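(* Let $m\in H^\infty$ be inner, $H=H^2\ominus mH^2$ with $\dim H\ge2$, and $T=P_HS|_H$ (so $m=m_T$ is the minimal/characteristic function of $T$). Suppose: (A) $m(\lambda)\not\equiv m(-\lambda)$ on $\mathbb D$; (B) for every $\lambda_0\in\mathbb D$ with $m(\lambda_0)=0$, the function $m_{\lambda_0}(\lambda)=m(\lambda)\Big/\dfrac{\lambda-\lambda_0}{1-\bar\lambda_0\lambda}$ satisfies $m_{\lambda_0}(\lambda)\not\equiv m_{\lambda_0}(-\lambda)$; (C) there exists a nonconstant inner divisor $p\in H^\infty$ of $m$ with $p(\lambda)=p(-\lambda)$ for all $\lambda\in\mathbb D$. Then (D) $T^2$ is irreducible, and (E) $\mathrm{Lat}\{T^2\}\ne\mathrm{Lat}\{T^2\}'$.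
   Context: $S$ is the unilateral shift $(Sh)(z)=zh(z)$ on the Hardy space $H^2$ of the unit disc $\mathbb D$; $P_H$ is the orthogonal projection onto $H$. Irreducible means having no closed subspace other than $\{0\}$ and the whole space invariant under both the operator and its adjoint. $\mathrm{Lat}\{X\}$ is the lattice of closed invariant subspaces of $X$; $\mathrm{Lat}\{X\}'$ is the lattice of hyperinvariant subspaces (closed subspaces invariant under every operator commuting with $X$). *)

(* Defs.v *)
From HB Require Import structures.
From mathcomp Require Import all_boot all_order all_algebra.
From mathcomp Require Import all_classical all_reals all_analysis.
From mathcomp Require Import complex.
Import Order.TTheory GRing.Theory Num.Theory.
Import numFieldTopology.Exports numFieldNormedType.Exports.

Set Implicit Arguments.
Unset Strict Implicit.
Unset Printing Implicit Defensive.

(** complex numbers as a normed field over themselves (topology, limits,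
    complex differentiability) *)
Set Warnings "-redundant-canonical-projection".
HB.instance Definition _ (R : rcfType) := PseudoPointedMetric.copy R[i] (R[i])^o.
HB.instance Definition _ (R : rcfType) := GRing.ComAlgebra.copy R[i] (R[i])^o.
HB.instance Definition _ (R : rcfType) := Vector.copy R[i] (R[i])^o.
HB.instance Definition _ (R : rcfType) := NormedModule.copy R[i] (R[i])^o.

Local Open Scope classical_set_scope.
Local Open Scope ring_scope.
Local Open Scope complex_scope.

Notation normc := (@ComplexField.Normc.normc _).

Section Hardy.
Variable R : realType.

(** Sequences of complex numbers: Taylor coefficients of elements of H^2. *)
Definition cseq := nat -> R[i].

Definition zero_seq : cseq := fun _ => 0.

Definition in_disc (z : R[i]) : Prop := normc z < 1.

(** H^2 = { h = sum a_n z^n : sum |a_n|^2 < oo }, identified with the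
    coefficient sequences. *)
Definition H2 : set cseq :=
  [set a | cvgn (series (fun n => normc (a n) ^+ 2))].

Definition ev (a : cseq) (z : R[i]) : R[i] :=
  limn (series (fun n => a n * z ^+ n)).

Definition ip (a b : cseq) : R[i] :=
  limn (series (fun n => a n * conjc (b n))).

Definition nrm (a : cseq) : R :=
  Num.sqrt (limn (series (fun n => normc (a n) ^+ 2))).

(** the unilateral shift (S h)(z) = z h(z) *)
Definition ushift (a : cseq) : cseq :=
  fun n => if n is k.+1 then a k else 0.

Definition holomorphic_on_disc (f : R[i] -> R[i]) : Prop :=
  forall z, in_disc z -> derivable f z 1.

Definition Hinf (f : R[i] -> R[i]) : Prop :=
  holomorphic_on_disc f /\ exists M : R, forall z, in_disc z -> normc (f z) <= M.

Definition cexpi (t : R) : R[i] := (cos t) +i* (sin t).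

Definition inner_fun (f : R[i] -> R[i]) : Prop :=
  Hinf f /\
  {ae (@lebesgue_measure R), forall t : R,
     exists l : R[i],
       (fun r : R => f (r%:C * cexpi t)) @ (1 : R)^'- --> l /\ normc l = 1}.

Definition mH2 (m : R[i] -> R[i]) : set cseq :=
  [set b | H2 b /\ exists a, H2 a /\ forall z, in_disc z -> ev b z = m z * ev a z].

Definition model_space (m : R[i] -> R[i]) : set cseq :=
  [set x | H2 x /\ forall y, mH2 m y -> ip x y = 0].

Definition is_proj (H : set cseq) (x y : cseq) : Prop :=
  H y /\ forall z, H z -> ip (fun n => x n - y n) z = 0.

Definition dim_ge2 (H : set cseq) : Prop :=
  exists x y, H x /\ H y /\
    forall al be : R[i], (forall n, al * x n + be * y n = 0) -> al = 0 /\ be = 0.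

Definition closed_subspace (H M : set cseq) : Prop :=
  M `<=` H /\ M zero_seq /\
  (forall (al : R[i]) x y, M x -> M y -> M (fun n => al * x n + y n)) /\
  (forall (u : nat -> cseq) y, (forall k, M (u k)) -> H y ->
     (fun k => nrm (fun n => u k n - y n)) @ \oo --> (0 : R) -> M y).

Definition op_invariant (A : cseq -> cseq) (M : set cseq) : Prop :=
  forall x, M x -> M (A x).

Definition is_adjoint (H : set cseq) (A B : cseq -> cseq) : Prop :=
  (forall x, H x -> H (B x)) /\
  forall x y, H x -> H y -> ip (A x) y = ip x (B y).

Definition op_irreducible (H : set cseq) (A : cseq -> cseq) : Prop :=
  forall M, closed_subspace H M -> op_invariant A M ->
    (forall B, is_adjoint H A B -> op_invariant B M) ->
    M = [set zero_seq] \/ M = H.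

Definition bounded_op (H : set cseq) (B : cseq -> cseq) : Prop :=
  (forall x, H x -> H (B x)) /\
  (forall (al : R[i]) x y, H x -> H y ->
     B (fun n => al * x n + y n) = (fun n => al * B x n + B y n)) /\
  exists K : R, forall x, H x -> nrm (B x) <= K * nrm x.

Definition Lat (H : set cseq) (A : cseq -> cseq) : set (set cseq) :=
  [set M | closed_subspace H M /\ op_invariant A M].

Definition Lat' (H : set cseq) (A : cseq -> cseq) : set (set cseq) :=
  [set M | closed_subspace H M /\
     forall B, bounded_op H B -> (forall x, H x -> B (A x) = A (B x)) ->
       op_invariant B M].

Definition blaschke (lam0 lam : R[i]) : R[i] :=
  (lam - lam0) / (1 - conjc lam0 * lam).

End Hardy.

(* Main.v *)
Require Import Defs.
From HB Require Import structures.
From mathcomp Require Import all_boot all_order all_algebra.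
From mathcomp Require Import all_classical all_reals all_analysis.
From mathcomp Require Import complex ring lra.
Import Order.TTheory GRing.Theory Num.Theory.
Import numFieldTopology.Exports numFieldNormedType.Exports.
Local Open Scope classical_set_scope.
Local Open Scope ring_scope.
Local Open Scope complex_scope.
Import ComplexField.Normc.

(** Identify [H^2] with square-summable Taylor coefficients and let [c] be those of [m].
A bounded holomorphic function has a Taylor series: Goursat bisection, applied to the
form [(f w - f z0) dw / (w - z0)] on the cone over a circle with apex [z0], yields Cauchy's
formula.  Parseval on circles and the unimodular radial limits make the functions
[z^k m] orthonormal, so [H] consists of the [x] orthogonal to all of them, and it contains
the backward shifts [S*^j m] for [j >= 1].

(E) [M = {x in H : x _|_ S*^(2k+1) p for all k}] is invariant under [T^2].  As [p] is even,
[M] contains [S*^2 p]; but [<T S*^2 p, S* p> = |S*^2 p|^2 <> 0], so [M] is not invariant under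
[T], which commutes with [T^2].

(D) Let [M] reduce [T^2] and [N = H - M].  Both are invariant under [S*^2], so the pairs
[(x 0, x 1)] with [x] in [M] are orthogonal to those with [x] in [N]; unless [M] or [N]
vanishes, they span a line [C (a, b)] and its orthogonal complement in [C^2].  The
projection [Q] onto the sequences all of whose pairs [(x (2n), x (2n+1))] lie on that
line maps [H] to itself and commutes with [S*^2], whence [Q] maps the span of [m] and
[z m] to itself.  Elements of the ranges of [Q] and [1 - Q] are even functions times
[a + b z], respectively [conj b - conj a z]; comparing [z] with [- z] shows that either
[m] is even, or [m l = 0] and [m / b_l] is even for some Blaschke factor [b_l]. *)

Set Implicit Arguments.
Unset Strict Implicit.
Unset Printing Implicit Defensive.

Local Notation Re := (@complex.Re _).
Local Notation Im := (@complex.Im _).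
Local Notation "z ^*" := (conjc z) : ring_scope.
Local Arguments ComplexField.Normc.normc : simpl never.

(** * Power series *)

Section ComplexModulus.
Variable R : realType.
Implicit Types (z w : R[i]) (x y : R).

Lemma normc_ge0 z : 0 <= normc z.
Proof. by case: z => a b; exact: sqrtr_ge0. Qed.

Lemma normc_eq0 z : (normc z == 0) = (z == 0).
Proof. by apply/eqP/eqP => [/eq0_normc//|->]; exact: normc0. Qed.

Lemma normc_gt0 z : (0 < normc z) = (z != 0).
Proof. by rewrite lt_neqAle normc_ge0 andbT eq_sym normc_eq0. Qed.

Lemma normcX z n : normc (z ^+ n) = normc z ^+ n.
Proof. by elim: n => [|n IH]; rewrite ?normc1// !exprS normcM IH. Qed.

Lemma normc_sub z w : normc (z - w) <= normc z + normc w.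
Proof. by rewrite -(normcN w); exact: le_normcD. Qed.

Lemma normc_distC z w : normc (z - w) = normc (w - z).
Proof. by rewrite -normcN opprB. Qed.

Lemma le_dist_normc z w : `|normc z - normc w| <= normc (z - w).
Proof.
have := le_normcD (z - w) w; have := le_normcD (w - z) z.
by rewrite !subrK normc_distC ler_norml; lra.
Qed.

Lemma normc_sum (F : nat -> R[i]) m n :
  normc (\sum_(m <= k < n) F k) <= \sum_(m <= k < n) normc (F k).
Proof.
elim/big_ind2: _ => [|x a y b xa yb|//]; first by rewrite normc0.
by rewrite (le_trans (le_normcD _ _))// lerD.
Qed.

Lemma normc_conj z : normc z^* = normc z.
Proof. by case: z => a b; rewrite /normc/= sqrrN. Qed.

Lemma normc_real x : normc x%:C = `|x|.
Proof. by rewrite /normc/= expr0n/= addr0 sqrtr_sqr. Qed.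

Lemma normc_nat n : normc (n%:R : R[i]) = n%:R :> R.
Proof. by rewrite -(rmorph_nat (real_complex R)) normc_real normr_nat. Qed.

Lemma sqr_normc_ReIm z : normc z ^+ 2 = Re z ^+ 2 + Im z ^+ 2.
Proof. by case: z => a b; rewrite /normc/= sqr_sqrtr// addr_ge0// sqr_ge0. Qed.

Lemma mulcJ z : z * z^* = (normc z ^+ 2)%:C.
Proof. by rewrite -sqr_normc rmorphXn. Qed.

Lemma Re_le_normc z : `|Re z| <= normc z.
Proof. by have := normc_ge_Re z; rewrite lecR. Qed.

Lemma Im_le_normc z : `|Im z| <= normc z.
Proof.
rewrite -(ger0_norm (normc_ge0 z)) -ler_sqr ?nnegrE// !real_normK ?num_real//.
by rewrite sqr_normc_ReIm lerDr sqr_ge0.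
Qed.

Lemma normci : normc (0 +i* 1 : R[i]) = 1.
Proof.
by apply/eqP; rewrite -sqrp_eq1 ?normc_ge0// sqr_normc_ReIm/= expr0n expr1n add0r.
Qed.

Lemma ReM z w : Re (z * w) = Re z * Re w - Im z * Im w.
Proof. by case: z => a b; case: w. Qed.

Lemma ImM z w : Im (z * w) = Re z * Im w + Im z * Re w.
Proof. by case: z => a b; case: w. Qed.

Lemma Re_conj z : Re z^* = Re z.
Proof. by case: z. Qed.

Lemma Im_conj z : Im z^* = - Im z.
Proof. by case: z. Qed.

Lemma complex_ext z w : Re z = Re w -> Im z = Im w -> z = w.
Proof. by case: z => a b; case: w => c d /= -> ->. Qed.

End ComplexModulus.

Section ComplexTopology.
Variable R : realType.

Lemma cvg_normcP {T : Type} (F : set_system T) {FF : Filter F} (f : T -> R[i]) (l : R[i]) :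
  f x @[x --> F] --> l <->
  forall e : R, 0 < e -> \forall x \near F, normc (l - f x) < e.
Proof.
split=> [/cvgrPdist_lt fl e e0|fl].
  have /fl : 0 < e%:C by rewrite ltcR.
  by apply: filterS => x; rewrite /= ltcR.
apply/cvgrPdist_lt => e e0; move: (e0); rewrite -(RRe_real (gtr0_real e0)) ltcR => /fl.
by apply: filterS => x; rewrite ltcR.
Qed.

Lemma nbhs_normc (z : R[i]) (e : R) : 0 < e -> \forall w \near z, normc (z - w) < e.
Proof. by move=> e0; apply: (@cvg_normcP _ (nbhs z) _ id z).1 => //; exact: cvg_id. Qed.

Lemma lipschitz1_continuous (g : R[i] -> R) :
  (forall z w, `|g z - g w| <= normc (z - w)) -> continuous g.
Proof.
move=> g_lip z; apply/(@cvgrPdist_lt _ _ _ (nbhs z)) => e e0.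
by apply: filterS (nbhs_normc z e0) => w; exact: le_lt_trans.
Qed.

Lemma continuous_normc : continuous (fun z : R[i] => normc z).
Proof. exact/lipschitz1_continuous/le_dist_normc. Qed.

Lemma continuous_Re : continuous (fun z : R[i] => Re z).
Proof. by apply: lipschitz1_continuous => z w; rewrite -raddfB Re_le_normc. Qed.

Lemma continuous_Im : continuous (fun z : R[i] => Im z).
Proof. by apply: lipschitz1_continuous => z w; rewrite -raddfB Im_le_normc. Qed.

Lemma continuous_conj : continuous (fun z : R[i] => z^*).
Proof.
move=> z; apply/(@cvg_normcP _ (nbhs z)) => e e0.
by apply: filterS (nbhs_normc z e0) => w; rewrite -rmorphB normc_conj.
Qed.

Lemma continuous_real_complex : continuous (fun x : R => x%:C).
Proof.
move=> x; apply/cvg_normcP => e e0.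
apply: filterS (nbhsx_ballx x _ e0) => y.
by rewrite /ball/= -rmorphB normc_real.
Qed.

Lemma cvg_complex {T : Type} (F : set_system T) {FF : Filter F} (f : T -> R[i]) (a b : R) :
  Re (f x) @[x --> F] --> a -> Im (f x) @[x --> F] --> b -> f x @[x --> F] --> a +i* b.
Proof.
move=> fa fb; rewrite [_ +i* _]complexE/=.
rewrite (_ : f = fun x => (Re (f x))%:C + 'i * (Im (f x))%:C); last first.
  by apply/funext => x; exact: complexE.
apply: cvgD; first exact: (continuous_cvg _ (@continuous_real_complex a) fa).
exact: (cvgM (cvg_cst 'i) (continuous_cvg _ (@continuous_real_complex b) fb)).
Qed.

Lemma cvg_normc_le {T : Type} (F : set_system T) {FF : ProperFilter F} (f : T -> R[i]) (l : R[i])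
    (B : R) : f x @[x --> F] --> l -> (forall x, normc (f x) <= B) -> normc l <= B.
Proof.
move=> /(continuous_cvg _ (@continuous_normc l)) fl fB.
by apply: (cvgr_to_le fl); exact: nearW.
Qed.

Lemma cvgc_lim (u : nat -> R[i]) (l : R[i]) : u @ \oo --> l -> limn u = l.
Proof. exact/cvg_lim/norm_hausdorff. Qed.

End ComplexTopology.

Section Series.
Variable R : realType.
Implicit Types (x y : nat -> R) (u v : nat -> R[i]).

Lemma nneg_series_is_cvg x B : (forall n, 0 <= x n) ->
  (forall n, series x n <= B) -> cvgn (series x).
Proof.
move=> x0 xB; apply: nondecreasing_is_cvgn; first exact: nondecreasing_series.
by exists B => _ [n _ <-].
Qed.

Lemma nneg_series_le_lim x n : (forall n, 0 <= x n) -> cvgn (series x) ->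
  series x n <= limn (series x).
Proof. by move=> x0 cx; apply: nondecreasing_cvgn_le => //; exact: nondecreasing_series. Qed.

Definition abs_summable u := cvgn (series (fun n => normc (u n))).

Lemma abs_summable_le u x : (forall n, normc (u n) <= x n) ->
  cvgn (series x) -> abs_summable u.
Proof.
move=> ux; apply: series_le_cvg => // n; first exact: normc_ge0.
exact: le_trans (normc_ge0 _) (ux n).
Qed.

Lemma abs_summable_is_cvg u : abs_summable u -> cvgn (series u).
Proof.
move=> su.
have is_cvg_le x : (forall n, `|x n| <= normc (u n)) -> cvgn (series x).
  by move=> xu; apply/normed_cvg/(series_le_cvg _ _ xu su) => n //=; exact: normc_ge0.
have cRe := is_cvg_le _ (fun n => Re_le_normc (u n)).
have cIm := is_cvg_le _ (fun n => Im_le_normc (u n)).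
suff su_lim : series u @ \oo --> limn (series (fun n => Re (u n))) +i*
    limn (series (fun n => Im (u n))) by exact: cvgP su_lim.
apply: cvg_complex.
  by rewrite (_ : (fun n => _) = series (fun n => Re (u n)))//;
    apply/funext => n; rewrite /series/= raddf_sum.
by rewrite (_ : (fun n => _) = series (fun n => Im (u n)))//;
  apply/funext => n; rewrite /series/= raddf_sum.
Qed.

Lemma normc_lim_series_le u : abs_summable u ->
  normc (limn (series u)) <= limn (series (fun n => normc (u n))).
Proof.
move=> su; apply: (cvg_normc_le (abs_summable_is_cvg su)) => n.
apply: le_trans (normc_sum _ _ _) _.
by apply: nneg_series_le_lim su => k; exact: normc_ge0.
Qed.

Lemma lim_series_conj u : cvgn (series u) ->
  limn (series (fun n => (u n)^*)) = (limn (series u))^*.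
Proof.
move=> su; rewrite (_ : series _ = fun n => (series u n)^*).
  by apply: cvgc_lim; exact: (continuous_cvg _ (@continuous_conj R _) su).
by apply/funext => n; rewrite /series/= raddf_sum.
Qed.

Lemma lim_series_recl u : cvgn (series u) ->
  limn (series u) = u 0%N + limn (series (fun n => u n.+1)).
Proof.
move=> su; suff -> : limn (series (fun n => u n.+1)) = limn (series u) - u 0%N by rewrite subrKC.
rewrite (_ : series (fun n => u n.+1) = fun n => series u n.+1 - u 0%N).
  by apply: cvgc_lim; apply: cvgB; [rewrite cvg_shiftS|exact: cvg_cst].
by apply/funext => n; rewrite /series/= big_nat_recl// [RHS]addrC addKr.
Qed.

End Series.

Section PowerSeries.
Variable R : realType.
Implicit Types (x y : cseq R) (z : R[i]).

Lemma near0_in_disc : \forall z \near (0 : R[i]), in_disc z.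
Proof. by apply: filterS (nbhs_normc 0 ltr01) => z; rewrite sub0r normcN. Qed.

Lemma in_discN z : in_disc (- z) <-> in_disc z.
Proof. by rewrite /in_disc normcN. Qed.

Lemma in_disc_segment z w (l : R) : in_disc z -> in_disc w -> 0 <= l <= 1 ->
  in_disc (z + l%:C * (w - z)).
Proof.
rewrite /in_disc => z1 w1 /andP[l0 l1].
have -> : z + l%:C * (w - z) = (1 - l)%:C * z + l%:C * w by rewrite rmorphB; ring.
apply: le_lt_trans (le_normcD _ _) _.
rewrite !normcM !normc_real !ger0_norm ?subr_ge0//.
have [->|l_neq0] := eqVneq l 0; first by rewrite subr0 mul0r addr0 mul1r.
have := ler_wpM2l _ (ltW z1) => /(_ (1 - l)); rewrite subr_ge0 => /(_ l1).
have : l * normc w < l by rewrite gtr_pMr// lt_neqAle eq_sym l_neq0.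
lra.
Qed.

Definition coef_bound (B : R) x := forall n, normc (x n) <= B.

Definition bounded_seq x := exists B, coef_bound B x.

Definition bshift x : cseq R := fun n => x n.+1.

Lemma coef_bound_ge0 B x : coef_bound B x -> 0 <= B.
Proof. by move=> /(_ 0%N); apply: le_trans; exact: normc_ge0. Qed.

Lemma bounded_seqD x y : bounded_seq x -> bounded_seq y -> bounded_seq (x + y).
Proof.
move=> [A xA] [B yB]; exists (A + B) => n.
by apply: le_trans (le_normcD _ _) _; exact: lerD.
Qed.

Lemma bounded_seqZ (a : R[i]) x : bounded_seq x -> bounded_seq (a *: x).
Proof.
move=> [B xB]; exists (normc a * B) => n.
by rewrite [normc _]normcM ler_wpM2l ?normc_ge0.
Qed.

Lemma bounded_seqN x : bounded_seq x -> bounded_seq (- x).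
Proof. by rewrite -scaleN1r; exact: bounded_seqZ. Qed.

Lemma bounded_seq_alt x : bounded_seq x -> bounded_seq (fun n => (-1) ^+ n * x n).
Proof.
by move=> [B xB]; exists B => n; rewrite normcM normcX normcN normc1 expr1n mul1r.
Qed.

Lemma bounded_seq_bshift x : bounded_seq x -> bounded_seq (bshift x).
Proof. by move=> [B xB]; exists B => n; exact: xB. Qed.

Lemma bounded_seq_ushift x : bounded_seq x -> bounded_seq (ushift x).
Proof.
move=> [B xB]; exists B => -[|n]; last exact: xB.
by rewrite normc0; exact: coef_bound_ge0 xB.
Qed.

Lemma geometric_cvg (B z : R) : 0 <= z < 1 ->
  series (geometric B z) @ \oo --> B / (1 - z).
Proof. by move=> /andP[z0 z1]; apply: cvg_geometric_series; rewrite ger0_norm. Qed.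

Lemma normc_ev_term_le B x z n : coef_bound B x ->
  normc (x n * z ^+ n) <= geometric B (normc z) n.
Proof. by move=> xB; rewrite normcM normcX ler_wpM2r// exprn_ge0// normc_ge0. Qed.

Lemma ev_abs_summable x z : bounded_seq x -> in_disc z ->
  abs_summable (fun n => x n * z ^+ n).
Proof.
move=> [B xB] z1; apply: abs_summable_le (fun n => normc_ev_term_le z n xB) _.
by apply: cvgP; apply: geometric_cvg; rewrite normc_ge0.
Qed.

Lemma ev_cvg x z : bounded_seq x -> in_disc z ->
  series (fun n => x n * z ^+ n) @ \oo --> ev x z.
Proof. by move=> xb z1; apply: abs_summable_is_cvg; exact: ev_abs_summable. Qed.

Lemma normc_ev_le B x z : coef_bound B x -> in_disc z ->
  normc (ev x z) <= B / (1 - normc z).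
Proof.
move=> xB z1; have z01 : 0 <= normc z < 1 by rewrite normc_ge0.
have sx : abs_summable (fun n => x n * z ^+ n) by apply: ev_abs_summable => //; exists B.
apply: le_trans (normc_lim_series_le sx) _; rewrite -(cvg_lim _ (@geometric_cvg B _ z01))//.
apply: lim_series_le => // [|n]; last exact: normc_ev_term_le.
by apply: cvgP; exact: geometric_cvg.
Qed.

Lemma evD x y z : bounded_seq x -> bounded_seq y -> in_disc z ->
  ev (x + y) z = ev x z + ev y z.
Proof.
move=> xb yb z1; rewrite /ev -(lim_seriesD (ev_cvg xb z1) (ev_cvg yb z1)).
by congr (limn (series _)); apply/funext => n; rewrite -mulrDl.
Qed.

Lemma evZ (a : R[i]) x z : bounded_seq x -> in_disc z -> ev (a *: x) z = a * ev x z.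
Proof.
move=> xb z1; rewrite -[RHS](lim_seriesZ _ (ev_cvg xb z1)).
by congr (limn (series _)); apply/funext => n; exact: esym (mulrA _ _ _).
Qed.

Lemma evB x y z : bounded_seq x -> bounded_seq y -> in_disc z ->
  ev (x - y) z = ev x z - ev y z.
Proof.
move=> xb yb z1; rewrite evD//; last exact: bounded_seqN.
by rewrite -scaleN1r evZ// mulN1r.
Qed.

Lemma ev0 z : ev 0 z = 0.
Proof.
apply: cvgc_lim; rewrite (_ : series _ = cst 0); first exact: cvg_cst.
by apply/funext => n; apply: big1 => k _; rewrite mul0r.
Qed.

Lemma ev_recl x z : bounded_seq x -> in_disc z ->
  ev x z = x 0%N + z * ev (bshift x) z.
Proof.
move=> xb z1; rewrite {1}/ev lim_series_recl; last exact: ev_cvg.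
rewrite expr0 mulr1 -[z * _]lim_seriesZ; last exact: ev_cvg (bounded_seq_bshift xb) z1.
congr (_ + limn (series _)); apply/funext => n.
by rewrite exprS mulrCA.
Qed.

Lemma ev_ushift x z : bounded_seq x -> in_disc z -> ev (ushift x) z = z * ev x z.
Proof. by move=> xb z1; rewrite (ev_recl (bounded_seq_ushift xb) z1) add0r. Qed.

Lemma ev_opp x z : ev x (- z) = ev (fun n => (-1) ^+ n * x n) z.
Proof.
by congr (limn (series _)); apply/funext => n; rewrite (exprNn z n) mulrCA mulrA.
Qed.

Lemma near0_ev_neq0 x : bounded_seq x -> x 0%N != 0 -> \forall z \near 0, ev x z != 0.
Proof.
move=> [B xB] x0; have B0 := coef_bound_ge0 xB.
have nx0 : 0 < normc (x 0%N) by rewrite normc_gt0.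
have e0 : 0 < normc (x 0%N) / (B + normc (x 0%N)) by rewrite divr_gt0// ltr_wpDl.
apply: filterS (nbhs_normc 0 e0) => z; rewrite sub0r normcN => zx.
have z1 : in_disc z.
  by apply: lt_le_trans zx _; rewrite ler_pdivrMr ?ltr_wpDl// mul1r lerDr.
apply/eqP; rewrite ev_recl//; last by exists B.
move=> /eqP; rewrite addr_eq0 => /eqP/(congr1 (@normc R)); rewrite normcN normcM => x0E.
have sxB : coef_bound B (bshift x) by move=> n; exact: xB.
have := normc_ev_le sxB z1; rewrite ler_pdivlMr ?subr_gt0// => evB.
move: zx; rewrite ltr_pdivlMr ?ltr_wpDl// x0E.
have := ler_wpM2l (normc_ge0 z) evB; lra.
Qed.

Lemma dnbhs0_ev_neq0 x : bounded_seq x -> x != 0 -> \forall z \near 0^', ev x z != 0.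
Proof.
move=> xb /eqP x_neq0; have [n xn] : exists n, x n != 0.
  by apply: contra_notP x_neq0 => /forallNP x0; apply/funext => n; apply/eqP/negPn/negP/x0.
elim: n x xb {x_neq0} xn => [|n IH] x xb xn; first exact/nbhs_dnbhs/near0_ev_neq0.
have [x0|x0] := eqVneq (x 0%N) 0; last exact/nbhs_dnbhs/near0_ev_neq0.
near=> z; rewrite ev_recl//; last by near: z; exact/nbhs_dnbhs/near0_in_disc.
rewrite x0 add0r mulf_neq0//; first by near: z; exact: nbhs_dnbhs_neq.
by near: z; exact: (IH _ (bounded_seq_bshift xb)).
Unshelve. all: by end_near. Qed.

Lemma ev_inj x y : bounded_seq x -> bounded_seq y ->
  (\forall z \near 0^', ev x z = ev y z) -> x = y.
Proof.
move=> xb yb xy; apply/eqP; rewrite -subr_eq0; apply/negPn/negP => xy0.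
have xyb := bounded_seqD xb (bounded_seqN yb).
have : \forall z \near (0 : R[i])^', False.
  near=> z; have /eqP : ev (x - y) z != 0 by near: z; exact: dnbhs0_ev_neq0.
  apply; rewrite evB//; last by near: z; exact/nbhs_dnbhs/near0_in_disc.
  by apply/eqP; rewrite subr_eq0; apply/eqP; near: z.
by move=> /filter_const.
Unshelve. all: by end_near. Qed.

Lemma ev_inj_disc x y : bounded_seq x -> bounded_seq y ->
  (forall z, in_disc z -> ev x z = ev y z) -> x = y.
Proof.
by move=> xb yb xy; apply: ev_inj => //; apply/nbhs_dnbhs/(filterS xy)/near0_in_disc.
Qed.

End PowerSeries.

(** * The Hilbert space H^2 *)

Section HardySpace.
Variable R : realType.
Implicit Types (x y w : cseq R) (a : R[i]).

Definition nrm2 x : R := limn (series (fun n => normc (x n) ^+ 2)).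

Lemma H2_bound x B : (forall n, series (fun n => normc (x n) ^+ 2) n <= B) ->
  H2 x /\ nrm2 x <= B.
Proof.
move=> xB; have xH : H2 x.
  by apply: (@nneg_series_is_cvg _ _ B) => // n; exact: sqr_ge0.
by split=> //; apply: limr_le => //; exact: nearW.
Qed.

Lemma series_le_nrm2 x n : H2 x -> series (fun n => normc (x n) ^+ 2) n <= nrm2 x.
Proof. by move=> xH; apply: nneg_series_le_lim => // k; exact: sqr_ge0. Qed.

Lemma nrm2_ge0 x : H2 x -> 0 <= nrm2 x.
Proof. by move=> xH; have := series_le_nrm2 0 xH; rewrite /series/= big_geq. Qed.

Lemma nrm_ge0 x : 0 <= nrm x.
Proof. exact: sqrtr_ge0. Qed.

Lemma sqr_nrm x : H2 x -> nrm x ^+ 2 = nrm2 x.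
Proof. by move=> xH; rewrite sqr_sqrtr// nrm2_ge0. Qed.

Lemma nrm_le_sqr x (e : R) : H2 x -> 0 <= e -> (nrm x <= e) = (nrm2 x <= e ^+ 2).
Proof. by move=> xH e0; rewrite -sqr_nrm// ler_sqr ?nnegrE ?nrm_ge0. Qed.

Lemma coef_le_nrm2 x n : H2 x -> normc (x n) ^+ 2 <= nrm2 x.
Proof.
move=> xH; apply: le_trans (series_le_nrm2 n.+1 xH).
by rewrite /series/= big_nat_recr//= lerDr; apply: sumr_ge0 => i _; exact: sqr_ge0.
Qed.

Lemma coef_bound_nrm x : H2 x -> coef_bound (nrm x) x.
Proof.
by move=> xH n; rewrite -ler_sqr ?nnegrE ?normc_ge0 ?nrm_ge0// sqr_nrm// coef_le_nrm2.
Qed.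

Lemma H2_bounded_seq x : H2 x -> bounded_seq x.
Proof. by move=> xH; exists (nrm x); exact: coef_bound_nrm. Qed.

Lemma normc_ev_le_nrm x z : H2 x -> in_disc z -> normc (ev x z) <= nrm x / (1 - normc z).
Proof. by move=> xH z1; exact: normc_ev_le (coef_bound_nrm xH) z1. Qed.

Lemma nrm2_eq0 x : H2 x -> nrm2 x = 0 -> x = 0.
Proof.
move=> xH x0; apply/funext => n; apply/eqP; rewrite -normc_eq0 -sqrf_eq0.
by rewrite eq_le sqr_ge0 andbT -x0 coef_le_nrm2.
Qed.

Lemma nrm2_gt0 x : H2 x -> x != 0 -> 0 < nrm2 x.
Proof.
move=> xH x0; rewrite lt_neqAle nrm2_ge0// andbT eq_sym.
by apply: contra x0 => /eqP/(nrm2_eq0 xH)->.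
Qed.

Lemma H2_0 : H2 (0 : cseq R).
Proof.
apply: (H2_bound (B := 0) _).1 => n; rewrite /series/= big1// => i _.
by rewrite normc0 expr0n.
Qed.

Lemma H2D x y : H2 x -> H2 y -> H2 (x + y).
Proof.
move=> xH yH; apply: (H2_bound (B := 2 * nrm2 x + 2 * nrm2 y) _).1 => n.
apply: (@le_trans _ _ (2 * series (fun n => normc (x n) ^+ 2) n +
   2 * series (fun n => normc (y n) ^+ 2) n)); last first.
  by apply: lerD; rewrite ler_pM2l// series_le_nrm2.
rewrite /series/= !mulr_sumr -big_split/=; apply: ler_sum => k _.
have := le_normcD (x k) (y k); have := normc_ge0 ((x + y) k).
have := sqr_ge0 (normc (x k) - normc (y k)); nra.
Qed.

Lemma H2Z a x : H2 x -> H2 (a *: x).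
Proof.
move=> xH; apply: (H2_bound (B := normc a ^+ 2 * nrm2 x) _).1 => n.
apply: le_trans (ler_wpM2l (sqr_ge0 _) (series_le_nrm2 n xH)).
by rewrite /series/= mulr_sumr; apply: ler_sum => k _; rewrite normcM exprMn.
Qed.

Global Arguments H2Z a {x} _.

Lemma H2N x : H2 x -> H2 (- x).
Proof. by rewrite -scaleN1r; exact: H2Z. Qed.

Lemma H2B x y : H2 x -> H2 y -> H2 (x - y).
Proof. by move=> xH yH; apply: H2D => //; exact: H2N. Qed.

Lemma ip_abs_summable x y : H2 x -> H2 y -> abs_summable (fun n => x n * (y n)^*).
Proof.
move=> xH yH; apply: (abs_summable_le (x := fun n => normc (x n) ^+ 2 + normc (y n) ^+ 2)).
  move=> n; rewrite normcM normc_conj.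
  have := sqr_ge0 (normc (x n) - normc (y n)).
  have := mulr_ge0 (normc_ge0 (x n)) (normc_ge0 (y n)); lra.
exact: is_cvg_seriesD.
Qed.

Lemma ip_cvg x y : H2 x -> H2 y -> series (fun n => x n * (y n)^*) @ \oo --> ip x y.
Proof. by move=> xH yH; apply: abs_summable_is_cvg; exact: ip_abs_summable. Qed.

Lemma ipDl x y w : H2 x -> H2 y -> H2 w -> ip (x + y) w = ip x w + ip y w.
Proof.
move=> xH yH wH; rewrite /ip -(lim_seriesD (ip_cvg xH wH) (ip_cvg yH wH)).
by congr (limn (series _)); apply/funext => n; rewrite -mulrDl.
Qed.

Lemma ipZl a x w : H2 x -> H2 w -> ip (a *: x) w = a * ip x w.
Proof.
move=> xH wH; rewrite -[RHS](lim_seriesZ _ (ip_cvg xH wH)).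
by congr (limn (series _)); apply/funext => n; exact: esym (mulrA _ _ _).
Qed.

Lemma ipC x y : H2 x -> H2 y -> ip y x = (ip x y)^*.
Proof.
move=> xH yH; rewrite /ip -(lim_series_conj (ip_cvg xH yH)); congr (limn (series _)).
by apply/funext => n; rewrite rmorphM/= conjcK mulrC.
Qed.

Lemma ip0l w : ip 0 w = 0.
Proof.
apply: cvgc_lim; rewrite (_ : series _ = cst 0); first exact: cvg_cst.
by apply/funext => n; apply: big1 => i _; rewrite mul0r.
Qed.

Lemma ip0r w : H2 w -> ip w 0 = 0.
Proof. by move=> wH; rewrite (ipC H2_0 wH) ip0l conjc0. Qed.

Lemma ipNl x w : H2 x -> H2 w -> ip (- x) w = - ip x w.
Proof. by move=> xH wH; rewrite -scaleN1r ipZl// mulN1r. Qed.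

Lemma ipBl x y w : H2 x -> H2 y -> H2 w -> ip (x - y) w = ip x w - ip y w.
Proof. by move=> xH yH wH; rewrite ipDl ?ipNl//; exact: H2N. Qed.

Lemma ipZr a x w : H2 x -> H2 w -> ip x (a *: w) = a^* * ip x w.
Proof. by move=> xH wH; rewrite (ipC (H2Z a wH) xH) ipZl// rmorphM/= -ipC. Qed.

Lemma ipDr x y w : H2 x -> H2 y -> H2 w -> ip w (x + y) = ip w x + ip w y.
Proof. by move=> xH yH wH; rewrite (ipC (H2D xH yH) wH) ipDl// rmorphD/= -!ipC. Qed.

Lemma ipBr x y w : H2 x -> H2 y -> H2 w -> ip w (x - y) = ip w x - ip w y.
Proof. by move=> xH yH wH; rewrite (ipC (H2B xH yH) wH) ipBl// rmorphB/= -!ipC. Qed.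

Lemma ip_self x : H2 x -> ip x x = (nrm2 x)%:C.
Proof.
move=> xH; rewrite /ip (_ : series _ = real_complex R \o series (fun n => normc (x n) ^+ 2)).
  by apply: cvgc_lim; exact: (continuous_cvg _ (@continuous_real_complex R _) xH).
by apply/funext => n; rewrite /series/= raddf_sum/=; apply: eq_bigr => i _; rewrite mulcJ.
Qed.

Lemma nrm2Z a x : H2 x -> nrm2 (a *: x) = normc a ^+ 2 * nrm2 x.
Proof.
move=> xH; have axH := H2Z a xH; apply: complexI.
by rewrite -ip_self// ipZl// ipZr// ip_self// mulrA mulcJ [RHS]rmorphM.
Qed.

Lemma parallelogram x y : H2 x -> H2 y ->
  nrm2 (x - y) + nrm2 (x + y) = (nrm2 x + nrm2 y) *+ 2.
Proof.
move=> xH yH; have sH := H2D xH yH; have dH := H2B xH yH; apply: complexI.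
rewrite rmorphMn !rmorphD/= -!ip_self//.
by rewrite ipBl// !ipBr// ipDl// !ipDr//; ring.
Qed.

Lemma nrm2B_proj x y : H2 x -> H2 y -> y != 0 ->
  nrm2 (x - (ip x y / (nrm2 y)%:C) *: y) = nrm2 x - normc (ip x y) ^+ 2 / nrm2 y.
Proof.
move=> xH yH /(nrm2_gt0 yH) y0; set a := ip x y / _; have ayH := H2Z a yH.
have yC0 : (nrm2 y)%:C != 0 by rewrite fmorph_eq0 gt_eqF.
have aJ : a^* = (ip x y)^* / (nrm2 y)%:C.
  by rewrite rmorphM fmorphV; congr (_ / _); exact: conjc_real.
apply: complexI; rewrite -ip_self; last exact: H2B.
rewrite ipBl ?ipBr ?ipZl ?ipZr//; last exact: H2B.
have -> : (nrm2 x - normc (ip x y) ^+ 2 / nrm2 y)%:C =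
    (nrm2 x)%:C - ip x y * (ip x y)^* / (nrm2 y)%:C.
  by rewrite mulcJ -fmorphV -rmorphM -rmorphB.
by rewrite !ip_self// (ipC xH yH) aJ /a; field.
Qed.

Lemma ip_cauchy_schwarz x y : H2 x -> H2 y -> normc (ip x y) <= nrm x * nrm y.
Proof.
move=> xH yH; have [->|y0] := eqVneq y 0.
  by rewrite ip0r// normc0 mulr_ge0 ?nrm_ge0.
rewrite -ler_sqr ?nnegrE ?mulr_ge0 ?nrm_ge0 ?normc_ge0// exprMn !sqr_nrm//.
rewrite -ler_pdivrMr ?nrm2_gt0// -subr_ge0 -nrm2B_proj//.
by apply: nrm2_ge0; apply: H2B => //; exact: H2Z.
Qed.

Lemma nrmD x y : H2 x -> H2 y -> nrm (x + y) <= nrm x + nrm y.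
Proof.
move=> xH yH; rewrite nrm_le_sqr ?addr_ge0 ?nrm_ge0//; last exact: H2D.
have -> : nrm2 (x + y) = nrm2 x + nrm2 y + 2 * Re (ip x y).
  have := ip_self (H2D xH yH); rewrite ipDl ?ipDr//; try exact: H2D.
  rewrite (ipC xH yH) !ip_self// => /(congr1 (fun z => Re z)); rewrite !raddfD/= Re_conj; lra.
have := ip_cauchy_schwarz xH yH; have := Re_le_normc (ip x y); have := ler_norm (Re (ip x y)).
by rewrite sqrrD !sqr_nrm//; lra.
Qed.

Lemma nrm2N x : H2 x -> nrm2 (- x) = nrm2 x.
Proof. by move=> xH; rewrite -scaleN1r nrm2Z// normcN normc1 expr1n mul1r. Qed.

Lemma nrmN x : H2 x -> nrm (- x) = nrm x.
Proof. by move=> /nrm2N E; rewrite /nrm -!/(nrm2 _) E. Qed.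

Lemma le_dist_nrm x y : H2 x -> H2 y -> `|nrm x - nrm y| <= nrm (x - y).
Proof.
move=> xH yH; have := nrmD (H2B xH yH) yH; have := nrmD (H2B yH xH) xH.
by rewrite !subrK -opprB nrmN ?ler_norml; [lra|exact: H2B].
Qed.

End HardySpace.

Section ClosedSubspaces.
Variable R : realType.
Implicit Types (x y w : cseq R) (a : R[i]) (H M K A : set (cseq R)).

Definition nrm_cvg (u : nat -> cseq R) y := nrm (u k - y) @[k --> \oo] --> (0 : R).

Lemma nrm_cvgP (u : nat -> cseq R) y :
  nrm_cvg u y <-> forall e : R, 0 < e -> \forall k \near \oo, nrm (u k - y) < e.
Proof.
have nrm0 k : `|0 - nrm (u k - y)| = nrm (u k - y) by rewrite sub0r normrN ger0_norm ?nrm_ge0.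
split=> [/cvgrPdist_lt uy e /uy|uy]; first by under eq_near do rewrite nrm0.
by apply/cvgrPdist_lt => e /uy; under [X in _ -> X]eq_near do rewrite nrm0.
Qed.

Lemma nrm_cvg_subl (u : nat -> cseq R) x y : (forall k, H2 (u k)) -> H2 x -> H2 y ->
  nrm_cvg u y -> nrm (x - u k) @[k --> \oo] --> nrm (x - y).
Proof.
move=> uH xH yH /nrm_cvgP uy; apply/cvgrPdist_lt => e /uy.
apply: filterS => k; apply: le_lt_trans.
have -> : u k - y = (x - y) - (x - u k) by rewrite opprB [RHS]addrC addrA subrK.
by apply: le_dist_nrm; exact: H2B.
Qed.

Lemma nrm_cvg_ip (u : nat -> cseq R) y w : (forall k, H2 (u k)) -> H2 y -> H2 w ->
  nrm_cvg u y -> ip (u k) w @[k --> \oo] --> ip y w.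
Proof.
move=> uH yH wH /nrm_cvgP uy; apply/cvg_normcP => e e0.
have w0 : 0 < nrm w + 1 by rewrite ltr_wpDl ?nrm_ge0.
apply: filterS (uy _ (divr_gt0 e0 w0)) => k; rewrite ltr_pdivlMr// => uyk.
rewrite normc_distC -ipBl//; have uyH := H2B (uH k) yH.
apply: le_lt_trans (ip_cauchy_schwarz uyH wH) _.
by apply: le_lt_trans uyk; rewrite ler_wpM2l ?nrm_ge0// lerDl.
Qed.

Definition orth A := [set x | H2 x /\ forall y, A y -> ip x y = 0].

Lemma orth_closed_subspace A : A `<=` @H2 R -> closed_subspace (@H2 R) (orth A).
Proof.
move=> AH; split=> [x []//|]; split; first by split=> [|y _]; [exact: H2_0|exact: ip0l].
split=> [a x y [xH xA] [yH yA]|u y uA yH uy].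
  rewrite -[fun n => _]/(a *: x + y); split=> [|w wA]; first exact: (H2D (H2Z a xH) yH).
  rewrite (ipDl (H2Z a xH) yH (AH _ wA)) ipZl//; last exact: AH.
  by rewrite xA// yA// mulr0 addr0.
split=> // w wA; have uH k : H2 (u k) by case: (uA k).
rewrite -(cvgc_lim (nrm_cvg_ip uH yH (AH _ wA) uy)).
by apply: cvgc_lim; under eq_fun do rewrite (uA _).2//; exact: cvg_cst.
Qed.

Lemma closed_subspace_sub H M : closed_subspace H M -> M `<=` H.
Proof. by case. Qed.

Lemma closed_subspace0 H M : closed_subspace H M -> M 0.
Proof. by case=> _ []. Qed.

Lemma closed_subspaceD H M x y : closed_subspace H M -> M x -> M y -> M (x + y).
Proof. by move=> [_ [_ [Mlin _]]] Mx My; rewrite -[x]scale1r; exact: Mlin. Qed.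

Lemma closed_subspaceZ H M a x : closed_subspace H M -> M x -> M (a *: x).
Proof. by move=> [_ [M0 [Mlin _]]] Mx; rewrite -[_ *: _]addr0; exact: Mlin. Qed.

Lemma closed_subspaceB H M x y : closed_subspace H M -> M x -> M y -> M (x - y).
Proof.
move=> Mcl Mx My; rewrite -scaleN1r.
exact: closed_subspaceD Mcl Mx (closed_subspaceZ _ Mcl My).
Qed.

Lemma closed_subspaceI H K : closed_subspace (@H2 R) H -> closed_subspace (@H2 R) K ->
  closed_subspace H (H `&` K).
Proof.
move=> Hcl Kcl; have [HH [H0 [Hlin Hlim]]] := Hcl; have [_ [K0 [Klin Klim]]] := Kcl.
split; first exact: subIsetl.
split; first by split.
split=> [a x y [Hx Kx] [Hy Ky]|u y uHK Hy uy]; first by split; [exact: Hlin|exact: Klin].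
by split=> //; apply: (Klim u) => // [k|]; [case: (uHK k)|exact: HH].
Qed.

Lemma closed_subspace_trans H M : closed_subspace (@H2 R) H -> closed_subspace H M ->
  closed_subspace (@H2 R) M.
Proof.
move=> [HH [_ [_ Hlim]]] [MH [M0 [Mlin Mlim]]]; split; first exact: subset_trans HH.
split=> //; split=> // u y uM yH uy; apply: (Mlim u) => //.
by apply: (Hlim u) => // k; exact: MH.
Qed.

Definition nrm2_cauchy (u : nat -> cseq R) := forall e : R, 0 < e ->
  exists N, forall k l, (N <= k)%N -> (N <= l)%N -> nrm2 (u k - u l) <= e.

Lemma nrm2_cauchy_coord_cvg (u : nat -> cseq R) n :
  (forall k, H2 (u k)) -> nrm2_cauchy u -> cvgn (fun k => u k n).
Proof.
move=> uH u_cauchy.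
have is_cvg_lipschitz1 (g : R[i] -> R) : (forall z t, `|g z - g t| <= normc (z - t)) ->
    cvgn (fun k => g (u k n)).
  move=> g_lip; apply: cauchy_cvg; apply: cauchy_exP => e e0.
  have e2 : 0 < (e / 2) ^+ 2 by rewrite exprn_gt0// divr_gt0.
  have [N uN] := u_cauchy _ e2; exists (g (u N n)); exists N => // k Nk.
  rewrite /ball/=; apply: le_lt_trans (g_lip _ _) _.
  have := le_trans (coef_le_nrm2 n (H2B (uH N) (uH k))) (uN _ _ (leqnn N) Nk).
  rewrite ler_sqr ?nnegrE ?normc_ge0 ?divr_ge0 ?(ltW e0)// => /le_lt_trans; apply.
  by rewrite ltr_pdivrMr// ltr_pMr// ltr1n.
apply: cvgP; apply: cvg_complex; apply: is_cvg_lipschitz1 => z w; rewrite -raddfB.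
  exact: Re_le_normc.
exact: Im_le_normc.
Qed.

Lemma nrm2_coord_lim_le (u : nat -> cseq R) x y (e : R) : (forall k, H2 (u k)) -> H2 x ->
  (forall n, u k n @[k --> \oo] --> y n) -> (\forall k \near \oo, nrm2 (x - u k) <= e) ->
  H2 (x - y) /\ nrm2 (x - y) <= e.
Proof.
move=> uH xH uy xu; apply: H2_bound => K.
have xuy : series (fun n => normc ((x - u k) n) ^+ 2) K @[k --> \oo] -->
    series (fun n => normc ((x - y) n) ^+ 2) K.
  rewrite /series/=; apply: cvg_big => [|n _]; first exact: add_continuous.
  have xun : normc (x n - u k n) @[k --> \oo] --> normc (x n - y n).
    exact: (continuous_cvg _ (@continuous_normc R _) (cvgB (cvg_cst _) (uy n))).
  exact: (cvgM xun xun).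
apply: (cvgr_to_le xuy); apply: filterS xu => k; apply: le_trans.
by apply: series_le_nrm2; exact: H2B.
Qed.

Lemma H2_complete (u : nat -> cseq R) : (forall k, H2 (u k)) -> nrm2_cauchy u ->
  exists2 y, H2 y & nrm_cvg u y.
Proof.
move=> uH u_cauchy.
have /choice[y uy] : forall n, exists l : R[i], u k n @[k --> \oo] --> l.
  by move=> n; apply/cvg_ex; exact: nrm2_cauchy_coord_cvg.
have uy_le (e : R) : 0 < e -> \forall k \near \oo, H2 (u k - y) /\ nrm2 (u k - y) <= e.
  move=> /u_cauchy[N uN]; exists N => // k Nk; apply: (nrm2_coord_lim_le uH) => //.
  by exists N => // l; exact: uN.
exists y.
  have [N _ /(_ N (leqnn N))[uyH _]] := uy_le _ ltr01.
  by rewrite -[y](subKr (u N)); exact: H2B.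
apply/nrm_cvgP => e e0; have e2 : 0 < e / 2 by rewrite divr_gt0.
apply: filterS (uy_le _ (exprn_gt0 2 e2)) => k [uyH uyk].
by rewrite (@le_lt_trans _ _ (e / 2))// ?nrm_le_sqr ?(ltW e2)//; lra.
Qed.

Lemma minimizer_orthogonal M x y : closed_subspace (@H2 R) M -> H2 x -> M y ->
  (forall w, M w -> nrm2 (x - y) <= nrm2 (x - w)) -> forall w, M w -> ip (x - y) w = 0.
Proof.
move=> Mcl xH My y_min w Mw; have MH := closed_subspace_sub Mcl.
have wH := MH _ Mw; have [->|w0] := eqVneq w 0; first by rewrite ip0r//; exact: H2B xH (MH _ My).
have xyH := H2B xH (MH _ My); have nw := nrm2_gt0 wH w0.
have := y_min _ (closed_subspaceD Mcl My
  (closed_subspaceZ (ip (x - y) w / (nrm2 w)%:C) Mcl Mw)).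
rewrite opprD addrA nrm2B_proj// lerBrDr gerDl pmulr_lle0 ?invr_gt0// => ip_le0.
by apply/eqP; rewrite -normc_eq0 -sqrf_eq0 eq_le ip_le0 sqr_ge0.
Qed.

Lemma minimizing_cauchy M x (d : R) (u : nat -> cseq R) : closed_subspace (@H2 R) M -> H2 x ->
  (forall w, M w -> d <= nrm2 (x - w)) ->
  (forall k, M (u k) /\ nrm2 (x - u k) < d + k.+1%:R^-1) -> nrm2_cauchy u.
Proof.
move=> Mcl xH d_le u_min e e0; have MH := closed_subspace_sub Mcl.
have uM k : M (u k) by case: (u_min k).
have xuH k : H2 (x - u k) := H2B xH (MH _ (uM k)).
have e4 : 0 < e / 4 by rewrite divr_gt0.
have [N _ invN] : \forall k \near \oo, (k.+1%:R : R)^-1 < e / 4.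
  have /cvgrPdist_lt/(_ _ e4) := @cvg_harmonic R.
  by apply: filterS => k; rewrite /= sub0r normrN ger0_norm.
exists N => k l Nk Nl; pose v : cseq R := 2^-1 *: (u k + u l).
have vM : M v by apply: (closed_subspaceZ _ Mcl); exact: closed_subspaceD Mcl (uM k) (uM l).
have := parallelogram (xuH l) (xuH k).
have -> : x - u l - (x - u k) = u k - u l by rewrite opprB addrC addrA subrK.
have -> : x - u l + (x - u k) = 2%:R *: (x - v).
  rewrite scalerBr scalerA divff ?pnatr_eq0// scale1r scaler_nat mulr2n.
  by rewrite addrACA -opprD (addrC (u l)).
rewrite nrm2Z; last exact: H2B xH (MH _ vM).
rewrite normc_nat; have := d_le _ vM; have := (u_min k).2; have := (u_min l).2.
have := invN _ Nk; have := invN _ Nl.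
by move: (k.+1%:R^-1) (l.+1%:R^-1) => p q; lra.
Qed.

Lemma hilbert_projection M x : closed_subspace (@H2 R) M -> H2 x ->
  exists2 y, M y & forall w, M w -> ip (x - y) w = 0.
Proof.
move=> Mcl xH; have [MH [M0 [_ Mlim]]] := Mcl.
pose D := [set nrm2 (x - w) | w in M].
have D0 : lbound D 0.
  by move=> _ [w Mw <-]; apply: nrm2_ge0; apply: H2B => //; exact: MH.
have hinf : has_inf D by split; [exists (nrm2 (x - 0)); exists 0|exists 0].
have inf_le w : M w -> inf D <= nrm2 (x - w).
  by move=> Mw; apply: ge_inf; [exists 0|exists w].
have /choice[u u_min] : forall k, exists w, M w /\ nrm2 (x - w) < inf D + k.+1%:R^-1.
  move=> k; have k0 : 0 < k.+1%:R^-1 :> R by rewrite invr_gt0.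
  by have [_ [w Mw <-]] := inf_adherent k0 hinf; exists w.
have uH k : H2 (u k) by apply: MH; case: (u_min k).
have [y yH uy] := H2_complete uH (minimizing_cauchy Mcl xH inf_le u_min).
have My : M y by apply: (Mlim u) => // k; case: (u_min k).
exists y => //; apply: minimizer_orthogonal => // w Mw; apply: le_trans (inf_le _ Mw).
have xu := nrm_cvg_subl uH xH yH uy.
have D_cvg : inf D + k.+1%:R^-1 @[k --> \oo] --> inf D.
  by rewrite -[X in _ --> X]addr0; exact: (cvgD (cvg_cst _) (@cvg_harmonic R)).
rewrite -(sqr_nrm (H2B xH yH)) expr2; apply: (ler_cvg_to (cvgM xu xu) D_cvg).
apply: nearW => k; rewrite /= -expr2 sqr_nrm; last exact: H2B.
by case: (u_min k) => _ /ltW.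
Qed.

End ClosedSubspaces.

(** * Cauchy's formula and Taylor series *)

Section RealIntegral.
Variable R : realType.
Local Notation mu := (@lebesgue_measure R).
Implicit Types (a b c : R) (f g : R -> R).

Definition Rint a b f : R := (\int[mu]_(x in `[a, b]) f x)%R.

Lemma Rint_integrable a b f : continuous f -> mu.-integrable `[a, b] (EFin \o f).
Proof.
move=> cf; apply: continuous_compact_integrable; first exact: segment_compact.
exact: continuous_subspaceT.
Qed.

Lemma RintD a b f g : continuous f -> continuous g ->
  Rint a b (fun t => f t + g t) = Rint a b f + Rint a b g.
Proof. by move=> cf cg; apply: RintegralD => //; exact: Rint_integrable. Qed.

Lemma RintZ a b (k : R) f : continuous f ->
  Rint a b (fun t => k * f t) = k * Rint a b f.
Proof. by move=> cf; apply: RintegralZl => //; exact: Rint_integrable. Qed.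

Lemma RintB a b f g : continuous f -> continuous g ->
  Rint a b (fun t => f t - g t) = Rint a b f - Rint a b g.
Proof. by move=> cf cg; apply: RintegralB => //; exact: Rint_integrable. Qed.

Lemma eq_Rint a b f g : (forall t, a <= t <= b -> f t = g t) -> Rint a b f = Rint a b g.
Proof. by move=> fg; apply: eq_Rintegral => t; rewrite inE /= in_itv/=; exact: fg. Qed.

Lemma Rint_cst a b (k : R) : a <= b -> Rint a b (fun=> k) = k * (b - a).
Proof.
move=> ab; rewrite /Rint Rintegral_cst//; congr (_ * _).
apply: etrans (congr1 fine (lebesgue_measure_itv `[a, b])) _.
by rewrite /= lte_fin; case: ltgtP ab => // -> _; rewrite subrr.
Qed.

Lemma le_Rint a b f g : continuous f -> continuous g ->
  (forall t, a <= t <= b -> f t <= g t) -> Rint a b f <= Rint a b g.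
Proof. by move=> cf cg fg; apply: le_Rintegral => //; exact: Rint_integrable. Qed.

Lemma Rint_split a b c f : continuous f -> a <= c <= b ->
  Rint a b f = Rint a c f + Rint c b f.
Proof.
move=> cf /andP[ac cb].
have := @Rintegral_itvB R f (BLeft a) (BRight b) c (Rint_integrable a b cf).
rewrite !bnd_simp => /(_ ac cb) abE.
rewrite /Rint -(Rintegral_itv_obnd_cbnd (r := c)); first by rewrite -abE addrC subrK.
by apply: integrableS (Rint_integrable c b cf) => //; exact: subset_itv_oc_cc.
Qed.

Lemma Rint_FTC a b (F f : R -> R) : a <= b -> continuous f ->
  (forall t : R, is_derive t 1 F (f t)) -> Rint a b f = F b - F a.
Proof.
rewrite le_eqVlt => /orP[/eqP <-|ab] cf dF.
  by rewrite subrr /Rint set_itv1 Rintegral_set1.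
have cF : continuous F.
  move=> t; apply: differentiable_continuous; apply/derivable1_diffP.
  by case: (dF t).
rewrite /Rint /Rintegral (@continuous_FTC2 R f F)//=.
- exact: continuous_subspaceT.
- split => [t _| |]; first by case: (dF t).
  + by apply: cvg_at_right_filter; exact: cF.
  + by apply: cvg_at_left_filter; exact: cF.
- by move=> t _; rewrite derive1E; case: (dF t).
Qed.

End RealIntegral.

Section ComplexIntegral.
Variable R : realType.
Implicit Types (a b c t : R) (k : R[i]) (f g F : R -> R[i]).

Lemma continuous_Re_comp f : continuous f -> continuous (fun t => Re (f t)).
Proof. by move=> cf t; exact: (continuous_cvg _ (@continuous_Re R _) (cf t)). Qed.

Lemma continuous_Im_comp f : continuous f -> continuous (fun t => Im (f t)).
Proof. by move=> cf t; exact: (continuous_cvg _ (@continuous_Im R _) (cf t)). Qed.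

Lemma continuous_sqr_normc f : continuous f -> continuous (fun t => normc (f t) ^+ 2).
Proof.
move=> cf; under eq_fun do rewrite expr2; move=> t.
have cn : normc (f s) @[s --> t] --> normc (f t).
  exact: (continuous_cvg _ (@continuous_normc R _) (cf t)).
exact: (cvgM cn cn).
Qed.

Lemma continuous_conj_comp f : continuous f -> continuous (fun t => (f t)^*).
Proof. by move=> cf t; exact: (continuous_cvg _ (@continuous_conj R _) (cf t)). Qed.

Lemma continuous_cstM k f : continuous f -> continuous (fun t => k * f t).
Proof. by move=> cf t; exact: (cvgM (cvg_cst k) (cf t)). Qed.

Lemma continuousMc f g : continuous f -> continuous g -> continuous (fun t => f t * g t).
Proof. by move=> cf cg t; exact: (cvgM (cf t) (cg t)). Qed.

Lemma continuousBc f g : continuous f -> continuous g -> continuous (fun t => f t - g t).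
Proof. by move=> cf cg t; exact: (cvgB (cf t) (cg t)). Qed.

Lemma continuousDc f g : continuous f -> continuous g -> continuous (fun t => f t + g t).
Proof. by move=> cf cg t; exact: (cvgD (cf t) (cg t)). Qed.

Lemma continuousVc f : continuous f -> (forall t, f t != 0) -> continuous (fun t => (f t)^-1).
Proof. by move=> cf f0 t; exact: (cvgV (f0 t) (cf t)). Qed.

Lemma continuous_derivable_comp (h : R[i] -> R[i]) f : continuous f ->
  (forall t, derivable h (f t) 1) -> continuous (fun t => h (f t)).
Proof.
move=> cf dh t; apply: continuous_comp; first exact: cf.
exact/differentiable_continuous/derivable1_diffP.
Qed.

Definition Cint a b f : R[i] :=
  Rint a b (fun t => Re (f t)) +i* Rint a b (fun t => Im (f t)).

Lemma eq_Cint a b f g : (forall t, a <= t <= b -> f t = g t) -> Cint a b f = Cint a b g.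
Proof. by move=> fg; congr (_ +i* _); apply: eq_Rint => t /fg ->. Qed.

Lemma CintD a b f g : continuous f -> continuous g ->
  Cint a b (fun t => f t + g t) = Cint a b f + Cint a b g.
Proof.
move=> cf cg; apply: complex_ext; rewrite raddfD/= -RintD;
  by [apply: eq_Rint => t _; rewrite raddfD
     |exact: continuous_Re_comp|exact: continuous_Im_comp].
Qed.

Lemma CintZ a b k f : continuous f -> Cint a b (fun t => k * f t) = k * Cint a b f.
Proof.
move=> cf; have cRe := continuous_Re_comp cf; have cIm := continuous_Im_comp cf.
have cZ (l : R) (h : R -> R) : continuous h -> continuous (fun t => l * h t).
  by move=> ch t; exact: (cvgM (cvg_cst l) (ch t)).
apply: complex_ext; rewrite ?ReM ?ImM/= -!RintZ// -?RintB -?RintD; try exact: cZ.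
  by apply: eq_Rint => t _; rewrite ReM.
by apply: eq_Rint => t _; rewrite ImM.
Qed.

Lemma CintB a b f g : continuous f -> continuous g ->
  Cint a b (fun t => f t - g t) = Cint a b f - Cint a b g.
Proof.
move=> cf cg; rewrite -mulN1r -(CintZ _ _ _ cg) -(CintD _ _ cf (continuous_cstM cg)).
by apply: eq_Cint => t _; rewrite mulN1r.
Qed.

Lemma Cint_cst a b k : a <= b -> Cint a b (fun=> k) = k * (b - a)%:C.
Proof.
by move=> ab; rewrite /Cint !Rint_cst//; case: k => x y; apply: complex_ext => /=; ring.
Qed.

Lemma continuous_sumc (I : Type) (s : seq I) (G : I -> R -> R[i]) :
  (forall j, continuous (G j)) -> continuous (fun t => \sum_(j <- s) G j t).
Proof. by move=> cG t; apply: cvg_big => [|j _]; [exact: add_continuous|exact: cG]. Qed.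

Lemma Cint_sum a b (I : Type) (s : seq I) (G : I -> R -> R[i]) :
  a <= b -> (forall j, continuous (G j)) ->
  Cint a b (fun t => \sum_(j <- s) G j t) = \sum_(j <- s) Cint a b (G j).
Proof.
move=> ab cG; elim: s => [|i s IH].
  by rewrite big_nil; under eq_Cint => t _ do rewrite big_nil; rewrite Cint_cst// mul0r.
rewrite big_cons -IH -(CintD _ _ (cG i) (continuous_sumc cG)).
by apply: eq_Cint => t _; rewrite big_cons.
Qed.

Lemma Cint_split a b c f : continuous f -> a <= c <= b ->
  Cint a b f = Cint a c f + Cint c b f.
Proof.
move=> cf acb; apply: complex_ext; rewrite raddfD/=; apply: Rint_split => //.
  exact: continuous_Re_comp.
exact: continuous_Im_comp.
Qed.

Lemma Cint_conj a b f : continuous f -> Cint a b (fun t => (f t)^*) = (Cint a b f)^*.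
Proof.
move=> cf; apply: complex_ext; rewrite ?Re_conj ?Im_conj/=.
  by apply: eq_Rint => t _; rewrite Re_conj.
rewrite -mulN1r -RintZ; last exact: continuous_Im_comp.
by apply: eq_Rint => t _; rewrite Im_conj mulN1r.
Qed.

(* Rotating the integral onto the positive real axis leaves only the real part. *)
Lemma normc_Cint_le a b f (K : R) : a <= b -> continuous f ->
  (forall t, a <= t <= b -> normc (f t) <= K) -> normc (Cint a b f) <= K * (b - a).
Proof.
move=> ab cf fK; set I := Cint a b f.
have K0 : 0 <= K by apply: le_trans (normc_ge0 _) (fK a _); rewrite lexx.
have [I0|I0] := eqVneq I 0; first by rewrite I0 normc0 mulr_ge0// subr_ge0.
rewrite -(@ler_pM2l _ (normc I)) ?normc_gt0//.
have -> : normc I * normc I = Rint a b (fun t => Re (I^* * f t)).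
  by have := mulcJ I; rewrite mulrC -(CintZ _ _ _ cf) -expr2 => /(congr1 (fun z => Re z))/= <-.
rewrite mulrA -Rint_cst//; apply: le_Rint => [| |t /fK ftK].
- exact/continuous_Re_comp/continuous_cstM.
- by move=> t; exact: cvg_cst.
- apply: le_trans (ler_norm _) _; apply: le_trans (Re_le_normc _) _.
  by rewrite normcM normc_conj ler_wpM2l ?normc_ge0.
Qed.

Lemma Cint_FTC a b F f : a <= b -> continuous f ->
  (forall t, is_derive t 1 (fun t => Re (F t)) (Re (f t))) ->
  (forall t, is_derive t 1 (fun t => Im (F t)) (Im (f t))) -> Cint a b f = F b - F a.
Proof.
move=> ab cf dRe dIm; apply: complex_ext; rewrite raddfB/=.
  exact: (Rint_FTC ab (continuous_Re_comp cf) dRe).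
exact: (Rint_FTC ab (continuous_Im_comp cf) dIm).
Qed.

End ComplexIntegral.

Section Circle.
Variable R : realType.
Implicit Types (a b t r : R) (k : R[i]) (f g : R -> R[i]) (z : R[i]).

Lemma cexpiD a b : cexpi (a + b) = cexpi a * cexpi b.
Proof. by rewrite /cexpi cosD sinD; apply: complex_ext; rewrite ?ReM ?ImM/=; ring. Qed.

Lemma cexpi0 : cexpi (0 : R) = 1.
Proof. by rewrite /cexpi cos0 sin0. Qed.

Lemma cexpiX t n : cexpi t ^+ n = cexpi (n%:R * t).
Proof.
elim: n => [|n IH]; first by rewrite mul0r cexpi0.
by rewrite exprS IH -cexpiD -{1}(mul1r t) -mulrDl -natr1 addrC.
Qed.

Lemma normc_cexpi t : normc (cexpi t) = 1.
Proof. by apply/eqP; rewrite -sqrp_eq1 ?normc_ge0// sqr_normc_ReIm/= cos2Dsin2. Qed.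

Lemma cexpi_2pi : cexpi (2 * pi : R) = 1.
Proof. by rewrite /cexpi mulr_natl cos2pi sin2pi. Qed.

Lemma mul_cexpi_conj t : cexpi t * (cexpi t)^* = 1.
Proof. by rewrite mulcJ normc_cexpi expr1n. Qed.

Lemma normc_circle r t : 0 <= r -> normc (r%:C * cexpi t) = r.
Proof. by move=> r0; rewrite normcM normc_cexpi mulr1 normc_real ger0_norm. Qed.

Lemma circle_in_disc r t : 0 < r < 1 -> in_disc (r%:C * cexpi t).
Proof. by move=> /andP[/ltW r0 r1]; rewrite /in_disc normc_circle. Qed.

Lemma continuous_cexpiZ a : continuous (fun t => cexpi (a * t)).
Proof.
have ca t : {for t, continuous ( *%R a)} by exact: mulrl_continuous.
move=> t; apply: cvg_complex => /=.
  exact: (@continuous_comp _ _ _ ( *%R a) cos t (ca t) (@continuous_cos R _)).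
exact: (@continuous_comp _ _ _ ( *%R a) sin t (ca t) (@continuous_sin R _)).
Qed.

Lemma continuous_cexpiX n : continuous (fun t => cexpi t ^+ n).
Proof. by under eq_fun do rewrite cexpiX; exact: continuous_cexpiZ. Qed.

Lemma continuous_cexpi_conjX n : continuous (fun t => (cexpi t)^* ^+ n).
Proof.
by under eq_fun do rewrite -rmorphXn; exact/continuous_conj_comp/continuous_cexpiX.
Qed.

Lemma continuous_circle r : continuous (fun t => r%:C * cexpi t).
Proof. exact/continuous_cstM/(continuous_cexpiX (n := 1)). Qed.

Lemma Cint_cexpiZ (l a b : R) : a <= b ->
  Cint a b (fun t => (0 +i* l) * cexpi (l * t)) = cexpi (l * b) - cexpi (l * a).
Proof.
move=> ab; have dl t : is_derive t 1 ( *%R l) l.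
  by apply: is_derive_eq; rewrite /= ?scaler0 ?add0r ?addr0 /GRing.scale /= mulr1.
apply: (Cint_FTC (F := fun t => cexpi (l * t)) ab) => [|t|t].
- by apply: continuous_cstM; exact: continuous_cexpiZ.
- have dcos := @is_derive1_comp R cos ( *%R l) t _ _ (is_derive_cos (l * t)) (dl t).
  by apply: (is_derive_eq dcos); rewrite ReM/= mul0r sub0r mulNr mulrC.
- have dsin := @is_derive1_comp R sin ( *%R l) t _ _ (is_derive_sin (l * t)) (dl t).
  by apply: (is_derive_eq dsin); rewrite ImM/= mul0r add0r mulrC.
Qed.

Lemma twopi_gt0 : 0 < 2 * pi :> R.
Proof. by rewrite mulr_gt0// pi_gt0. Qed.

Let twopi_ge0 : 0 <= 2 * pi :> R := ltW twopi_gt0.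

Definition rmean (f : R -> R) : R := (2 * pi)^-1 * Rint 0 (2 * pi) f.

Definition cmean f : R[i] := ((2 * pi)^-1)%:C * Cint 0 (2 * pi) f.

Lemma Re_cmean f : Re (cmean f) = rmean (fun t => Re (f t)).
Proof. by rewrite ReM/= mul0r subr0. Qed.

Lemma le_rmean (f g : R -> R) : continuous f -> continuous g -> (forall t, f t <= g t) ->
  rmean f <= rmean g.
Proof.
by move=> cf cg fg; rewrite ler_pM2l ?invr_gt0 ?twopi_gt0//; apply: le_Rint.
Qed.

Lemma rmeanZ (l : R) (f : R -> R) : continuous f -> rmean (fun t => l * f t) = l * rmean f.
Proof. by move=> cf; rewrite /rmean RintZ// mulrCA. Qed.

Lemma cmeanD f g : continuous f -> continuous g ->
  cmean (fun t => f t + g t) = cmean f + cmean g.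
Proof. by move=> cf cg; rewrite /cmean (CintD _ _ cf cg) mulrDr. Qed.

Lemma cmeanB f g : continuous f -> continuous g ->
  cmean (fun t => f t - g t) = cmean f - cmean g.
Proof. by move=> cf cg; rewrite /cmean (CintB _ _ cf cg) mulrBr. Qed.

Lemma cmeanZ k f : continuous f -> cmean (fun t => k * f t) = k * cmean f.
Proof. by move=> cf; rewrite /cmean (CintZ _ _ _ cf) mulrCA. Qed.

Lemma cmean_sum (I : Type) (s : seq I) (G : I -> R -> R[i]) : (forall j, continuous (G j)) ->
  cmean (fun t => \sum_(j <- s) G j t) = \sum_(j <- s) cmean (G j).
Proof. by move=> cG; rewrite /cmean (Cint_sum _ twopi_ge0 cG) mulr_sumr. Qed.

Lemma cmean_cst k : cmean (fun=> k) = k.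
Proof.
rewrite /cmean Cint_cst// subr0 mulrCA -rmorphM mulVf ?mulr1//.
by rewrite gt_eqF ?twopi_gt0.
Qed.

Lemma cmean_conj f : continuous f -> cmean (fun t => (f t)^*) = (cmean f)^*.
Proof. by move=> cf; rewrite /cmean (Cint_conj _ _ cf) [RHS]rmorphM/= oppr0. Qed.

Lemma normc_cmean_le f (K : R) : continuous f -> (forall t, normc (f t) <= K) ->
  normc (cmean f) <= K.
Proof.
move=> cf fK; rewrite normcM normc_real gtr0_norm ?invr_gt0 ?twopi_gt0//.
rewrite ler_pdivrMl ?twopi_gt0//.
by have := normc_Cint_le twopi_ge0 cf (fun t _ => fK t); rewrite subr0 (mulrC K).
Qed.

Lemma cmean_cexpiX n : cmean (fun t => cexpi t ^+ n.+1) = 0.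
Proof.
rewrite /cmean; have := Cint_cexpiZ n.+1%:R twopi_ge0.
rewrite mulr0 cexpi0 -cexpiX cexpi_2pi expr1n subrr CintZ; last exact: continuous_cexpiZ.
move=> /eqP; rewrite mulf_eq0 => /orP[/eqP[/eqP]|/eqP I0]; first by rewrite pnatr_eq0.
by under eq_fun do rewrite cexpiX; rewrite I0 mulr0.
Qed.

Lemma cmean_cexpi_conjX n : cmean (fun t => (cexpi t)^* ^+ n) = (n == 0%N)%:R.
Proof.
case: n => [|n]; first by under eq_fun do rewrite expr0; exact: cmean_cst.
under eq_fun do rewrite -rmorphXn; rewrite cmean_conj ?cmean_cexpiX ?conjc0//.
exact: continuous_cexpiX.
Qed.

Lemma cmean_cexpi_orthonormal (j k : nat) :
  cmean (fun t => cexpi t ^+ j * (cexpi t)^* ^+ k) = (j == k)%:R.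
Proof.
wlog jk : j k / (j <= k)%N.
  move=> H; have [/H//|/ltnW/H kj] := leqP j k.
  have c := continuousMc (continuous_cexpiX (n := k)) (continuous_cexpi_conjX (n := j)).
  rewrite eq_sym -[RHS]conjc_nat -kj -cmean_conj//; congr cmean; apply/funext => t.
  by rewrite rmorphM !rmorphXn [RHS]mulrC; congr (_ ^+ _ * _); rewrite [RHS]conjcK.
rewrite eqn_leq jk -subn_eq0 -cmean_cexpi_conjX; congr cmean; apply/funext => t.
by rewrite -[in LHS](subnKC jk) exprD mulrA -exprMn mul_cexpi_conj expr1n mul1r.
Qed.

End Circle.

Section Bisection.
Variable R : realType.

Lemma nested_intervals (x h : nat -> R) : (forall n, 0 <= h n) -> h @ \oo --> (0 : R) ->
  (forall n, x n <= x n.+1) -> (forall n, x n.+1 + h n.+1 <= x n + h n) ->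
  exists c, forall n, x n <= c <= x n + h n.
Proof.
move=> h0 h_cvg x_incr xh_decr.
have x_nd : nondecreasing_seq x by exact/nondecreasing_seqP.
have xh_ni : nonincreasing_seq (x + h) by exact/nonincreasing_seqP.
have [|xh_lim x_cvg xh_cvg] := adjacent_seq x_nd xh_ni.
  by rewrite [_ - _]addrC addKr.
exists (limn x) => n; rewrite nondecreasing_cvgn_le//= -xh_lim.
exact: (nonincreasing_cvgn_ge xh_ni).
Qed.

Definition subsquare (x y h : R) := [/\ 0 <= h, 0 <= x, x + h <= 1, 0 <= y & y + h <= 1].

Variable I : R -> R -> R -> R.
Hypothesis I_subdivide : forall x y h, subsquare x y h ->
  I x y h <= I x y (h / 2) + I (x + h / 2) y (h / 2) +
    (I x (y + h / 2) (h / 2) + I (x + h / 2) (y + h / 2) (h / 2)).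
Hypothesis I_locally_small : forall c d e, 0 <= c <= 1 -> 0 <= d <= 1 -> 0 < e ->
  exists2 delta, 0 < delta & forall x y h, subsquare x y h -> h < delta ->
    x <= c <= x + h -> y <= d <= y + h -> I x y h <= e * h ^+ 2.

Let heavy n (p : R * R) :=
  subsquare p.1 p.2 (2^-1 ^+ n) /\ I 0 0 1 * (4^-1 ^+ n) <= I p.1 p.2 (2^-1 ^+ n).

Let nested n (p q : R * R) :=
  [/\ p.1 <= q.1, q.1 + 2^-1 ^+ n.+1 <= p.1 + 2^-1 ^+ n, p.2 <= q.2 &
      q.2 + 2^-1 ^+ n.+1 <= p.2 + 2^-1 ^+ n].

Let heavy_quarter n p : heavy n p -> exists q, heavy n.+1 q /\ nested n p q.
Proof.
rewrite /heavy /nested !exprSr mulrA; move: (2^-1 ^+ n) (I 0 0 1 * 4^-1 ^+ n) => h m.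
move=> [[h0 x0 x1 y0 y1] mI].
have := I_subdivide (And5 h0 x0 x1 y0 y1) => Ile.
have [lower_left|lower_left] := leP (m / 4) (I p.1 p.2 (h / 2)).
  by exists p; do !split => //=; lra.
have [lower_right|lower_right] := leP (m / 4) (I (p.1 + h / 2) p.2 (h / 2)).
  by exists (p.1 + h / 2, p.2); do !split => //=; lra.
have [upper_left|upper_left] := leP (m / 4) (I p.1 (p.2 + h / 2) (h / 2)).
  by exists (p.1, p.2 + h / 2); do !split => //=; lra.
by exists (p.1 + h / 2, p.2 + h / 2); do !split => //=; lra.
Qed.

Let heavy_nested_seq : exists P : nat -> R * R,
  forall n, heavy n (P n) /\ nested n (P n) (P n.+1).
Proof.
have /choice[next nextP] : forall u : nat * (R * R), exists q, heavy u.1 u.2 ->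
    heavy u.1.+1 q /\ nested u.1 u.2 q.
  move=> [n p] /=; have [/heavy_quarter[q qP]|np] := pselect (heavy n p); first by exists q.
  by exists p => /np.
pose P := fix P n := if n is k.+1 then next (k, P k) else (0, 0).
have heavyP n : heavy n (P n).
  elim: n => [|n IH]; last by have [] := nextP (n, P n) IH.
  by rewrite /heavy /= !expr0 mulr1 /subsquare add0r.
by exists P => n; split=> //; have [] := nextP (n, P n) (heavyP n).
Qed.

Lemma bisection_le0 : I 0 0 1 <= 0.
Proof.
have [P PP] := heavy_nested_seq.
have h0 n : 0 <= 2^-1 ^+ n :> R by rewrite exprn_ge0 ?invr_ge0.
have h_cvg : (fun n => 2^-1 ^+ n : R) @ \oo --> (0 : R).
  by apply: cvg_expr; rewrite ger0_norm ?invr_ge0// invf_lt1// ltr1n.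
have [c cP] : exists c, forall n, (P n).1 <= c <= (P n).1 + 2^-1 ^+ n.
  by apply: nested_intervals => // n; have [_ []] := PP n.
have [d dP] : exists d, forall n, (P n).2 <= d <= (P n).2 + 2^-1 ^+ n.
  by apply: nested_intervals => // n; have [_ []] := PP n.
have [c01 d01] : 0 <= c <= 1 /\ 0 <= d <= 1.
  have [[[_ x0 x1 y0 y1] _] _] := PP 0%N; have := cP 0%N; have := dP 0%N.
  by rewrite expr0 in x1 y1 *; lra.
rewrite leNgt; apply/negP => I0; have e0 : 0 < I 0 0 1 / 2 by rewrite divr_gt0.
have [delta delta0 Ile] := I_locally_small c01 d01 e0.
have /cvgrPdist_lt/(_ _ delta0)[n _ /(_ n (leqnn n))] := h_cvg.
rewrite /= sub0r normrN ger0_norm// => hn; have [[sqn In] _] := PP n.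
have := le_trans In (Ile _ _ _ sqn hn (cP n) (dP n)).
rewrite -exprM mulnC exprM (_ : 2^-1 ^+ 2 = 4^-1 :> R); last by field.
by rewrite ler_pM2r ?exprn_gt0 ?invr_gt0//; lra.
Qed.

End Bisection.

Section ComplexDerivative.
Variable R : realType.
Implicit Types (f : R[i] -> R[i]) (z w : R[i]).

Lemma nbhs_normc_radius z (P : set R[i]) :
  (\forall w \near z, P w) -> exists2 r : R, 0 < r & forall w, normc (w - z) < r -> P w.
Proof.
move=> /nbhs_normP[e /= e0 eP]; exists (Re e).
  by rewrite -ltcR RRe_real// gtr0_real.
move=> w wz; apply: eP => /=; rewrite distrC.
by rewrite -(RRe_real (gtr0_real e0)) ltcR.
Qed.

Lemma derivable_first_order f z : derivable f z 1 -> exists d : R[i],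
  forall e : R, 0 < e ->
    \forall w \near z, normc (f w - f z - d * (w - z)) <= e * normc (w - z).
Proof.
move=> /cvg_ex[d /cvgrPdist_lt d_lim]; exists d => e e0.
have /d_lim/nbhs_ballP[r /= r0 rP] : 0 < e%:C by rewrite ltcR.
have r0' : 0 < Re r by rewrite -ltcR RRe_real// gtr0_real.
apply: filterS (nbhs_normc z r0') => w; rewrite normc_distC => wz.
have [->|wz0] := eqVneq w z; first by rewrite !subrr mulr0 subrr normc0 mulr0.
have wz1 : w - z != 0 by rewrite subr_eq0.
have := rP (w - z); rewrite /ball/= sub0r normrN -(RRe_real (gtr0_real r0)) ltcR.
move=> /(_ wz wz1); rewrite ltcR /GRing.scale/= mulr1 subrK => dist_lt.
have -> : f w - f z - d * (w - z) = - (d - (w - z)^-1 * (f w - f z)) * (w - z).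
  by field.
by rewrite normcM normcN ler_wpM2r ?normc_ge0// ltW.
Qed.

End ComplexDerivative.

(* On the cone [w = z0 + e^s v(t)] the form [dw / (w - z0)] is [ds + (v'(t) / v(t)) dt], and
   [kappa] stands for [v' / v]. *)
Section ConeForm.
Variable R : realType.
Variables (v kappa : R -> R[i]) (K : R).
Hypotheses (cont_v : continuous v) (cont_kappa : continuous kappa).
Hypothesis Cint_v_kappa : forall t b, 0 <= b ->
  Cint t (t + b) (fun y => v y * kappa y) = v (t + b) - v t.
Hypotheses (K1 : 1 <= K) (normc_v_le : forall t, normc (v t) <= K)
  (normc_kappa_le : forall t, normc (kappa t) <= K).
Implicit Types (u : R -> R -> R[i]) (s t a b : R).

Definition sep_continuous u := (forall t, continuous (u ^~ t)) /\ (forall s, continuous (u s)).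

Definition rect_form u s t a b : R[i] :=
  Cint s (s + a) (u ^~ t) - Cint s (s + a) (u ^~ (t + b)) +
  (Cint t (t + b) (fun y => u (s + a) y * kappa y) -
   Cint t (t + b) (fun y => u s y * kappa y)).

Let K0 : 0 < K. Proof. exact: lt_le_trans K1. Qed.

Lemma sep_continuous_cst (k : R[i]) : sep_continuous (fun _ _ => k).
Proof. by split=> s t; exact: cvg_cst. Qed.

Lemma sep_continuousDZ (l : R[i]) u1 u2 : sep_continuous u1 -> sep_continuous u2 ->
  sep_continuous (fun x y => u1 x y + l * u2 x y).
Proof.
by move=> [cx1 cy1] [cx2 cy2]; split=> s;
  [exact: (continuousDc (cx1 s) (continuous_cstM (cx2 s)))
  |exact: (continuousDc (cy1 s) (continuous_cstM (cy2 s)))].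
Qed.

Lemma rect_form_cst (k : R[i]) s t a b : rect_form (fun _ _ => k) s t a b = 0.
Proof. by rewrite /rect_form !subrr addr0. Qed.

Lemma rect_formDZ (l : R[i]) u1 u2 s t a b : sep_continuous u1 -> sep_continuous u2 ->
  rect_form (fun x y => u1 x y + l * u2 x y) s t a b =
  rect_form u1 s t a b + l * rect_form u2 s t a b.
Proof.
move=> cu1 cu2; rewrite /rect_form.
have horiz y : Cint s (s + a) (fun x => u1 x y + l * u2 x y) =
    Cint s (s + a) (u1 ^~ y) + l * Cint s (s + a) (u2 ^~ y).
  by rewrite -(CintZ _ _ _ (cu2.1 y)) -(CintD _ _ (cu1.1 y) (continuous_cstM (cu2.1 y))).
have vert x : Cint t (t + b) (fun y => (u1 x y + l * u2 x y) * kappa y) =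
    Cint t (t + b) (fun y => u1 x y * kappa y) + l * Cint t (t + b) (fun y => u2 x y * kappa y).
  have c1 := continuousMc (cu1.2 x) cont_kappa; have c2 := continuousMc (cu2.2 x) cont_kappa.
  rewrite -(CintZ _ _ _ c2) -(CintD _ _ c1 (continuous_cstM c2)).
  by apply: eq_Cint => y _; rewrite mulrDl mulrA.
by rewrite !horiz !vert; ring.
Qed.

Lemma rect_form_split u s t a b : 0 <= a -> 0 <= b -> sep_continuous u ->
  rect_form u s t a b =
  rect_form u s t (a / 2) (b / 2) + rect_form u (s + a / 2) t (a / 2) (b / 2) +
  (rect_form u s (t + b / 2) (a / 2) (b / 2) +
   rect_form u (s + a / 2) (t + b / 2) (a / 2) (b / 2)).
Proof.
move=> a0 b0 cu; rewrite /rect_form.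
have -> : s + a / 2 + a / 2 = s + a by field.
have -> : t + b / 2 + b / 2 = t + b by field.
have horiz y : Cint s (s + a) (u ^~ y) =
    Cint s (s + a / 2) (u ^~ y) + Cint (s + a / 2) (s + a) (u ^~ y).
  by apply: (Cint_split (cu.1 y)); lra.
have vert x : Cint t (t + b) (fun y => u x y * kappa y) =
    Cint t (t + b / 2) (fun y => u x y * kappa y) +
    Cint (t + b / 2) (t + b) (fun y => u x y * kappa y).
  by apply: (Cint_split (continuousMc (cu.2 x) cont_kappa)); lra.
by rewrite !horiz !vert; ring.
Qed.

Lemma normc_rect_form_le u s t a b (B : R) : 0 <= a -> 0 <= b -> sep_continuous u ->
  (forall x y, s <= x <= s + a -> t <= y <= t + b -> normc (u x y) <= B) ->
  normc (rect_form u s t a b) <= 2 * K * B * (a + b).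
Proof.
move=> a0 b0 cu uB.
have sa : s <= s + a by rewrite lerDl.
have tb : t <= t + b by rewrite lerDl.
have B0 : 0 <= B by apply: le_trans (normc_ge0 _) (uB s t _ _); rewrite lexx.
have horiz y : t <= y <= t + b -> normc (Cint s (s + a) (u ^~ y)) <= K * B * a.
  move=> ty; apply: (@le_trans _ _ (B * (s + a - s))).
    by apply: (normc_Cint_le sa (cu.1 y)) => x xs; exact: uB.
  by rewrite addrC addKr ler_wpM2r// ler_peMl.
have vert x : s <= x <= s + a ->
    normc (Cint t (t + b) (fun y => u x y * kappa y)) <= K * B * b.
  move=> sx; apply: (@le_trans _ _ (K * B * (t + b - t))); last by rewrite addrC addKr.
  apply: (normc_Cint_le tb (continuousMc (cu.2 x) cont_kappa)) => y ty.
  by rewrite normcM mulrC ler_pM ?normc_ge0// uB.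
apply: le_trans (le_normcD _ _) _.
apply: le_trans (lerD (normc_sub _ _) (normc_sub _ _)) _.
apply: le_trans (lerD (lerD (horiz t _) (horiz (t + b) _)) (lerD (vert (s + a) _) (vert s _))) _;
  rewrite ?lexx ?sa ?tb//.
by rewrite le_eqVlt; apply/orP; left; apply/eqP; ring.
Qed.

Variables (f : R[i] -> R[i]) (z0 : R[i]).
Hypothesis df : forall l t : R, 0 <= l <= 1 -> derivable f (z0 + l%:C * v t) 1.

(* The clamp makes the radial variable range over the whole line. *)
Let lam s : R := expR (Num.min s 0).

Let lamE s : s <= 0 -> lam s = expR s.
Proof. by move=> s0; rewrite /lam min_l. Qed.

Let lam01 s : 0 <= lam s <= 1.
Proof. by rewrite expR_ge0 -expR0 ler_expR ge_min lexx orbT. Qed.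

Let continuous_lam : continuous (fun s => (lam s)%:C).
Proof.
have cmin : continuous (fun s : R => Num.min s 0).
  by move=> s; apply: continuous_min; [exact: cvg_id|exact: cvg_cst].
move=> s; apply: (continuous_cvg _ (@continuous_real_complex R _)).
exact: (continuous_comp (cmin s) (@continuous_expR R _)).
Qed.

Let lam_lipschitz s s' : s <= 0 -> s' <= 0 -> `|lam s - lam s'| <= `|s - s'|.
Proof.
wlog ss' : s s' / s' <= s.
  move=> H s0 s0'; have [/ltW/H|/H] := ltP s' s; first exact.
  by rewrite distrC (distrC s); exact.
move=> s0 s0'; rewrite !lamE// !ger0_norm ?subr_ge0 ?ler_expR//.
have -> : expR s - expR s' = expR s * (1 - expR (s' - s)).
  by rewrite mulrBr mulr1 -expRD subrKC.
have one_sub_exp_le : 1 - expR (s' - s) <= s - s' by have := expR_ge1Dx (s' - s); lra.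
apply: le_trans (ler_wpM2l (expR_ge0 _) one_sub_exp_le) _.
by rewrite -[leRHS]mul1r ler_wpM2r ?subr_ge0// -expR0 ler_expR.
Qed.

Let w s t := z0 + (lam s)%:C * v t.

Let sep_continuous_lam_v : sep_continuous (fun s t => (lam s)%:C * v t).
Proof.
have cvt t : continuous (fun _ : R => v t) by move=> ?; exact: cvg_cst.
split=> t; first exact: (continuousMc continuous_lam (cvt t)).
exact: (continuous_cstM cont_v).
Qed.

Let sep_continuous_fw : sep_continuous (fun s t => f (w s t)).
Proof.
have cz0 : continuous (fun _ : R => z0) by move=> ?; exact: cvg_cst.
have [cx cy] := sep_continuous_lam_v.
split=> t; (apply: continuous_derivable_comp; last by move=> ?; exact/df/lam01).
  exact: (continuousDc cz0 (cx t)).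
exact: (continuousDc cz0 (cy t)).
Qed.

Let v_lipschitz t t' : normc (v t - v t') <= K ^+ 2 * `|t - t'|.
Proof.
wlog tt' : t t' / t' <= t.
  move=> H; have [/ltW/H//|/H] := ltP t' t.
  by rewrite normc_distC distrC.
rewrite ger0_norm ?subr_ge0// -[t in v t](subrKC t') -Cint_v_kappa ?subr_ge0//.
have t'E : t' + (t - t') - t' = t - t' by rewrite addrC addKr.
rewrite -[in leRHS]t'E; apply: normc_Cint_le => [| |y _]; first by rewrite subrKC.
  exact: (continuousMc cont_v cont_kappa).
by rewrite normcM expr2 ler_pM ?normc_ge0.
Qed.

Let w_lipschitz s t s' t' : s <= 0 -> s' <= 0 ->
  normc (w s t - w s' t') <= K ^+ 2 * (`|s - s'| + `|t - t'|).
Proof.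
move=> s0 s0'.
have -> : w s t - w s' t' = (lam s - lam s')%:C * v t + (lam s')%:C * (v t - v t').
  by rewrite /w rmorphB; ring.
apply: le_trans (le_normcD _ _) _; rewrite !normcM !normc_real mulrDr; apply: lerD.
  rewrite mulrC ler_pM ?normc_ge0 ?lam_lipschitz//.
  by rewrite (le_trans (normc_v_le _))// expr2 ler_peMl// ltW.
have /andP[l0 l1] := lam01 s'; rewrite ger0_norm// -[leRHS]mul1r.
by rewrite ler_pM ?normc_ge0 ?v_lipschitz.
Qed.

Let rect_form_lam_v s t a b : 0 <= a -> 0 <= b -> s + a <= 0 ->
  rect_form (fun x y => (lam x)%:C * v y) s t a b = 0.
Proof.
move=> a0 b0 sa; rewrite /rect_form.
have horiz y : Cint s (s + a) (fun x => (lam x)%:C * v y) = v y * (lam (s + a) - lam s)%:C.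
  under eq_fun do rewrite mulrC.
  rewrite (CintZ _ _ _ continuous_lam); congr (_ * _).
  rewrite !lamE//; last by lra.
  apply: complex_ext => /=; last by rewrite Rint_cst ?mul0r// lerDl.
  rewrite -(Rint_FTC _ (@continuous_expR R) (@is_derive_expR R)) ?lerDl//.
  by apply: eq_Rint => x /andP[_ xs]; rewrite lamE//; exact: le_trans sa.
have vert x : Cint t (t + b) (fun y => (lam x)%:C * v y * kappa y) =
    (lam x)%:C * (v (t + b) - v t).
  rewrite -Cint_v_kappa// -(CintZ _ _ _ (continuousMc cont_v cont_kappa)).
  by apply: eq_Cint => y _; rewrite mulrA.
by rewrite !horiz !vert rmorphB; ring.
Qed.

(* An affine function of [w] integrates to zero along every rectangle. *)
Let normc_rect_form_fw_le (z l : R[i]) s t a b (B : R) : 0 <= a -> 0 <= b -> s + a <= 0 ->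
  (forall x y, s <= x <= s + a -> t <= y <= t + b ->
     normc (f (w x y) - f z - l * (w x y - z)) <= B) ->
  normc (rect_form (fun x y => f (w x y)) s t a b) <= 2 * K * B * (a + b).
Proof.
move=> a0 b0 sa fB; pose k := f z + l * (z0 - z).
have caff := sep_continuousDZ l (sep_continuous_cst k) sep_continuous_lam_v.
have crem := sep_continuousDZ (-1) sep_continuous_fw caff.
have -> : rect_form (fun x y => f (w x y)) s t a b =
    rect_form (fun x y => f (w x y) + -1 * (k + l * ((lam x)%:C * v y))) s t a b.
  rewrite (rect_formDZ _ _ _ _ _ sep_continuous_fw caff).
  rewrite (rect_formDZ _ _ _ _ _ (sep_continuous_cst k) sep_continuous_lam_v).
  by rewrite rect_form_cst rect_form_lam_v// mulr0 addr0 mulr0 addr0.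
apply: (normc_rect_form_le a0 b0 crem) => x y xs yt.
have -> : f (w x y) + -1 * (k + l * ((lam x)%:C * v y)) = f (w x y) - f z - l * (w x y - z).
  by rewrite /k /w; ring.
exact: fB.
Qed.

Let cone_integral P s := Cint 0 P (fun y => (f (w s y) - f z0) * kappa y).

Section Rectangle.
Variables (L P : R).
Hypotheses (L0 : 0 <= L) (P0 : 0 <= P).

Let cell_form x y h := rect_form (fun s t => f (w s t)) (- L + x * L) (y * P) (h * L) (h * P).

Let cell_form_subdivide x y h : subsquare x y h ->
  normc (cell_form x y h) <=
    normc (cell_form x y (h / 2)) + normc (cell_form (x + h / 2) y (h / 2)) +
    (normc (cell_form x (y + h / 2) (h / 2)) + normc (cell_form (x + h / 2) (y + h / 2) (h / 2))).
Proof.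
move=> [h0 _ _ _ _]; rewrite /cell_form.
have -> : - L + (x + h / 2) * L = - L + x * L + h * L / 2 by ring.
have -> : (y + h / 2) * P = y * P + h * P / 2 by ring.
have -> : h / 2 * L = h * L / 2 by ring.
have -> : h / 2 * P = h * P / 2 by ring.
rewrite rect_form_split ?mulr_ge0//.
by apply: le_trans (le_normcD _ _) _; apply: lerD; exact: le_normcD.
Qed.

Let normc_cell_form_le x y h c d (l : R[i]) e delta : subsquare x y h ->
  x <= c <= x + h -> y <= d <= y + h -> 0 <= e ->
  K ^+ 2 * (h * (L + P)) < delta ->
  (forall z, normc (z - w (- L + c * L) (d * P)) < delta ->
     normc (f z - f (w (- L + c * L) (d * P)) - l * (z - w (- L + c * L) (d * P))) <=
     e * normc (z - w (- L + c * L) (d * P))) ->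
  normc (cell_form x y h) <= 2 * K ^+ 3 * e * (L + P) ^+ 2 * h ^+ 2.
Proof.
move=> [h0 _ x1 _ _] /andP[xc cx] /andP[yd dy] e0 h_delta f_le.
have sL : - L + x * L + h * L <= 0 by have := ler_wpM2r L0 x1; lra.
have B_E : 2 * K ^+ 3 * e * (L + P) ^+ 2 * h ^+ 2 =
  2 * K * (e * (K ^+ 2 * (h * (L + P)))) * (h * L + h * P) by ring.
rewrite B_E; apply: (normc_rect_form_fw_le (l := l) (z := w (- L + c * L) (d * P)));
  rewrite ?mulr_ge0// => s t sh th.
have w_close : normc (w s t - w (- L + c * L) (d * P)) <= K ^+ 2 * (h * (L + P)).
  have := ler_wpM2r L0 xc; have := ler_wpM2r L0 cx => xcL cxL.
  have := ler_wpM2r P0 yd; have := ler_wpM2r P0 dy => ydP dyP.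
  apply: le_trans (w_lipschitz _ _ _ _) _; rewrite ?ler_wpM2l ?sqr_ge0//; try lra.
  by rewrite mulrDr lerD// ler_norml; lra.
apply: le_trans (f_le _ (le_lt_trans w_close h_delta)) _.
by rewrite ler_wpM2l.
Qed.

Let cell_form_locally_small c d e : 0 <= c <= 1 -> 0 <= d <= 1 -> 0 < e ->
  exists2 delta, 0 < delta & forall x y h, subsquare x y h -> h < delta ->
    x <= c <= x + h -> y <= d <= y + h -> normc (cell_form x y h) <= e * h ^+ 2.
Proof.
move=> c01 d01 e0; pose D := L + P + 1; pose e' := e / (2 * K ^+ 3 * D ^+ 2).
have D0 : 0 < D by rewrite ltr_wpDl ?addr_ge0.
have e'0 : 0 < e' by rewrite divr_gt0// !mulr_gt0 ?exprn_gt0.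
have [l fl] := derivable_first_order (@df _ (d * P) (lam01 (- L + c * L))).
have [delta delta0 f_le] := nbhs_normc_radius (fl _ e'0).
have KD0 : 0 < K ^+ 2 * D by rewrite mulr_gt0 ?exprn_gt0.
exists (delta / (K ^+ 2 * D)); first by rewrite divr_gt0.
move=> x y h sq; rewrite ltr_pdivlMr// => h_delta xc yd; have [h0 _ _ _ _] := sq.
have LPD : L + P <= D by rewrite lerDl.
have h_delta' : K ^+ 2 * (h * (L + P)) < delta.
  by apply: le_lt_trans h_delta; rewrite mulrCA ler_wpM2l// ler_wpM2l ?sqr_ge0.
apply: le_trans (normc_cell_form_le sq xc yd (ltW e'0) h_delta' f_le) _.
have -> : 2 * K ^+ 3 * e' * (L + P) ^+ 2 * h ^+ 2 = e * h ^+ 2 * ((L + P) ^+ 2 / D ^+ 2).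
  by rewrite /e'; field; rewrite !gt_eqF.
rewrite ler_piMr ?mulr_ge0 ?sqr_ge0 ?(ltW e0)// ler_pdivrMr ?exprn_gt0// mul1r.
by rewrite ler_sqr ?nnegrE ?addr_ge0 ?(ltW D0).
Qed.

Let rect_form_fw_eq0 : rect_form (fun s t => f (w s t)) (- L) 0 L P = 0.
Proof.
apply/eqP; rewrite -normc_eq0 eq_le normc_ge0 andbT.
have := bisection_le0 cell_form_subdivide cell_form_locally_small.
by rewrite /cell_form !mul0r addr0 !mul1r.
Qed.

Hypothesis v_closed : v P = v 0.

Lemma cone_integral_shrink : cone_integral P 0 = cone_integral P (- L).
Proof.
have cz0 : continuous (fun _ : R => f z0) by move=> ?; exact: cvg_cst.
have split s : cone_integral P s =
    Cint 0 P (fun y => f (w s y) * kappa y) - Cint 0 P (fun y => f z0 * kappa y).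
  rewrite -(CintB _ _ (continuousMc (sep_continuous_fw.2 s) cont_kappa)
    (continuousMc cz0 cont_kappa)).
  by apply: eq_Cint => y _; rewrite mulrBl.
have := rect_form_fw_eq0; rewrite /rect_form addNr add0r.
under [X in _ - X + _]eq_Cint => x _ do rewrite /w v_closed.
by rewrite subrr add0r !split => /eqP; rewrite subr_eq0 => /eqP ->.
Qed.

End Rectangle.

Lemma cone_integral_eq0 (P : R) : 0 <= P -> v P = v 0 ->
  Cint 0 P (fun y => (f (z0 + v y) - f z0) * kappa y) = 0.
Proof.
move=> P0 vP; have l0 : lam 0 = 1 by rewrite lamE// expR0.
have -> : Cint 0 P (fun y => (f (z0 + v y) - f z0) * kappa y) = cone_integral P 0.
  by apply: eq_Cint => y _; rewrite /w l0 mul1r.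
apply/eqP; rewrite -normc_eq0 eq_le normc_ge0 andbT; apply/ler_addgt0Pl => e e0.
rewrite addr0; have KP0 : 0 < K * P + 1 by rewrite ltr_wpDl ?mulr_ge0 ?(ltW K0).
have fz0 : derivable f z0 1 by have := @df 0 0; rewrite mul0r addr0 lexx ler01; exact.
have [delta delta0 f_close] : exists2 delta, 0 < delta &
    forall z, normc (z - z0) < delta -> normc (f z - f z0) < e / (K * P + 1).
  apply: nbhs_normc_radius.
  have fc : {for z0, continuous f} by exact/differentiable_continuous/derivable1_diffP.
  have /cvg_normcP/(_ _ (divr_gt0 e0 KP0)) := fc.
  by apply: filterS => z; rewrite normc_distC.
pose s := Num.min 0 (ln (delta / (2 * K))); have s0 : s <= 0 by rewrite ge_min lexx.
have lam_s : lam s * K < delta.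
  have dK0 : 0 < delta / (2 * K) by rewrite divr_gt0// mulr_gt0.
  have : lam s <= delta / (2 * K).
    by rewrite lamE// -[leRHS]lnK ?posrE// ler_expR ge_min lexx orbT.
  by rewrite ler_pdivlMr ?mulr_gt0//; have := mulr_gt0 (expR_gt0 s) K0; rewrite -lamE//; lra.
rewrite (cone_integral_shrink (L := - s) _ P0 vP) ?oppr_ge0// opprK.
have cz0 : continuous (fun _ : R => f z0) by move=> ?; exact: cvg_cst.
have cint := continuousMc (continuousBc (sep_continuous_fw.2 s) cz0) cont_kappa.
apply: (@le_trans _ _ (e / (K * P + 1) * K * (P - 0))).
  apply: (normc_Cint_le P0 cint) => y _; rewrite normcM ler_pM ?normc_ge0//.
  have /andP[lam0 _] := lam01 s.
  apply/ltW/f_close; rewrite /w addrC addKr normcM normc_real ger0_norm//.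
  by apply: le_lt_trans lam_s; rewrite ler_wpM2l.
by rewrite subr0 -mulrA mulrAC ler_pdivrMr// ler_wpM2l ?lerDl// ltW.
Qed.

End ConeForm.

Section CauchyKernel.
Variables (R : realType) (z0 : R[i]) (r : R).
Hypothesis z0r : normc z0 < r.

Let r0 : 0 < r. Proof. exact: le_lt_trans (normc_ge0 _) z0r. Qed.
Let rC0 : r%:C != 0. Proof. by rewrite fmorph_eq0 gt_eqF. Qed.
Let q : R[i] := z0 / r%:C.

Definition cauchy_kernel (t : R) : R[i] := r%:C * cexpi t / (r%:C * cexpi t - z0).

Lemma circle_dist_ge t : r - normc z0 <= normc (r%:C * cexpi t - z0).
Proof.
by have := le_normcD (r%:C * cexpi t - z0) z0; rewrite subrK normc_circle ?(ltW r0)//; lra.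
Qed.

Lemma circle_sub_neq0 t : r%:C * cexpi t - z0 != 0.
Proof. by rewrite -normc_gt0; apply: lt_le_trans (circle_dist_ge t); rewrite subr_gt0. Qed.

Lemma continuous_circle_sub : continuous (fun t => r%:C * cexpi t - z0).
Proof.
have cz0 : continuous (fun _ : R => z0) by move=> ?; exact: cvg_cst.
exact: (continuousBc (continuous_circle (r := r)) cz0).
Qed.

Lemma continuous_cauchy_kernel : continuous cauchy_kernel.
Proof.
exact: (continuousMc (continuous_circle (r := r))
  (continuousVc continuous_circle_sub circle_sub_neq0)).
Qed.

Lemma normc_cauchy_kernel_le t : normc (cauchy_kernel t) <= r / (r - normc z0).
Proof.
rewrite normcM normcV normc_circle ?(ltW r0)// ler_pM2l// lef_pV2 ?posrE ?subr_gt0//.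
  exact: circle_dist_ge.
by rewrite normc_gt0 circle_sub_neq0.
Qed.

Lemma cauchy_kernel_expand n t :
  cauchy_kernel t = \sum_(0 <= k < n) (q * (cexpi t)^*) ^+ k +
    (q * (cexpi t)^*) ^+ n * cauchy_kernel t.
Proof.
have kerS : cauchy_kernel t = 1 + q * (cexpi t)^* * cauchy_kernel t.
  apply: (mulIf (circle_sub_neq0 t)); rewrite mulrDl mul1r -(mulrA _ (cauchy_kernel t)).
  rewrite /cauchy_kernel divfK ?circle_sub_neq0//.
  have -> : q * (cexpi t)^* * (r%:C * cexpi t) = q * r%:C * (cexpi t * (cexpi t)^*) by ring.
  by rewrite mul_cexpi_conj mulr1 (divfK rC0) subrK.
elim: n => [|n IH]; first by rewrite big_geq// add0r expr0 mul1r.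
by rewrite big_nat_recr//= {1}IH -!addrA {1}kerS mulrDr mulr1 exprSr mulrA.
Qed.

Lemma cmean_mul_cauchy_kernel (g : R -> R[i]) (M : R) : continuous g ->
  (forall t, normc (g t) <= M) ->
  cmean (fun t => g t * cauchy_kernel t) =
  ev (fun k => cmean (fun t => g t * (cexpi t)^* ^+ k)) q.
Proof.
move=> cg gM; pose K := r / (r - normc z0); have cker := continuous_cauchy_kernel.
have cgk k : continuous (fun t => g t * (cexpi t)^* ^+ k).
  exact: (continuousMc cg (continuous_cexpi_conjX (n := k))).
have remainder n : cmean (fun t => g t * cauchy_kernel t) -
    series (fun k => cmean (fun t => g t * (cexpi t)^* ^+ k) * q ^+ k) n =
    q ^+ n * cmean (fun t => g t * (cexpi t)^* ^+ n * cauchy_kernel t).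
  apply/eqP; rewrite subr_eq addrC; apply/eqP.
  rewrite /series/=; under eq_bigr do rewrite mulrC -(cmeanZ _ (cgk _)).
  have crem := continuousMc (cgk n) cker.
  have cterm k := continuous_cstM (k := q ^+ k) (cgk k).
  rewrite -(cmean_sum _ cterm) -(cmeanZ _ crem).
  rewrite -(cmeanD (continuous_sumc cterm) (continuous_cstM crem)).
  congr cmean; apply/funext => t; rewrite {1}(cauchy_kernel_expand n t) mulrDr mulr_sumr.
  by congr (_ + _); [apply: eq_bigr => k _|]; rewrite exprMn; ring.
have normq : `|normc q| < 1.
  rewrite ger0_norm ?normc_ge0// normcM normcV normc_real gtr0_norm//.
  by rewrite ltr_pdivrMr// mul1r.
apply/esym/cvgc_lim/cvg_normcP => e e0.
have C0 : 0 < M * K + 1.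
  have M0 : 0 <= M := le_trans (normc_ge0 _) (gM 0).
  by rewrite ltr_wpDl// mulr_ge0// divr_ge0 ?subr_ge0 ?(ltW z0r) ?(ltW r0).
have /cvgrPdist_lt/(_ _ (divr_gt0 e0 C0)) := cvg_expr normq.
apply: filterS => n; rewrite sub0r normrN ger0_norm ?exprn_ge0 ?normc_ge0//.
rewrite ltr_pdivlMr// remainder (normcM (q ^+ n)) normcX; apply: le_lt_trans.
apply: ler_wpM2l; first by rewrite exprn_ge0 ?normc_ge0.
apply: (@le_trans _ _ (M * K)); last by rewrite lerDl.
apply: (normc_cmean_le (continuousMc (cgk n) cker)) => t.
rewrite (normcM _ (cauchy_kernel t)); apply: ler_pM; rewrite ?normc_ge0 ?normc_cauchy_kernel_le//.
by rewrite (normcM (g t)) normcX normc_conj normc_cexpi expr1n mulr1.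
Qed.

Lemma cmean_cauchy_kernel : cmean cauchy_kernel = 1.
Proof.
have c1 : continuous (fun _ : R => 1 : R[i]) by move=> ?; exact: cvg_cst.
have := cmean_mul_cauchy_kernel c1 (M := 1) (fun _ => _).
under eq_fun do rewrite mul1r; move=> ->; last by rewrite normc1.
rewrite (_ : (fun k => _) = fun k => (k == 0%N)%:R); last first.
  by apply/funext => k; under eq_fun do rewrite mul1r; exact: cmean_cexpi_conjX.
rewrite ev_recl; first by rewrite (_ : bshift _ = 0) ?ev0 ?mulr0 ?addr0//; apply/funext.
  by exists 1 => k; rewrite normc_nat lern1 leq_b1.
by rewrite /in_disc normcM normcV normc_real gtr0_norm// ltr_pdivrMr// mul1r.
Qed.

Let kappa t := (0 +i* 1) * cauchy_kernel t.

Let Cint_circle_sub_kappa t b : 0 <= b ->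
  Cint t (t + b) (fun y => (r%:C * cexpi y - z0) * kappa y) =
  r%:C * cexpi (t + b) - z0 - (r%:C * cexpi t - z0).
Proof.
move=> b0; have tb : t <= t + b by rewrite lerDl.
have -> : r%:C * cexpi (t + b) - z0 - (r%:C * cexpi t - z0) =
  r%:C * (cexpi (t + b) - cexpi t) by ring.
have := Cint_cexpiZ 1 tb; rewrite !mul1r => <-.
rewrite -CintZ; last exact/continuous_cstM/continuous_cexpiZ.
apply: eq_Cint => y _; rewrite mul1r /kappa /cauchy_kernel.
by have := circle_sub_neq0 y; move: (r%:C * cexpi y - z0) (cexpi y) => vy ey vy0; field.
Qed.

Lemma cint_cauchy_kernel_eq0 (f : R[i] -> R[i]) : holomorphic_on_disc f -> r < 1 ->
  Cint 0 (2 * pi) (fun t => (f (r%:C * cexpi t) - f z0) * kappa t) = 0.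
Proof.
move=> df r1; pose K := 2 + r / (r - normc z0).
have K2 : 2 <= K by rewrite lerDl divr_ge0 ?subr_ge0 ?(ltW z0r) ?(ltW r0).
have normc_v t : normc (r%:C * cexpi t - z0) <= K.
  apply: le_trans (normc_sub _ _) _; rewrite normc_circle ?(ltW r0)//.
  by have := z0r; lra.
have normc_kappa t : normc (kappa t) <= K.
  by rewrite normcM normci mul1r (le_trans (normc_cauchy_kernel_le t))// lerDr.
have df_cone (l t : R) : 0 <= l <= 1 -> derivable f (z0 + l%:C * (r%:C * cexpi t - z0)) 1.
  move=> l01; apply/df/in_disc_segment => //; first exact: lt_trans z0r r1.
  by apply: circle_in_disc; rewrite r0.
have v_closed : r%:C * cexpi (2 * pi) - z0 = r%:C * cexpi 0 - z0 by rewrite cexpi_2pi cexpi0.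
have K1 : 1 <= K by lra.
rewrite -[RHS](cone_integral_eq0 continuous_circle_sub
  (continuous_cstM (k := 0 +i* 1) continuous_cauchy_kernel)
  Cint_circle_sub_kappa K1 normc_v normc_kappa df_cone (ltW (twopi_gt0 R)) v_closed).
by apply: eq_Cint => t _; rewrite (addrC z0) subrK.
Qed.

Theorem cauchy_formula (f : R[i] -> R[i]) : holomorphic_on_disc f -> r < 1 ->
  cmean (fun t => f (r%:C * cexpi t) * cauchy_kernel t) = f z0.
Proof.
move=> df r1; have cker := continuous_cauchy_kernel.
have cf : continuous (fun t => f (r%:C * cexpi t)).
  apply: (continuous_derivable_comp (continuous_circle (r := r))) => t.
  by apply/df/circle_in_disc; rewrite r0.
have cfker := continuousMc cf cker; have cfz0ker := continuous_cstM (k := f z0) cker.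
have := cint_cauchy_kernel_eq0 df r1.
under eq_Cint => t _ do rewrite mulrCA mulrBl.
rewrite (CintZ _ _ _ (continuousBc cfker cfz0ker)) => /eqP.
rewrite mulf_eq0 -normc_eq0 normci oner_eq0 => /eqP cauchy0.
have : cmean (fun t => f (r%:C * cexpi t) * cauchy_kernel t - f z0 * cauchy_kernel t) = 0.
  by rewrite /cmean cauchy0 mulr0.
rewrite (cmeanB cfker cfz0ker) (cmeanZ _ cker) cmean_cauchy_kernel mulr1 => /eqP.
by rewrite subr_eq0 => /eqP.
Qed.

End CauchyKernel.

Section TaylorExpansion.
Variables (R : realType).
Implicit Types (x : cseq R) (r : R) (z : R[i]).

Definition dilate r x : cseq R := fun n => x n * (r ^+ n)%:C.

Lemma ev_dilate r x z : ev (dilate r x) z = ev x (r%:C * z).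
Proof.
by congr (limn (series _)); apply/funext => n; rewrite exprMn -rmorphXn mulrA.
Qed.

Lemma dilateM r s x : dilate r (dilate s x) = dilate (r * s) x.
Proof. by apply/funext => n; rewrite /dilate exprMn rmorphM -mulrA [_%:C * _]mulrC. Qed.

Lemma dilate1 x : dilate 1 x = x.
Proof. by apply/funext => n; rewrite /dilate expr1n mulr1. Qed.

Lemma normc_dilate r x n : 0 <= r -> normc (dilate r x n) = normc (x n) * r ^+ n.
Proof. by move=> r0; rewrite normcM normc_real ger0_norm// exprn_ge0. Qed.

Lemma bounded_seq_dilate r x : 0 <= r <= 1 -> bounded_seq x -> bounded_seq (dilate r x).
Proof.
move=> /andP[r0 r1] [B xB]; exists B => n; rewrite normc_dilate//.
by apply: le_trans (xB n); rewrite ler_piMr ?normc_ge0 ?exprn_ile1.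
Qed.

Definition rad n : R := 1 - n.+2%:R^-1.

Lemma rad01 n : 0 < rad n < 1.
Proof. by rewrite /rad subr_gt0 gtrBl invr_gt0 ltr0n invf_lt1 ?ltr1n. Qed.

Lemma rad_cvg : rad @ \oo --> (1 : R).
Proof.
rewrite -[X in _ --> X]subr0; apply: cvgB; first exact: cvg_cst.
by have := @cvg_harmonic R; rewrite -cvg_shiftS.
Qed.

Lemma radX_cvg k : rad n ^+ k @[n --> \oo] --> (1 : R).
Proof.
rewrite -[X in _ --> X](expr1n _ k).
exact: (cvg_comp _ _ rad_cvg (@exprn_continuous R k 1)).
Qed.

Variables (f : R[i] -> R[i]) (M : R).
Hypothesis df : holomorphic_on_disc f.
Hypothesis fM : forall z, in_disc z -> normc (f z) <= M.

Definition circle_coef r (k : nat) : R[i] :=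
  cmean (fun t => f (r%:C * cexpi t) * (cexpi t)^* ^+ k).

Lemma continuous_on_circle r : 0 < r < 1 -> continuous (fun t => f (r%:C * cexpi t)).
Proof.
move=> r01; apply: (continuous_derivable_comp (continuous_circle (r := r))) => t.
by apply: df; exact: circle_in_disc.
Qed.

Lemma coef_bound_circle_coef r : 0 < r < 1 -> coef_bound M (circle_coef r).
Proof.
move=> r01 k; apply: normc_cmean_le => [|t].
  exact: (continuousMc (continuous_on_circle r01) (continuous_cexpi_conjX (n := k))).
rewrite normcM normcX normc_conj normc_cexpi expr1n mulr1.
by apply: fM; exact: circle_in_disc.
Qed.

Lemma ev_circle_coef r z : r < 1 -> normc z < r -> ev (circle_coef r) (z / r%:C) = f z.
Proof.
move=> r1 zr; have r01 : 0 < r < 1 by rewrite (le_lt_trans (normc_ge0 z) zr).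
rewrite -(cauchy_formula zr df r1).
rewrite (cmean_mul_cauchy_kernel zr (continuous_on_circle r01) (M := M))// => t.
by apply: fM; exact: circle_in_disc.
Qed.

Lemma circle_coef_dilate r s : 0 < r -> r <= s -> s < 1 ->
  circle_coef r = dilate (r / s) (circle_coef s).
Proof.
move=> r0 rs s1; have s0 : 0 < s := lt_le_trans r0 rs; have r1 := le_lt_trans rs s1.
have rs01 : 0 <= r / s <= 1 by rewrite divr_ge0 ?(ltW r0) ?(ltW s0)//= ler_pdivrMr// mul1r.
have cB t : 0 < t < 1 -> bounded_seq (circle_coef t).
  by move=> t01; exists M; exact: coef_bound_circle_coef.
apply: ev_inj_disc => [||z z1]; first by apply: cB; rewrite r0.
  by apply: bounded_seq_dilate => //; apply: cB; rewrite s0.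
have rz : normc (r%:C * z) < r by rewrite normcM normc_real gtr0_norm// gtr_pMr.
rewrite ev_dilate rmorphM fmorphV mulrAC (ev_circle_coef s1 (lt_le_trans rz rs)).
by rewrite -(ev_circle_coef r1 rz) mulrAC divff ?mul1r// fmorph_eq0 gt_eqF.
Qed.

Theorem taylor_expansion : exists2 c, coef_bound M c & forall z, in_disc z -> f z = ev c z.
Proof.
pose c := dilate 2 (circle_coef 2^-1).
have circle_coefE r : 0 < r < 1 -> circle_coef r = dilate r c.
  move=> /andP[r0 r1]; rewrite /c dilateM; have [r2|/ltW r2] := leP r 2^-1.
    by rewrite (circle_coef_dilate r0 r2) ?invrK// invf_lt1// ltr1n.
  rewrite (circle_coef_dilate _ r2 r1) ?invr_gt0// dilateM.
  have -> : r * 2 * (2^-1 / r) = 1 by field; rewrite gt_eqF.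
  by rewrite dilate1.
exists c => [k|z z1].
  have c_cvg : normc (c k) * rad n ^+ k @[n --> \oo] --> normc (c k).
    by rewrite -[X in _ --> X]mulr1; exact: (cvgM (cvg_cst _) (radX_cvg k)).
  apply: (cvgr_to_le c_cvg); apply: nearW => n.
  have /andP[r0 r1] := rad01 n.
  rewrite -normc_dilate ?(ltW r0)// -circle_coefE ?rad01//.
  exact: (coef_bound_circle_coef (rad01 n)).
have [r zr r1] : exists2 r, normc z < r & r < 1.
  by exists ((normc z + 1) / 2); have := z1; rewrite /in_disc; lra.
have r0 : 0 < r := le_lt_trans (normc_ge0 z) zr.
have rzE : r%:C * (z / r%:C) = z by rewrite mulrC divfK// fmorph_eq0 gt_eqF.
have cE : circle_coef r = dilate r c by apply: circle_coefE; rewrite r0.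
by rewrite -(ev_circle_coef r1 zr) cE ev_dilate rzE.
Qed.

End TaylorExpansion.

(** * Parseval's identity and model spaces *)

Section Shift.
Variable R : realType.
Implicit Types (x y : cseq R) (z : R[i]).

Lemma H2_bshift x : H2 x -> H2 (bshift x).
Proof.
move=> xH; apply: (H2_bound (B := nrm2 x) _).1 => n.
apply: le_trans (series_le_nrm2 n.+1 xH).
by rewrite /series/= [leRHS]big_nat_recl// lerDr sqr_ge0.
Qed.

Lemma H2_ushift_bound x : H2 x -> H2 (ushift x) /\ nrm2 (ushift x) <= nrm2 x.
Proof.
move=> xH; apply: H2_bound => -[|n]; first by rewrite /series/= big_geq// nrm2_ge0.
rewrite /series/= big_nat_recl//= normc0 expr0n/= add0r.
exact: (series_le_nrm2 n xH).
Qed.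

Lemma H2_ushift x : H2 x -> H2 (ushift x).
Proof. by move=> /H2_ushift_bound[]. Qed.

Lemma nrm_ushift_le x : H2 x -> nrm (ushift x) <= nrm x.
Proof.
move=> xH; have [sxH sx_le] := H2_ushift_bound xH.
by rewrite nrm_le_sqr ?nrm_ge0// sqr_nrm.
Qed.

Lemma H2_iter_ushift k x : H2 x -> H2 (iter k (@ushift R) x).
Proof. by move=> xH; elim: k => //= k; exact: H2_ushift. Qed.

Lemma ip_recl x y : H2 x -> H2 y ->
  ip x y = x 0%N * (y 0%N)^* + ip (bshift x) (bshift y).
Proof. by move=> xH yH; rewrite /ip lim_series_recl//; exact: ip_cvg. Qed.

Lemma ip_ushiftl x y : H2 x -> H2 y -> ip (ushift x) y = ip x (bshift y).
Proof. by move=> xH yH; rewrite ip_recl ?mul0r ?add0r//; exact: H2_ushift. Qed.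

Lemma ip_bshiftl x y : H2 x -> H2 y -> ip (bshift x) y = ip x (ushift y).
Proof.
move=> xH yH; rewrite (ipC (H2_ushift yH) xH) ip_ushiftl//.
by rewrite -(ipC yH (H2_bshift xH)).
Qed.

Lemma bounded_seq_iter_ushift k x : bounded_seq x -> bounded_seq (iter k (@ushift R) x).
Proof. by move=> xb; elim: k => //= k; exact: bounded_seq_ushift. Qed.

Lemma ev_iter_ushift k x z : bounded_seq x -> in_disc z ->
  ev (iter k (@ushift R) x) z = z ^+ k * ev x z.
Proof.
move=> xb z1; elim: k => [|k IH]; first by rewrite mul1r.
by rewrite iterS ev_ushift ?IH ?exprS ?mulrA//; exact: bounded_seq_iter_ushift.
Qed.

Definition monom k : cseq R := fun n => (n == k)%:R.

Lemma iter_ushift_monom k : iter k (@ushift R) (monom 0) = monom k.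
Proof. by elim: k => //= k ->; apply/funext => -[|n]. Qed.

Lemma H2_monom k : H2 (monom k).
Proof.
rewrite -iter_ushift_monom; apply: H2_iter_ushift.
apply: (H2_bound (B := 1) _).1 => -[|n]; first by rewrite /series/= big_geq.
rewrite /series/= big_nat_recl//= normc1 expr1n big1 ?addr0// => i _.
by rewrite normc0 expr0n.
Qed.

Lemma ev_monom k z : in_disc z -> ev (monom k) z = z ^+ k.
Proof.
move=> z1; have mb := H2_bounded_seq (H2_monom (k := 0%N)).
rewrite -iter_ushift_monom ev_iter_ushift// ev_recl//.
by rewrite (_ : bshift _ = 0) ?ev0 ?mulr0 ?addr0 ?mulr1//; apply/funext.
Qed.

Lemma nrm_cvg_ev (u : nat -> cseq R) y z : (forall k, H2 (u k)) -> H2 y -> in_disc z ->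
  nrm_cvg u y -> ev (u k) z @[k --> \oo] --> ev y z.
Proof.
move=> uH yH z1 /nrm_cvgP uy; have z0 : 0 < 1 - normc z by rewrite subr_gt0.
apply/cvg_normcP => e e0; apply: filterS (uy _ (mulr_gt0 e0 z0)) => k.
have uyH := H2B (uH k) yH; rewrite -ltr_pdivrMr//; apply: le_lt_trans.
rewrite normc_distC -evB//; [|exact: H2_bounded_seq..].
exact: normc_ev_le_nrm.
Qed.

End Shift.

Section Parseval.
Variable R : realType.
Local Notation mu := (@lebesgue_measure R).
Implicit Types (x y h : cseq R) (t r : R).

Lemma rmean_dominated_cvg (F : nat -> R -> R) (G : R -> R) (K : R) :
  (forall j, continuous (F j)) -> continuous G -> (forall j t, `|F j t| <= K) ->
  {ae mu, forall t, F j t @[j --> \oo] --> G t} -> rmean (F j) @[j --> \oo] --> rmean G.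
Proof.
move=> cF cG FK [A [mA A0 FG]]; apply: (cvgM (cvg_cst _)).
have cK : continuous (fun _ : R => K) by move=> ?; exact: cvg_cst.
have iF j := Rint_integrable 0 (2 * pi) (cF j).
have iG := Rint_integrable 0 (2 * pi) cG; have iK := Rint_integrable 0 (2 * pi) cK.
have mD : measurable (`[0, 2 * pi] : set R) by exact: measurable_itv.
have [] := @dominated_convergence _ _ R mu _ mD (fun j t => (F j t)%:E)
   (fun t => (G t)%:E) (fun t => K%:E).
- by move=> j; exact: (measurable_int mu (iF j)).
- exact: (measurable_int mu iG).
- exists A; split=> // t; apply: contraPP => /= nA; apply => _.
  apply/cvg_EFin; first exact: nearW.
  by apply: contra_notP nA => FGt; exact: FG.
- exact: iK.
- by apply: aeW => t j _; rewrite lee_fin.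
move=> _ _ /= int_cvg; apply: fine_cvg.
by rewrite /Rint /Rintegral fineK//; exact: integrable_fin_num.
Qed.

Definition trig y m n t : R[i] := \sum_(m <= k < n) y k * cexpi t ^+ k.

Lemma continuous_trig y m n : continuous (trig y m n).
Proof.
move=> t; apply: cvg_big => [|k _]; first exact: add_continuous.
exact: (continuous_cstM (continuous_cexpiX (n := k))).
Qed.

Lemma normc_trig_le y m n t : normc (trig y m n t) <= \sum_(m <= k < n) normc (y k).
Proof.
apply: le_trans (normc_sum _ _ _) _; apply: ler_sum => k _.
by rewrite normcM normcX normc_cexpi expr1n mulr1.
Qed.

Lemma cmean_trig_coef y m n j : (m <= j < n)%N ->
  cmean (fun t => trig y m n t * (cexpi t)^* ^+ j) = y j.
Proof.
move=> jmn; have cterm k : continuous (fun t => y k * (cexpi t ^+ k * (cexpi t)^* ^+ j)).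
  by apply: continuous_cstM; exact: (continuousMc (continuous_cexpiX (n := k))
    (continuous_cexpi_conjX (n := j))).
transitivity (\sum_(m <= k < n) cmean (fun t => y k * (cexpi t ^+ k * (cexpi t)^* ^+ j))).
  rewrite -cmean_sum//; congr cmean; apply/funext => t.
  by rewrite mulr_suml; apply: eq_bigr => k _; rewrite mulrA.
transitivity (\sum_(m <= k < n) if k == j then y k else 0); last first.
  by rewrite -big_mkcond big_nat1_eq jmn.
apply: eq_bigr => k _; rewrite cmeanZ ?cmean_cexpi_orthonormal.
  by case: eqP; rewrite ?mulr1 ?mulr0.
exact: (continuousMc (continuous_cexpiX (n := k)) (continuous_cexpi_conjX (n := j))).
Qed.

Lemma parseval_trig y m n :
  rmean (fun t => normc (trig y m n t) ^+ 2) = \sum_(m <= k < n) normc (y k) ^+ 2.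
Proof.
have cterm k : continuous (fun t => trig y m n t * (cexpi t)^* ^+ k).
  exact: (continuousMc (continuous_trig (y := y) (m := m) (n := n))
    (continuous_cexpi_conjX (n := k))).
have -> : rmean (fun t => normc (trig y m n t) ^+ 2) =
    Re (cmean (fun t => trig y m n t * (trig y m n t)^*)).
  by rewrite Re_cmean; congr rmean; apply/funext => t; rewrite mulcJ.
have -> : (fun t => trig y m n t * (trig y m n t)^*) =
    fun t => \sum_(m <= k < n) (y k)^* * (trig y m n t * (cexpi t)^* ^+ k).
  apply/funext => t; rewrite [in X in _ * X]/trig rmorph_sum mulr_sumr.
  by apply: eq_bigr => k _; rewrite rmorphM rmorphXn mulrCA.
rewrite cmean_sum => [|k]; last exact: continuous_cstM.
rewrite raddf_sum; apply: eq_big_nat => k kmn.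
by rewrite (cmeanZ _ (cterm k)) cmean_trig_coef// mulrC mulcJ.
Qed.

Lemma H2_dilate r x : bounded_seq x -> 0 <= r < 1 -> H2 (dilate r x).
Proof.
move=> [B xB] /andP[r0 r1]; apply: (@series_le_cvg _ _ (geometric (B ^+ 2) (r ^+ 2))) => [n|n|n|].
- exact: sqr_ge0.
- by rewrite /geometric/= mulr_ge0 ?sqr_ge0 ?exprn_ge0 ?sqr_ge0.
- rewrite normc_dilate// exprMn /geometric/= -!exprM mulnC ler_wpM2r ?exprn_ge0//.
  by rewrite ler_sqr ?nnegrE ?normc_ge0 ?(coef_bound_ge0 xB).
by apply: cvgP; apply: geometric_cvg; rewrite sqr_ge0 expr_lt1.
Qed.

Lemma nrm2_dilate_le r x : H2 x -> 0 <= r < 1 -> nrm2 (dilate r x) <= nrm2 x.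
Proof.
move=> xH r01; have rxH := H2_dilate (H2_bounded_seq xH) r01; case/andP: r01 => r0 r1.
apply: lim_series_le => // n; rewrite normc_dilate// exprMn ler_piMr ?sqr_ge0//.
by rewrite -exprM exprn_ile1// ltW.
Qed.

Lemma nrm2_dilate_lim_le x (B : nat -> R) (S : R) : bounded_seq x ->
  (forall j, nrm2 (dilate (rad R j) x) <= B j) -> B @ \oo --> S -> H2 x /\ nrm2 x <= S.
Proof.
move=> xb dB BS; have rad_itv j : 0 <= rad R j < 1 by have /andP[/ltW-> ->] := rad01 R j.
have rad_ge0 j : 0 <= rad R j by case/andP: (rad_itv j).
apply: H2_bound => K.
have dx_cvg : series (fun n => normc (dilate (rad R j) x n) ^+ 2) K @[j --> \oo] -->
    series (fun n => normc (x n) ^+ 2) K.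
  rewrite /series/=; apply: cvg_big => [|n _]; first exact: add_continuous.
  have xn_cvg : normc (dilate (rad R j) x n) @[j --> \oo] --> normc (x n).
    rewrite (_ : (fun j => _) = fun j => normc (x n) * rad R j ^+ n); last first.
      by apply/funext => j; rewrite normc_dilate.
    by rewrite -[X in _ --> X]mulr1; exact: (cvgM (cvg_cst _) (radX_cvg n)).
  exact: (cvgM xn_cvg xn_cvg).
apply: (ler_cvg_to dx_cvg BS); apply: nearW => j; apply: le_trans (dB j).
by apply: series_le_nrm2; exact: H2_dilate.
Qed.

Lemma abs_summable_dilate r x : bounded_seq x -> 0 <= r < 1 -> abs_summable (dilate r x).
Proof.
move=> xb /andP[r0 r1]; have rd : in_disc r%:C by rewrite /in_disc normc_real ger0_norm.
rewrite (_ : dilate r x = fun n => x n * r%:C ^+ n); first exact: ev_abs_summable.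
by apply/funext => n; rewrite -rmorphXn.
Qed.

Lemma parseval x r : bounded_seq x -> 0 < r < 1 ->
  continuous (fun t => ev x (r%:C * cexpi t)) ->
  rmean (fun t => normc (ev x (r%:C * cexpi t)) ^+ 2) = nrm2 (dilate r x).
Proof.
move=> xb r01 cx; have r0 : 0 <= r < 1 by case/andP: r01 => /ltW-> ->.
have trigE n t : trig (dilate r x) 0 n t = series (fun k => x k * (r%:C * cexpi t) ^+ k) n.
  by apply: eq_bigr => k _; rewrite exprMn -rmorphXn mulrA.
pose K := limn (series (fun n => normc (dilate r x n))).
have trig_le n t : normc (trig (dilate r x) 0 n t) <= K.
  apply: le_trans (normc_trig_le _ _ _ _) _.
  by apply: nneg_series_le_lim (abs_summable_dilate xb r0) => k; exact: normc_ge0.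
have trig_cvg : rmean (fun t => normc (trig (dilate r x) 0 n t) ^+ 2) @[n --> \oo] -->
    rmean (fun t => normc (ev x (r%:C * cexpi t)) ^+ 2).
  apply: (rmean_dominated_cvg (K := K ^+ 2)).
  - by move=> n; exact/continuous_sqr_normc/continuous_trig.
  - exact: continuous_sqr_normc.
  - move=> n t; rewrite ger0_norm ?sqr_ge0// ler_sqr ?nnegrE ?normc_ge0//.
    exact: le_trans (normc_ge0 _) (trig_le n t).
  - apply: aeW => t; have evc := ev_cvg xb (circle_in_disc t r01).
    have nc : normc (trig (dilate r x) 0 n t) @[n --> \oo] --> normc (ev x (r%:C * cexpi t)).
      under eq_fun do rewrite trigE.
      exact: (continuous_cvg _ (@continuous_normc R _) evc).
    exact: (cvgM nc nc).
apply: (cvg_unique (@norm_hausdorff _ _) trig_cvg).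
rewrite (_ : (fun n => _) = series (fun k => normc (dilate r x k) ^+ 2)); first exact: H2_dilate.
by apply/funext => n; exact: parseval_trig.
Qed.

End Parseval.

Section Multiplication.
Variable R : realType.
Implicit Types (h c x y : cseq R) (z : R[i]) (f : R[i] -> R[i]).
Local Notation shiftn k c := (iter k (@ushift R) c).

Definition taylor_coefs f c := bounded_seq c /\ forall z, in_disc z -> f z = ev c z.

Lemma Hinf_taylor_coefs f : Hinf f -> exists c, taylor_coefs f c.
Proof.
move=> [df [M fM]]; have [c cM fc] := taylor_expansion df fM.
by exists c; split=> //; exists M.
Qed.

Definition polymul m n h c : cseq R := \sum_(m <= k < n) h k *: shiftn k c.

Lemma polymulDZ m n (a : R[i]) g h c :
  polymul m n (g + a *: h) c = polymul m n g c + a *: polymul m n h c.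
Proof.
rewrite /polymul scaler_sumr -big_split/=; apply: eq_bigr => k _.
by rewrite scalerA -scalerDl.
Qed.

Lemma polymul_monom n k c : (k < n)%N -> polymul 0 n (@monom R k) c = shiftn k c.
Proof.
move=> kn; transitivity (\sum_(0 <= j < n) if j == k then shiftn j c else 0).
  by apply: eq_bigr => j _; rewrite /monom; case: eqP => _; rewrite ?scale1r ?scale0r.
by rewrite -big_mkcond big_nat1_eq/= kn.
Qed.

Lemma bounded_seq_polymul m n h c : bounded_seq c -> bounded_seq (polymul m n h c).
Proof.
move=> cb; apply: big_ind => [||k _].
- by exists 0 => k; rewrite normc0.
- exact: bounded_seqD.
- by apply: bounded_seqZ; exact: bounded_seq_iter_ushift.
Qed.

Lemma ev_polymul m n h c z : bounded_seq c -> in_disc z ->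
  ev (polymul m n h c) z = (\sum_(m <= k < n) h k * z ^+ k) * ev c z.
Proof.
move=> cb z1.
suff : bounded_seq (polymul m n h c) /\
    ev (polymul m n h c) z = (\sum_(m <= k < n) h k * z ^+ k) * ev c z by case.
rewrite /polymul; elim/big_ind2: _ => [|x a y b [xb xE] [yb yE]|k _].
- by split; [exists 0 => k; rewrite normc0|rewrite ev0 mul0r].
- by split; [exact: bounded_seqD|rewrite evD// xE yE mulrDl].
- have sb := bounded_seq_iter_ushift k cb.
  by split; [exact: bounded_seqZ|rewrite evZ// ev_iter_ushift// mulrA].
Qed.

Variables (f : R[i] -> R[i]) (c : cseq R).
Hypotheses (fH : Hinf f) (fc : taylor_coefs f c).

Lemma ev_polymul_circle m n h r t : 0 < r < 1 ->
  ev (polymul m n h c) (r%:C * cexpi t) = trig (dilate r h) m n t * f (r%:C * cexpi t).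
Proof.
move=> r01; have [cb fE] := fc; have zd := circle_in_disc t r01.
have -> : trig (dilate r h) m n t = \sum_(m <= k < n) h k * (r%:C * cexpi t) ^+ k.
  by apply: eq_bigr => k _; rewrite exprMn -rmorphXn mulrA.
by rewrite (ev_polymul _ _ _ cb zd) (fE _ zd).
Qed.

Lemma parseval_polymul m n h r : 0 < r < 1 ->
  rmean (fun t => normc (trig (dilate r h) m n t * f (r%:C * cexpi t)) ^+ 2) =
  nrm2 (dilate r (polymul m n h c)).
Proof.
move=> r01; have [cb _] := fc.
have evE : (fun t => ev (polymul m n h c) (r%:C * cexpi t)) =
    fun t => trig (dilate r h) m n t * f (r%:C * cexpi t).
  by apply/funext => t; exact: ev_polymul_circle.
have cev : continuous (fun t => ev (polymul m n h c) (r%:C * cexpi t)).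
  rewrite evE; exact: (continuousMc (continuous_trig (y := dilate r h) (m := m) (n := n))
    (continuous_on_circle fH.1 r01)).
rewrite -(parseval (bounded_seq_polymul m n h cb) r01 cev).
by congr rmean; apply/funext => t; rewrite ev_polymul_circle.
Qed.

Lemma H2_polymul_bound (M : R) m n h : (forall z, in_disc z -> normc (f z) <= M) ->
  H2 (polymul m n h c) /\
  nrm2 (polymul m n h c) <= M ^+ 2 * \sum_(m <= k < n) normc (h k) ^+ 2.
Proof.
move=> fM; have [cb _] := fc.
apply: (nrm2_dilate_lim_le (B := fun=> M ^+ 2 * \sum_(m <= k < n) normc (h k) ^+ 2)).
- exact: bounded_seq_polymul.
- move=> j; have r01 := rad01 R j; have /andP[r0 r1] := r01.
  have ct := continuous_trig (y := dilate (rad R j) h) (m := m) (n := n).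
  rewrite -parseval_polymul//.
  apply: (@le_trans _ _ (rmean (fun t => M ^+ 2 * normc (trig (dilate (rad R j) h) m n t) ^+ 2))).
    apply: le_rmean => [| |t].
    + exact/continuous_sqr_normc/(continuousMc ct)/(continuous_on_circle fH.1).
    + by move=> t; apply: (cvgM (cvg_cst _)); exact: continuous_sqr_normc.
    + rewrite normcM exprMn mulrC ler_wpM2r ?sqr_ge0//.
      have ft := fM _ (circle_in_disc t r01).
      by rewrite ler_sqr ?nnegrE ?normc_ge0//; exact: le_trans (normc_ge0 _) ft.
  rewrite rmeanZ; last exact: continuous_sqr_normc.
  rewrite parseval_trig ler_wpM2l ?sqr_ge0//; apply: ler_sum => k _.
  rewrite normc_dilate ?(ltW r0)// exprMn ler_piMr ?sqr_ge0//.
  by rewrite -exprM exprn_ile1// ltW.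
- exact: cvg_cst.
Qed.

Lemma H2_polymul m n h : H2 (polymul m n h c).
Proof. by have [_ [M fM]] := fH; have [] := H2_polymul_bound m n h fM. Qed.

Lemma H2_taylor_coefs : H2 c.
Proof. by have := @H2_polymul 0 1 (@monom R 0); rewrite polymul_monom. Qed.

Lemma nrm2_cauchy_polymul h : H2 h -> nrm2_cauchy (fun n => polymul 0 n h c).
Proof.
move=> hH e e0; have [_ [M fM]] := fH.
have M0 : 0 < M ^+ 2 + 1 by rewrite ltr_wpDl ?sqr_ge0.
have /cvgrPdist_lt/(_ _ (divr_gt0 e0 M0))[N _ /(_ N (leqnn N))] := hH.
rewrite ltr_pdivlMr// => tail_small.
have block_le k l : (N <= k)%N -> (k <= l)%N -> nrm2 (polymul k l h c) <= e.
  move=> Nk kl; have [_ kl_le] := H2_polymul_bound k l h fM.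
  have block_tail : \sum_(k <= j < l) normc (h j) ^+ 2 <=
      nrm2 h - series (fun j => normc (h j) ^+ 2) N.
    rewrite -sub_series_geq// lerB ?series_le_nrm2//.
    by apply: nondecreasing_series => // j _ _; exact: sqr_ge0.
  have := le_trans block_tail (ler_norm _); have := ler_wpM2l (sqr_ge0 M) block_tail.
  have := ler_wpM2l (sqr_ge0 M) (ler_norm (nrm2 h - series (fun j => normc (h j) ^+ 2) N)).
  have := normr_ge0 (nrm2 h - series (fun j => normc (h j) ^+ 2) N).
  by move: kl_le tail_small; rewrite -/(nrm2 h); lra.
have polymulB k l : (k <= l)%N -> polymul 0 l h c - polymul 0 k h c = polymul k l h c.
  by move=> kl; rewrite /polymul (big_cat_nat (leq0n k) kl)/= addrAC subrr add0r.
exists N => k l Nk Nl /=; have [kl|/ltnW lk] := leqP k l; last by rewrite polymulB// block_le.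
by rewrite -opprB polymulB// nrm2N ?block_le//; exact: H2_polymul.
Qed.

Lemma mul_taylor_coefs h : H2 h -> exists y, [/\ H2 y,
  forall z, in_disc z -> ev y z = f z * ev h z & nrm_cvg (fun n => polymul 0 n h c) y].
Proof.
move=> hH; have uH n : H2 (polymul 0 n h c) := @H2_polymul 0 n h.
have [cb fE] := fc; have [y yH uy] := H2_complete uH (nrm2_cauchy_polymul hH).
exists y; split=> // z z1; apply: (cvg_unique (@norm_hausdorff _ _) (nrm_cvg_ev uH yH z1 uy)).
rewrite (_ : (fun n => _) = fun n => f z * series (fun k => h k * z ^+ k) n).
  exact: (cvgM (cvg_cst _) (ev_cvg (H2_bounded_seq hH) z1)).
by apply/funext => n; rewrite (ev_polymul _ _ _ cb z1) -(fE _ z1) mulrC.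
Qed.

Definition coinv := orth [set shiftn k c | k in setT].

Lemma model_space_coinv : model_space f = coinv.
Proof.
have cH := H2_taylor_coefs; have [cb fE] := fc; have shH k : H2 (shiftn k c) := H2_iter_ushift cH.
apply/seteqP; split=> x [xH x_orth]; split=> // y.
  move=> [k _ <-]; apply: x_orth; split=> //; exists (@monom R k); split; first exact: H2_monom.
  by move=> z z1; rewrite ev_iter_ushift// ev_monom// fE// mulrC.
move=> [yH [a [aH ya]]]; have [b [bH bE polymul_b]] := mul_taylor_coefs aH.
have -> : y = b.
  by apply: ev_inj_disc => [||z z1]; [exact: H2_bounded_seq..|rewrite ya// bE].
have polymul_orth n : ip (polymul 0 n a c) x = 0.
  rewrite /polymul; elim: n => [|n IH]; first by rewrite big_geq// ip0l.
  rewrite big_nat_recr//= ipDl ?ipZl ?IH ?add0r//; [|exact: H2_polymul|exact: H2Z].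
  by rewrite (ipC xH (shH n)) x_orth ?conjc0 ?mulr0//; exists n.
have bx : ip b x = 0.
  apply: (cvg_unique (@norm_hausdorff _ _) (nrm_cvg_ip _ bH xH polymul_b)) => [n|].
    exact: H2_polymul.
  by rewrite (_ : (fun n => _) = cst 0); [exact: cvg_cst|apply/funext].
by rewrite (ipC bH xH) bx conjc0.
Qed.

End Multiplication.

Section InnerFunction.
Variable R : realType.
Local Notation mu := (@lebesgue_measure R).
Implicit Types (h x y : cseq R) (t r : R).
Local Notation shiftn k c := (iter k (@ushift R) c).

Lemma rad_at_left : rad R @ \oo --> (1 : R)^'-.
Proof.
move=> A [e /= e0 eA]; have /cvgrPdist_lt/(_ _ e0)[N _ NP] := @rad_cvg R.
by exists N => // n /NP n_close; apply: eA => //=; case/andP: (rad01 R n).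
Qed.

Lemma trig_dilate_cvg h n t :
  trig (dilate (rad R j) h) 0 n t @[j --> \oo] --> trig h 0 n t.
Proof.
apply: cvg_big => [|k _]; first exact: add_continuous.
have hk_cvg : dilate (rad R j) h k @[j --> \oo] --> h k.
  have rk_cvg : (rad R j ^+ k)%:C @[j --> \oo] --> (1 : R)%:C.
    exact: (continuous_cvg _ (@continuous_real_complex R 1) (radX_cvg k)).
  by rewrite -[X in _ --> X]mulr1; exact: (cvgM (cvg_cst _) rk_cvg).
exact: (cvgM hk_cvg (cvg_cst _)).
Qed.

Lemma ip_eq0_pythagoras x y : H2 x -> H2 y ->
  (forall a : R[i], nrm2 (x - a *: y) = nrm2 x + normc a ^+ 2 * nrm2 y) -> ip x y = 0.
Proof.
move=> xH yH pyth; have [->|y0] := eqVneq y 0; first exact: ip0r.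
have ny := nrm2_gt0 yH y0; have := pyth (ip x y / (nrm2 y)%:C); rewrite nrm2B_proj//.
set p := normc (ip x y / _) ^+ 2 * _.
have p0 : 0 <= p by rewrite mulr_ge0 ?sqr_ge0 ?ltW.
move=> /addrI ipE; apply/eqP; rewrite -normc_eq0 -sqrf_eq0.
have : normc (ip x y) ^+ 2 / nrm2 y <= 0 by rewrite -oppr_ge0 ipE.
by rewrite pmulr_lle0 ?invr_gt0// => ip_le0; rewrite eq_le ip_le0 sqr_ge0.
Qed.

Variables (f : R[i] -> R[i]) (c : cseq R).
Hypotheses (f_inner : inner_fun f) (fc : taylor_coefs f c).

Let fH : Hinf f. Proof. by case: f_inner. Qed.

Let rmean_trig_inner_cvg h n :
  rmean (fun t => normc (trig (dilate (rad R j) h) 0 n t * f ((rad R j)%:C * cexpi t)) ^+ 2)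
    @[j --> \oo] --> rmean (fun t => normc (trig h 0 n t) ^+ 2).
Proof.
have [_ [M fM]] := fH; have [_ f_radial] := f_inner.
have cprod j : continuous (fun t =>
    trig (dilate (rad R j) h) 0 n t * f ((rad R j)%:C * cexpi t)).
  exact: (continuousMc (continuous_trig (y := dilate (rad R j) h) (m := 0%N) (n := n))
    (continuous_on_circle fH.1 (rad01 R j))).
apply: (rmean_dominated_cvg (K := ((\sum_(0 <= k < n) normc (h k)) * M) ^+ 2)).
- by move=> j; exact: continuous_sqr_normc.
- exact/continuous_sqr_normc/continuous_trig.
- move=> j t; have fr := fM _ (circle_in_disc t (rad01 R j)).
  have M0 : 0 <= M := le_trans (normc_ge0 _) fr.
  have s0 : 0 <= \sum_(0 <= k < n) normc (h k) by apply: sumr_ge0 => k _; exact: normc_ge0.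
  rewrite ger0_norm ?sqr_ge0// ler_sqr ?nnegrE ?normc_ge0 ?mulr_ge0// normcM.
  apply: ler_pM; rewrite ?normc_ge0//; apply: le_trans (normc_trig_le _ _ _ _) _.
  apply: ler_sum => k _; have /andP[r0 r1] := rad01 R j.
  by rewrite normc_dilate ?ler_piMr ?normc_ge0 ?exprn_ile1// ltW.
- have [A [mA A0 f_radialA]] := f_radial; exists A; split=> //.
  apply: subset_trans f_radialA => t; apply: contra_not => -[l [fl l1]].
  have fl' : f ((rad R j)%:C * cexpi t) @[j --> \oo] --> l := cvg_comp _ _ rad_at_left fl.
  have prod_cvg : normc (trig (dilate (rad R j) h) 0 n t * f ((rad R j)%:C * cexpi t))
      @[j --> \oo] --> normc (trig h 0 n t).
    rewrite -[X in _ --> X]mulr1 -l1 -normcM.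
    exact: (continuous_cvg _ (@continuous_normc R _) (cvgM (@trig_dilate_cvg h n t) fl')).
  exact: (cvgM prod_cvg prod_cvg).
Qed.

Lemma nrm2_polymul_inner h n :
  nrm2 (polymul 0 n h c) = \sum_(0 <= k < n) normc (h k) ^+ 2.
Proof.
have [cb _] := fc; have := @rmean_trig_inner_cvg h n; rewrite parseval_trig => h_cvg.
have pE j := parseval_polymul fH fc 0 n h (rad01 R j).
have [pH p_le] : H2 (polymul 0 n h c) /\
    nrm2 (polymul 0 n h c) <= \sum_(0 <= k < n) normc (h k) ^+ 2.
  apply: (nrm2_dilate_lim_le _ _ h_cvg); first exact: bounded_seq_polymul.
  by move=> j; rewrite -pE.
apply/eqP; rewrite eq_le p_le/=; apply: (cvgr_to_le h_cvg); apply: nearW => j.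
by rewrite pE nrm2_dilate_le//; have /andP[/ltW-> ->] := rad01 R j.
Qed.

Lemma nrm2_shiftn_inner k : nrm2 (shiftn k c) = 1.
Proof.
rewrite -(polymul_monom _ (ltnSn k)) nrm2_polymul_inner.
rewrite big_nat_recr//= big_nat_cond big1 => [|i /andP[/andP[_ ik] _]].
  by rewrite /monom eqxx normc1 expr1n add0r.
by rewrite /monom (ltn_eqF ik) normc0 expr0n.
Qed.

Lemma ip_shiftn_inner k : (0 < k)%N -> ip c (shiftn k c) = 0.
Proof.
move=> k0; have cH := H2_taylor_coefs fH fc; have kH : H2 (shiftn k c) := H2_iter_ushift cH.
apply: ip_eq0_pythagoras => // a; rewrite (nrm2_shiftn_inner 0) nrm2_shiftn_inner mulr1.
have -> : c - a *: shiftn k c = polymul 0 k.+1 (@monom R 0 + (- a) *: @monom R k) c.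
  by rewrite polymulDZ !polymul_monom// scaleNr.
have coefE j : normc ((@monom R 0 + (- a) *: @monom R k) j) ^+ 2 =
    (if j == 0%N then 1 else 0) + (if j == k then normc a ^+ 2 else 0).
  rewrite -[(_ + _) j]/((j == 0%N)%:R + (- a) * (j == k)%:R).
  have [->|j0] := eqVneq j 0%N; first by rewrite ltn_eqF// mulr0 !addr0 normc1 expr1n.
  by case: eqP => _; rewrite ?mulr1 ?mulr0 !add0r ?normcN ?normc0 ?expr0n.
rewrite nrm2_polymul_inner; under eq_bigr do rewrite coefE.
by rewrite big_split/= -!big_mkcond !big_nat1_eq/= ltnSn.
Qed.

End InnerFunction.

(** * Subspaces invariant under the square of the compressed shift *)

Section CompressedShift.
Variable R : realType.
Implicit Types (x y w : cseq R) (a : R[i]).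
Variables (H : set (cseq R)) (T : cseq R -> cseq R).
Hypothesis H_closed : closed_subspace (@H2 R) H.
Hypothesis H_bshift : forall x, H x -> H (bshift x).
Hypothesis T_proj : forall x, H x -> is_proj H (ushift x) (T x).

Let H_H2 : H `<=` @H2 R := closed_subspace_sub H_closed.

Lemma eq_from_ip x y : H x -> H y -> (forall w, H w -> ip x w = ip y w) -> x = y.
Proof.
move=> Hx Hy xy; have Hxy := closed_subspaceB H_closed Hx Hy; have xyH := H_H2 Hxy.
apply/eqP; rewrite -subr_eq0; apply/eqP/(nrm2_eq0 xyH)/complexI.
by rewrite -ip_self// (ipBl (H_H2 Hx) (H_H2 Hy) xyH) xy// subrr.
Qed.

Lemma compression_stable x : H x -> H (T x).
Proof. by move=> /T_proj[]. Qed.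

Lemma ip_compression x w : H x -> H w -> ip (T x) w = ip x (bshift w).
Proof.
move=> Hx Hw; have [HTx /(_ _ Hw)] := T_proj Hx; have xH := H_H2 Hx; have wH := H_H2 Hw.
rewrite -[fun n => _]/(ushift x - T x) (ipBl (H2_ushift xH) (H_H2 HTx) wH) ip_ushiftl//.
by move=> /eqP; rewrite subr_eq0 => /eqP ->.
Qed.

Lemma ip_compression2 x w : H x -> H w -> ip (T (T x)) w = ip x (bshift (bshift w)).
Proof.
by move=> Hx Hw; rewrite !ip_compression//; [exact: H_bshift|exact: compression_stable].
Qed.

Lemma compression_linear a x y : H x -> H y -> T (a *: x + y) = a *: T x + T y.
Proof.
move=> Hx Hy; have HTx := compression_stable Hx; have HTy := compression_stable Hy.
have Hl := closed_subspaceD H_closed (closed_subspaceZ a H_closed Hx) Hy.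
apply: eq_from_ip => [||w Hw]; first exact: compression_stable.
  exact: closed_subspaceD H_closed (closed_subspaceZ a H_closed HTx) HTy.
have bwH := H_H2 (H_bshift Hw).
rewrite ip_compression// (ipDl (H2Z a (H_H2 Hx)) (H_H2 Hy) bwH) (ipZl a (H_H2 Hx) bwH).
rewrite (ipDl (H2Z a (H_H2 HTx)) (H_H2 HTy) (H_H2 Hw)) (ipZl a (H_H2 HTx) (H_H2 Hw)).
by rewrite !ip_compression.
Qed.

Lemma nrm_compression_le x : H x -> nrm (T x) <= nrm x.
Proof.
move=> Hx; have HTx := compression_stable Hx; have xH := H_H2 Hx; have TxH := H_H2 HTx.
have [->|T0] := eqVneq (nrm (T x)) 0; first exact: nrm_ge0.
have T_gt0 : 0 < nrm (T x) by rewrite lt_neqAle eq_sym T0 nrm_ge0.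
rewrite -(ler_pM2r T_gt0) -expr2 sqr_nrm//.
have -> : nrm2 (T x) = normc (ip (ushift x) (T x)).
  by rewrite ip_ushiftl// -ip_compression// ip_self// normc_real ger0_norm// nrm2_ge0.
apply: le_trans (ip_cauchy_schwarz (H2_ushift xH) TxH) _.
by rewrite ler_wpM2r ?nrm_ge0 ?nrm_ushift_le.
Qed.

Lemma bounded_op_compression : bounded_op H T.
Proof.
split; first exact: compression_stable.
split; first exact: compression_linear.
by exists 1 => x Hx; rewrite mul1r nrm_compression_le.
Qed.

Lemma adjoint_compression2 : is_adjoint H (fun x => T (T x)) (fun x => bshift (bshift x)).
Proof. by split=> [x Hx|x y Hx Hy]; [do 2 apply: H_bshift|exact: ip_compression2]. Qed.

Lemma ip_disjoint_support x y : (forall n, x n = 0 \/ y n = 0) -> ip x y = 0.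
Proof.
move=> xy; rewrite /ip (_ : series _ = cst 0); first by apply: cvgc_lim; exact: cvg_cst.
apply/funext => n; apply: big1 => k _.
by have [->|->] := xy k; rewrite ?conjc0 ?mul0r ?mulr0.
Qed.

Lemma iter_bshiftE k x n : iter k (@bshift R) x n = x (n + k)%N.
Proof. by elim: k n => [|k IH] n; rewrite ?addn0// iterS /bshift IH addSnnS. Qed.

Lemma compression2_Lat_neq_Lat' (d : cseq R) : H2 d -> H (bshift d) ->
  (forall n, odd n -> d n = 0) -> bshift d != 0 ->
  Lat H (fun x => T (T x)) <> Lat' H (fun x => T (T x)).
Proof.
move=> dH Hbd d_even bd0 LatE; pose B k := iter k (@bshift R) (bshift d).
have HB k : H (B k) by elim: k => // k; exact: H_bshift.
pose M := H `&` orth [set B k.*2 | k in setT].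
have B_sub : [set B k.*2 | k in setT] `<=` @H2 R by move=> _ [k _ <-]; exact/H_H2/HB.
have MB1 : M (B 1%N).
  split=> //; split=> [|_ [k _ <-]]; first exact: H_H2.
  apply: ip_disjoint_support => n; rewrite /B !iter_bshiftE /bshift addn1.
  have [n_odd|n_even] := boolP (odd n); [left|right]; apply: d_even; first by rewrite /= negbK.
  by rewrite /= oddD odd_double addbF.
have [_ M_hyper] : Lat' H (fun x => T (T x)) M.
  rewrite -LatE; split; first exact: closed_subspaceI (orth_closed_subspace B_sub).
  move=> x [Hx [xH x_orth]]; have HTTx : H (T (T x)) by do 2 apply: compression_stable.
  split=> //; split=> [|_ [k _ <-]]; first exact: H_H2.
  by rewrite ip_compression2//; apply: x_orth; exists k.+1.
have [_ [_ /(_ (B 0%N))]] := M_hyper T bounded_op_compression (fun _ _ => erefl) _ MB1.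
have B1H := H_H2 (HB 1%N).
rewrite ip_compression// (ip_self B1H) => /(_ (ex_intro2 _ _ 0%N I erefl)).
move=> /complexI/(nrm2_eq0 B1H) B1_0; case/eqP: bd0; apply/funext => -[|n]; first exact: d_even.
by have := congr1 (fun x => x n) B1_0; rewrite /B iter_bshiftE addn1.
Qed.

End CompressedShift.

Lemma det2_eq0 (K : idomainType) (u w u' w' p q : K) : (p != 0) || (q != 0) ->
  u * p + w * q = 0 -> u' * p + w' * q = 0 -> u * w' = w * u'.
Proof.
move=> pq e e'; apply/eqP; rewrite -subr_eq0.
have dp : (u * w' - w * u') * p = 0.
  have -> : (u * w' - w * u') * p = w' * (u * p + w * q) - w * (u' * p + w' * q) by ring.
  by rewrite e e' !mulr0 subrr.
have dq : (u * w' - w * u') * q = 0.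
  have -> : (u * w' - w * u') * q = u * (u' * p + w' * q) - u' * (u * p + w * q) by ring.
  by rewrite e e' !mulr0 subrr.
by case/orP: pq => nz; apply/eqP; apply: (mulIf nz); rewrite ?dp ?dq mul0r.
Qed.

Section PairProjection.
Variable R : realType.
Implicit Types (x y w : cseq R) (a b z : R[i]).

Definition evenpart x : cseq R := fun n => if odd n then 0 else x n.

Lemma H2_evenpart x : H2 x -> H2 (evenpart x).
Proof.
move=> xH; apply: (H2_bound (B := nrm2 x) _).1 => n; apply: le_trans (series_le_nrm2 n xH).
apply: ler_sum => k _; rewrite /evenpart; case: ifP => // _.
by rewrite normc0 expr0n sqr_ge0.
Qed.

Lemma evenpart_idem x : evenpart (evenpart x) = evenpart x.
Proof. by apply/funext => n; rewrite /evenpart; case: (odd n). Qed.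

Lemma ip_evenpart x y : ip (evenpart x) y = ip x (evenpart y).
Proof.
congr (limn (series _)); apply/funext => n; rewrite /evenpart.
by case: (odd n); rewrite ?mul0r ?conjc0 ?mulr0.
Qed.

Lemma ev_evenpart_opp x z : ev (evenpart x) (- z) = ev (evenpart x) z.
Proof.
rewrite ev_opp; congr (ev _ _); apply/funext => n; rewrite /evenpart.
by case: ifPn => [_|n_even]; rewrite ?mulr0// -signr_odd (negbTE n_even) mul1r.
Qed.

(* The projection onto the sequences whose consecutive pairs [(x (2n), x (2n+1))] are
   multiples of the unit vector [(a, b)]; [paircoef] holds the multiples. *)
Definition paircoef a b x := evenpart (a^* *: x + b^* *: bshift x).
Definition pairproj a b x := a *: paircoef a b x + b *: ushift (paircoef a b x).

Lemma H2_paircoef a b x : H2 x -> H2 (paircoef a b x).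
Proof.
by move=> xH; apply: H2_evenpart; apply: H2D; apply: H2Z => //; exact: H2_bshift.
Qed.

Global Arguments H2_paircoef a b {x} _.

Lemma H2_pairproj a b x : H2 x -> H2 (pairproj a b x).
Proof.
move=> /(H2_paircoef a b) pH.
by apply: H2D; apply: H2Z => //; exact: H2_ushift.
Qed.

Global Arguments H2_pairproj a b {x} _.

Lemma ip_pairproj_paircoef a b x y : H2 x -> H2 y ->
  ip (pairproj a b x) y = ip (paircoef a b x) (paircoef a b y).
Proof.
move=> xH yH; have pH := H2_paircoef a b xH; have spH := H2_ushift pH.
have byH := H2_bshift yH.
rewrite [paircoef a b y]/paircoef -ip_evenpart evenpart_idem -/(paircoef a b x).
rewrite ipDr; [|exact: H2Z..|exact: pH].
rewrite !ipZr// !conjcK (ipDl (H2Z a pH) (H2Z b spH) yH) (ipZl a pH yH) (ipZl b spH yH).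
by rewrite ip_ushiftl.
Qed.

Lemma ip_pairproj a b x y : H2 x -> H2 y -> ip (pairproj a b x) y = ip x (pairproj a b y).
Proof.
move=> xH yH; rewrite (ipC (H2_pairproj a b yH) xH) !ip_pairproj_paircoef//.
by rewrite -ipC//; exact: H2_paircoef.
Qed.

Lemma pairprojD a b x y : pairproj a b (x + y) = pairproj a b x + pairproj a b y.
Proof.
have pD : paircoef a b (x + y) = paircoef a b x + paircoef a b y.
  apply/funext => n; rewrite -[RHS]/(paircoef a b x n + paircoef a b y n).
  rewrite /paircoef /evenpart; case: ifP => _; first by rewrite addr0.
  rewrite -[LHS]/(a^* * (x n + y n) + b^* * (x n.+1 + y n.+1)) !mulrDr.
  exact: addrACA.
have sD : ushift (paircoef a b x + paircoef a b y) =
    ushift (paircoef a b x) + ushift (paircoef a b y).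
  by apply/funext => -[|n] //; exact: esym (addr0 0).
by rewrite /pairproj pD sD !scalerDr addrACA.
Qed.

Lemma pairproj_bshift2 a b x :
  pairproj a b (bshift (bshift x)) = bshift (bshift (pairproj a b x)).
Proof.
have pB n : paircoef a b (bshift (bshift x)) n = paircoef a b x n.+2.
  by rewrite /paircoef /evenpart/= negbK.
apply/funext => -[|n].
  by rewrite -[LHS]/(a * paircoef a b (bshift (bshift x)) 0%N + b * 0) pB.
rewrite -[LHS]/(a * paircoef a b (bshift (bshift x)) n.+1 +
  b * paircoef a b (bshift (bshift x)) n).
by rewrite !pB.
Qed.

Lemma pairproj_eq0 a b x :
  (forall n, ~~ odd n -> a^* * x n + b^* * x n.+1 = 0) -> pairproj a b x = 0.
Proof.
move=> x_pairs; have p0 : paircoef a b x = 0.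
  by apply/funext => n; rewrite /paircoef /evenpart; case: ifPn => // /x_pairs.
rewrite /pairproj p0 scaler0 add0r (_ : ushift 0 = 0) ?scaler0//.
by apply/funext => -[|n].
Qed.

Lemma conjcNK a : (- a^*)^* = - a.
Proof. by rewrite rmorphN; congr (- _); exact: conjcK. Qed.

Lemma pairproj_compl a b x : a * a^* + b * b^* = 1 ->
  pairproj a b x + pairproj b^* (- a^*) x = x.
Proof.
move=> ab1; apply/funext => n; rewrite -[RHS]mul1r -ab1 /pairproj /paircoef conjcNK conjcK.
rewrite -[LHS]/(a * evenpart _ n + b * ushift _ n + (b^* * evenpart _ n + (- a^*) * ushift _ n)).
case: n => [|n] /=.
  rewrite -![evenpart _ _]/(_ * x 0%N + _ * x 1%N); ring.
rewrite /evenpart/=; case: (odd n) => /=.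
  rewrite -![(_ + _) n.+1]/(_ * x n.+1 + _ * x n.+2); ring.
rewrite -![(_ + _) n]/(_ * x n + _ * x n.+1); ring.
Qed.

Lemma ev_pairproj a b x z : H2 x -> in_disc z ->
  (a - b * z) * ev (pairproj a b x) z = (a + b * z) * ev (pairproj a b x) (- z).
Proof.
move=> xH z1; have Nz1 : in_disc (- z) by apply/in_discN.
have pH := H2_paircoef a b xH; have spH := H2_ushift pH.
have evE t : in_disc t -> ev (pairproj a b x) t = (a + b * t) * ev (paircoef a b x) t.
  move=> t1; rewrite evD ?evZ ?ev_ushift//; try exact: H2_bounded_seq.
  - by rewrite mulrDl mulrA.
  - exact: H2_bounded_seq (H2Z a pH).
  - exact: H2_bounded_seq (H2Z b spH).
rewrite (evE _ z1) (evE _ Nz1) ev_evenpart_opp -/(paircoef a b x); ring.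
Qed.

End PairProjection.

Section ReducingSubspaces.
Variable R : realType.
Implicit Types (x y w : cseq R) (a b : R[i]).

Lemma unit_pair_exists a b : (a != 0) || (b != 0) -> exists2 s : R,
  s != 0 & (a / s%:C) * (a / s%:C)^* + (b / s%:C) * (b / s%:C)^* = 1.
Proof.
move=> ab; pose t := normc a ^+ 2 + normc b ^+ 2.
have t0 : 0 < t.
  case/orP: ab => h; first by rewrite ltr_pwDl ?sqr_ge0// exprn_gt0// normc_gt0.
  by rewrite ltr_wpDl ?sqr_ge0// exprn_gt0// normc_gt0.
have s0 : Num.sqrt t != 0 by rewrite gt_eqF// sqrtr_gt0.
exists (Num.sqrt t) => //; rewrite !mulcJ -rmorphD !normcM -fmorphV normc_real.
rewrite !exprMn -mulrDl -/t real_normK ?num_real// exprVn sqr_sqrtr ?ltW//.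
by rewrite divff ?gt_eqF.
Qed.

Lemma bshift2_pair_ind (P : set (cseq R)) (S : R[i] -> R[i] -> Prop) :
  (forall x, P x -> P (bshift (bshift x))) -> (forall x, P x -> S (x 0%N) (x 1%N)) ->
  forall x n, P x -> ~~ odd n -> S (x n) (x n.+1).
Proof.
move=> Pb PS x n; elim/ltn_ind: n x => -[|[|n]] IH x Px //=; first by move=> _; exact: PS.
by rewrite negbK => n_even; exact: IH (ltnW _) _ (Pb _ Px) n_even.
Qed.

Lemma bshift2_pair_eq0 (P : set (cseq R)) : (forall x, P x -> P (bshift (bshift x))) ->
  (forall x, P x -> x 0%N = 0 /\ x 1%N = 0) -> forall x, P x -> x = 0.
Proof.
move=> Pb P0 x Px; pose S (u v : R[i]) := u = 0 /\ v = 0.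
have x0 n := bshift2_pair_ind (S := S) (n := n) Pb P0 Px.
apply/funext => n; have [n_odd|/x0[]//] := boolP (odd n).
by case: n n_odd => // n /x0[].
Qed.

Variables (H M : set (cseq R)).
Hypothesis H_closed : closed_subspace (@H2 R) H.
Hypothesis M_closed : closed_subspace H M.
Let N := H `&` orth M.
Hypothesis M_bshift2 : forall x, M x -> M (bshift (bshift x)).
Hypothesis N_bshift2 : forall x, N x -> N (bshift (bshift x)).

Let H_H2 : H `<=` @H2 R := closed_subspace_sub H_closed.
Let M_H : M `<=` H := closed_subspace_sub M_closed.

Lemma orth_decomposition x : H x -> exists y w, [/\ M y, N w & x = y + w].
Proof.
move=> Hx; have Mcl := closed_subspace_trans H_closed M_closed.
have [y My xy_orth] := hilbert_projection Mcl (H_H2 Hx).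
exists y, (x - y); split=> //; last by rewrite addrC subrK.
have Hxy : H (x - y) := closed_subspaceB H_closed Hx (M_H My).
by split=> //; split=> //; exact: H_H2.
Qed.

Lemma orth_pairs x y : M x -> N y -> x 0%N * (y 0%N)^* + x 1%N * (y 1%N)^* = 0.
Proof.
move=> Mx Ny; have N_H2 w : N w -> H2 w by case=> /H_H2.
have MN_orth u v : M u -> N v -> ip u v = 0.
  move=> Mu Nv; rewrite (ipC (N_H2 _ Nv) (H_H2 (M_H Mu))).
  by have [_ [_ ->//]] := Nv; rewrite conjc0.
have xH := H_H2 (M_H Mx); have yH := N_H2 _ Ny; have := MN_orth _ _ Mx Ny.
rewrite ip_recl// ip_recl; [|exact: H2_bshift..].
by rewrite (MN_orth _ _ (M_bshift2 Mx) (N_bshift2 Ny)) addr0.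
Qed.

Lemma orth_pairs_lines : [\/ forall x, M x -> x 0%N = 0 /\ x 1%N = 0,
    forall y, N y -> y 0%N = 0 /\ y 1%N = 0 |
    exists a b, [/\ a * a^* + b * b^* = 1, forall x, M x -> b * x 0%N - a * x 1%N = 0 &
      forall y, N y -> a^* * y 0%N + b^* * y 1%N = 0]].
Proof.
have pair_neq0 (P : set (cseq R)) : ~ (forall x, P x -> x 0%N = 0 /\ x 1%N = 0) ->
    exists2 x, P x & (x 0%N != 0) || (x 1%N != 0).
  move=> /existsNP[x /not_implyP[Px x0]]; exists x => //.
  by apply/orP; apply: contra_notP x0 => /not_orP[/negP/negPn/eqP-> /negP/negPn/eqP->].
have [M0|/pair_neq0[x0 Mx0 x0_neq0]] :=
  pselect (forall x, M x -> x 0%N = 0 /\ x 1%N = 0); first exact: Or31.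
have [N0|/pair_neq0[y0 Ny0 y0_neq0]] :=
  pselect (forall y, N y -> y 0%N = 0 /\ y 1%N = 0); first exact: Or32.
have [s s0 ab1] := unit_pair_exists x0_neq0; have sC0 : s%:C != 0 by rewrite fmorph_eq0.
apply: Or33; exists (x0 0%N / s%:C), (x0 1%N / s%:C); split=> // [x Mx|y Ny].
  have y0J_neq0 : ((y0 0%N)^* != 0) || ((y0 1%N)^* != 0) by rewrite !fmorph_eq0.
  have := det2_eq0 y0J_neq0 (orth_pairs Mx0 Ny0) (orth_pairs Mx Ny0).
  move=> /eqP; rewrite -subr_eq0 => /eqP det0.
  have -> : x0 1%N / s%:C * x 0%N - x0 0%N / s%:C * x 1%N =
    - ((x0 0%N * x 1%N - x0 1%N * x 0%N) / s%:C) by field.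
  by rewrite det0 mul0r oppr0.
have divJ (t : R[i]) : (t / s%:C)^* = t^* / s%:C.
  by rewrite rmorphM fmorphV; congr (_ / _); exact: conjc_real.
have := congr1 (fun t => t^* / s%:C) (orth_pairs Mx0 Ny).
rewrite !divJ conjc0 mul0r rmorphD !rmorphM => /= <-.
rewrite !conjcK; field; exact: sC0.
Qed.

Theorem bshift2_reducing : [\/ M = [set 0], M = H |
  exists a b, a * a^* + b * b^* = 1 /\ forall x, H x -> H (pairproj a b x)].
Proof.
have [M0|N0|[a [b [ab1 M_line N_line]]]] := orth_pairs_lines.
- apply: Or31; apply/seteqP; split=> [x|_ ->]; last exact: closed_subspace0 M_closed.
  exact: bshift2_pair_eq0 M_bshift2 M0 x.
- apply: Or32; apply/seteqP; split=> // x /orth_decomposition[y [w [My Nw ->]]].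
  by rewrite (bshift2_pair_eq0 N_bshift2 N0 Nw) addr0.
- apply: Or33; exists a, b; split=> // x /orth_decomposition[y [w [My Nw ->]]].
  have Qw : pairproj a b w = 0.
    pose S u v := a^* * u + b^* * v = 0.
    by apply: pairproj_eq0 => n; exact: (bshift2_pair_ind (S := S) N_bshift2 N_line Nw).
  have Qy : pairproj b^* (- a^*) y = 0.
    pose S u v := b * u - a * v = 0.
    apply: pairproj_eq0 => n n_even; rewrite conjcK conjcNK mulNr.
    exact: (bshift2_pair_ind (S := S) M_bshift2 M_line My n_even).
  rewrite pairprojD Qw addr0; apply: M_H.
  by have := pairproj_compl y ab1; rewrite Qy addr0 => ->.
Qed.

End ReducingSubspaces.

Section CoinvariantSpace.
Variables (R : realType) (c : cseq R).
Implicit Types (v w x : cseq R) (a b : R[i]).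
Local Notation shiftn k c := (iter k (@ushift R) c).
Hypothesis cH : H2 c.

Lemma coinv_closed : closed_subspace (@H2 R) (coinv c).
Proof. by apply: orth_closed_subspace => _ [k _ <-]; exact: H2_iter_ushift. Qed.

Lemma coinvP x : H2 x -> (forall k, ip x (shiftn k c) = 0) -> coinv c x.
Proof. by move=> xH x_orth; split=> // _ [k _ <-]. Qed.

Lemma coinv_orth x k : coinv c x -> ip x (shiftn k c) = 0.
Proof. by case=> _ ->//; exists k. Qed.

Lemma coinv_bshift x : coinv c x -> coinv c (bshift x).
Proof.
move=> xc; have [xH _] := xc; apply: coinvP => [|k]; first exact: H2_bshift.
rewrite ip_bshiftl//; [exact: (coinv_orth k.+1)|exact: H2_iter_ushift].
Qed.

Lemma ip_shiftn_coinv k x : coinv c x -> ip (shiftn k c) x = 0.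
Proof.
move=> xc; have [xH _] := xc; have kH : H2 (shiftn k c) := H2_iter_ushift cH.
by rewrite (ipC xH kH) coinv_orth// conjc0.
Qed.

Hypothesis c_unit : ip c c = 1.
Hypothesis c_orth : forall k, ip c (shiftn k.+1 c) = 0.

Let scH : H2 (ushift c) := H2_ushift cH.

Let ip_ushift_self : ip (ushift c) (ushift c) = 1.
Proof. by rewrite ip_ushiftl. Qed.

Lemma coinv_bshift_self : coinv c (bshift c).
Proof.
apply: coinvP => [|k]; first exact: H2_bshift.
rewrite ip_bshiftl//; [exact: (c_orth k)|exact: H2_iter_ushift].
Qed.

Lemma coinv_orth_span2 v : H2 v -> (forall w, coinv c w -> ip v w = 0) ->
  (forall k, ip v (shiftn k.+2 c) = 0) -> v = ip v c *: c + ip v (ushift c) *: ushift c.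
Proof.
move=> vH v_coinv v_shift; set g := ip v c; set h := ip v (ushift c).
pose s := g *: c + h *: ushift c; have sH : H2 s := H2D (H2Z g cH) (H2Z h scH).
have ip_s w : H2 w -> ip s w = g * ip c w + h * ip (ushift c) w.
  by move=> wH; rewrite (ipDl (H2Z g cH) (H2Z h scH) wH) (ipZl g cH wH) (ipZl h scH wH).
have vsH : H2 (v - s) := H2B vH sH.
have vs_coinv : coinv c (v - s).
  apply: coinvP => // k; have kH : H2 (shiftn k c) := H2_iter_ushift cH.
  rewrite (ipBl vH sH kH) (ip_s _ kH).
  case: k kH => [|[|k]] kH.
  - by rewrite /= c_unit (ipC cH scH) (c_orth 0) conjc0 mulr0 addr0 mulr1 subrr.
  - by rewrite (c_orth 0) ip_ushift_self mulr0 add0r mulr1 subrr.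
  - rewrite v_shift c_orth ip_ushiftl//.
    by rewrite -[bshift _]/(shiftn k.+1 c) c_orth !mulr0 addr0 subrr.
have vs_self : ip (v - s) (v - s) = 0.
  rewrite (ipBl vH sH vsH) v_coinv// (ip_s _ vsH) (ip_shiftn_coinv 0 vs_coinv).
  by rewrite (ip_shiftn_coinv 1 vs_coinv) !mulr0 addr0 subrr.
apply/eqP; rewrite -subr_eq0; apply/eqP/(nrm2_eq0 vsH)/complexI.
by rewrite -ip_self.
Qed.

Section StablePairProjection.
Variables a b : R[i].
Hypothesis coinv_pairproj : forall x, coinv c x -> coinv c (pairproj a b x).
Local Notation Q := (pairproj a b).

Lemma pairproj_span2 v : H2 v -> (forall w, coinv c w -> ip v w = 0) ->
  coinv c (bshift (bshift v)) -> Q v = ip (Q v) c *: c + ip (Q v) (ushift c) *: ushift c.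
Proof.
move=> vH v_coinv v_bshift2; have QvH := H2_pairproj a b vH.
apply: coinv_orth_span2 => // [w wc|k].
  have [wH _] := wc; rewrite ip_pairproj//; exact/v_coinv/coinv_pairproj.
have kH : H2 (shiftn k c) := H2_iter_ushift cH.
rewrite -[shiftn k.+2 c]/(ushift (ushift (shiftn k c))).
rewrite -ip_bshiftl//; last exact: H2_ushift.
rewrite -ip_bshiftl//; last exact: H2_bshift.
by rewrite -pairproj_bshift2; exact/coinv_orth/coinv_pairproj.
Qed.

Lemma pairproj_generators : exists g g' h, [/\ g^* = g,
  Q c = g *: c + h *: ushift c & Q (ushift c) = h^* *: c + g' *: ushift c].
Proof.
exists (ip (Q c) c), (ip (Q (ushift c)) (ushift c)), (ip (Q c) (ushift c)).
have QcH := H2_pairproj a b cH; split.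
- by rewrite -ipC// -ip_pairproj.
- apply: pairproj_span2 => // [w|]; first exact: (ip_shiftn_coinv 0).
  exact/coinv_bshift/coinv_bshift_self.
- rewrite -ipC// -ip_pairproj//; apply: pairproj_span2 => // [w|].
    exact: (ip_shiftn_coinv 1).
  exact: coinv_bshift_self.
Qed.

End StablePairProjection.

End CoinvariantSpace.

(** * Parity *)

Section PairSymmetry.
Variable R : realType.
Implicit Types (a b u w z : R[i]) (F : R[i] -> R[i]) (x : cseq R).

Lemma dnbhs0_binomial_neq0 a b k : (0 < k)%N -> (a != 0) || (b != 0) ->
  \forall z \near 0^', a + b * z ^+ k != 0.
Proof.
move=> k0 ab; have aH := H2Z a (H2_monom (k := 0%N)); have bH := H2Z b (H2_monom (k := k)).
pose x : cseq R := a *: @monom R 0 + b *: @monom R k; have xH : H2 x := H2D aH bH.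
have x0 : x != 0.
  apply/eqP => xE; have := congr1 (fun y => y 0%N) xE; have := congr1 (fun y => y k) xE.
  rewrite -![x _]/(a * _%:R + b * _%:R) !eqxx [_ == k]eq_sym (gtn_eqF k0).
  rewrite !mulr0 !mulr1 addr0 add0r => /= b0 a0.
  by move: ab; rewrite a0 b0 eqxx.
near=> z; have z1 : in_disc z by near: z; exact/nbhs_dnbhs/near0_in_disc.
have -> : a + b * z ^+ k = ev x z.
  rewrite (evD (H2_bounded_seq aH) (H2_bounded_seq bH) z1).
  rewrite (evZ a (H2_bounded_seq (@H2_monom R 0)) z1) (evZ b (H2_bounded_seq (@H2_monom R k)) z1).
  by rewrite !ev_monom// mulr1.
by near: z; exact: dnbhs0_ev_neq0 (H2_bounded_seq xH) x0.
Unshelve. all: by end_near. Qed.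

Lemma dnbhs0_binomial_eq0 a b k : (0 < k)%N ->
  (\forall z \near (0 : R[i])^', a + b * z ^+ k = 0) -> a = 0 /\ b = 0.
Proof.
move=> k0 ab0; apply: contrapT => ab.
have ab_neq0 : (a != 0) || (b != 0).
  by apply: contra_notT ab => /norP[/negPn/eqP-> /negPn/eqP->].
have : \forall z \near (0 : R[i])^', False.
  by apply: filterS2 (dnbhs0_binomial_neq0 k0 ab_neq0) ab0 => z /eqP.
by move=> /filter_const.
Qed.

Lemma dnbhs0_ev_neq0N x : bounded_seq x -> x != 0 ->
  \forall z \near 0^', ev x z != 0 /\ ev x (- z) != 0.
Proof.
move=> xb x_neq0; pose y : cseq R := fun n => (-1) ^+ n * x n.
have y_neq0 : y != 0.
  apply: contra x_neq0 => /eqP y0; apply/eqP/funext => n; apply/eqP.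
  by have /eqP := congr1 (fun y => y n) y0; rewrite mulf_eq0 signr_eq0.
apply: filterS2 (dnbhs0_ev_neq0 xb x_neq0) (dnbhs0_ev_neq0 (bounded_seq_alt xb) y_neq0).
by move=> z xz; rewrite -ev_opp.
Qed.

Lemma ev_alt_of_dnbhs0 x (s : R[i]) : bounded_seq x ->
  (\forall z \near 0^', ev x z = s * ev x (- z)) -> forall n, x n = s * ((-1) ^+ n * x n).
Proof.
move=> xb x_near; have altb := bounded_seq_alt xb.
have xE : x = s *: (fun n => (-1) ^+ n * x n).
  apply: ev_inj => //; first exact: bounded_seqZ.
  near=> z; rewrite evZ//; last by near: z; exact/nbhs_dnbhs/near0_in_disc.
  by rewrite -ev_opp; near: z.
by move=> n; rewrite {1}xE.
Unshelve. all: by end_near. Qed.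

(* The relation satisfied by [F] when [(u + w z) F z] is the sum of a series whose consecutive
   pairs of coefficients are multiples of [(a, b)]. *)
Definition pair_symmetric F a b u w := forall z, in_disc z ->
  (a - b * z) * (u + w * z) * F z = (a + b * z) * (u - w * z) * F (- z).

Lemma pair_symmetricZ F a b u w (e : R[i]) : e != 0 ->
  pair_symmetric F a b (e * u) (e * w) -> pair_symmetric F a b u w.
Proof.
move=> e0 sym z /sym h; apply: (mulfI e0).
transitivity ((a - b * z) * (e * u + e * w * z) * F z); first by ring.
by rewrite h; ring.
Qed.

Lemma unit_pair_neq0 a b : a * a^* + b * b^* = 1 -> (a != 0) || (b != 0).
Proof.
apply: contra_eqT => /norP[/negPn/eqP-> /negPn/eqP->].
by rewrite !mul0r addr0 eq_sym oner_neq0.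
Qed.

Lemma unit_pair_proportional a b u w : a * a^* + b * b^* = 1 -> (u != 0) || (w != 0) ->
  u * b = w * a -> exists e, [/\ e != 0, u = e * a & w = e * b].
Proof.
move=> ab1 uw ubwa; exists (u * a^* + w * b^*).
have uE : u = (u * a^* + w * b^*) * a.
  rewrite -[LHS]mulr1 -ab1; transitivity (u * a^* * a + u * b * b^*); first by ring.
  by rewrite ubwa; ring.
have wE : w = (u * a^* + w * b^*) * b.
  rewrite -[LHS]mulr1 -ab1; transitivity (w * a * a^* + w * b^* * b); first by ring.
  by rewrite -ubwa; ring.
split=> //; apply/eqP => e0; move: uE wE uw.
by rewrite e0 !mul0r => -> ->; rewrite eqxx.
Qed.

Section NonzeroNearZero.
Variable F : R[i] -> R[i].
Hypothesis F_neq0 : \forall z \near 0^', F z != 0 /\ F (- z) != 0.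

Lemma pair_symmetric_det a b u w u' w' : (a != 0) || (b != 0) ->
  pair_symmetric F a b u w -> pair_symmetric F a b u' w' -> u * w' = w * u'.
Proof.
move=> ab sym sym'; have abN : (a != 0) || (- b != 0) by rewrite oppr_eq0.
have : \forall z \near (0 : R[i])^', u * w' = w * u'.
  near=> z; have z1 : in_disc z by near: z; exact/nbhs_dnbhs/near0_in_disc.
  pose p := (a - b * z) * F z - (a + b * z) * F (- z).
  pose q := z * ((a - b * z) * F z + (a + b * z) * F (- z)).
  have linear (v t : R[i]) : pair_symmetric F a b v t -> v * p + t * q = 0.
    move=> /(_ _ z1) /eqP; rewrite -subr_eq0 => /eqP <-; rewrite /p /q; ring.
  apply: (@det2_eq0 _ _ _ _ _ p q); [|exact: linear..].
  apply: contraTT isT => /norP[/negPn/eqP p0 /negPn/eqP q0].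
  have z0 : z != 0 by near: z; exact: nbhs_dnbhs_neq.
  have : a + (- b) * z ^+ 1 != 0 by near: z; exact: dnbhs0_binomial_neq0.
  have [Fz _] : F z != 0 /\ F (- z) != 0 by near: z.
  case/eqP; apply: (mulIf Fz); rewrite mul0r expr1.
  have /eqP : z * 2 * ((a + - b * z) * F z) = 0.
    transitivity (z * p + q); last by rewrite p0 q0 mulr0 addr0.
    by rewrite /p /q; ring.
  by rewrite mulf_eq0 (negbTE (mulf_neq0 z0 _)) ?pnatr_eq0//= => /eqP.
by move=> /filter_const.
Unshelve. all: by end_near. Qed.

(* Dividing the two symmetries by [F z * F (- z)] leaves an identity between polynomials in [z],
   whose coefficients give the two equations. *)
Lemma pair_symmetric_cross a b u w : a * a^* + b * b^* = 1 ->
  pair_symmetric F a b u w -> pair_symmetric F b^* (- a^*) (- w^*) u^* ->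
  a * b^* * (u * u^* + w * w^*) = u * w^* /\ b * a^* * (u * u^* + w * w^*) = w * u^*.
Proof.
move=> ab1 sym sym_compl; set n := _ + _.
suff [] : a * b^* * n - u * w^* = 0 /\ b * a^* * n - w * u^* = 0.
  by split; apply/eqP; rewrite -subr_eq0; apply/eqP.
apply: (@dnbhs0_binomial_eq0 _ _ 2) => //; near=> z.
have z1 : in_disc z by near: z; exact/nbhs_dnbhs/near0_in_disc.
have z0 : z != 0 by near: z; exact: nbhs_dnbhs_neq.
have [Fz FNz] : F z != 0 /\ F (- z) != 0 by near: z.
have FF : F z * F (- z) != 0 by rewrite mulf_neq0.
have := congr2 (fun s t => s * t) (sym _ z1) (esym (sym_compl _ z1)).
move=> /eqP; rewrite -subr_eq0 => /eqP h.
apply: (mulfI (mulf_neq0 (mulf_neq0 z0 (_ : 2%:R != 0)) FF)); first by rewrite pnatr_eq0.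
have ab1M t : t = (a * a^* + b * b^*) * t by rewrite ab1 mul1r.
rewrite mulr0 -oppr0 -h (ab1M (u * w^*)) (ab1M (w * u^*)) /n; ring.
Unshelve. all: by end_near. Qed.

(* The two equations of [pair_symmetric_cross] make the product of [u * b - w * a] and
   [u * a^* - w * b^*] vanish. *)
Lemma pair_symmetric_dichotomy a b u w : a * a^* + b * b^* = 1 -> (u != 0) || (w != 0) ->
  pair_symmetric F a b u w -> pair_symmetric F b^* (- a^*) (- w^*) u^* ->
  pair_symmetric F a b a b \/ pair_symmetric F a b b^* a^*.
Proof.
move=> ab1 uw sym sym_compl; have [abJ_eq baJ_eq] := pair_symmetric_cross ab1 sym sym_compl.
have n0 : u * u^* + w * w^* != 0.
  rewrite !mulcJ -rmorphD fmorph_eq0 paddr_eq0 ?sqr_ge0// !sqrf_eq0 !normc_eq0.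
  by apply: contraL uw => /andP[/eqP-> /eqP->]; rewrite eqxx.
have : (u * b - w * a) * (u * a^* - w * b^*) == 0.
  apply/eqP/(mulIf n0); set n := _ + _ in abJ_eq baJ_eq *; rewrite mul0r.
  transitivity (u ^+ 2 * (b * a^* * n) + w ^+ 2 * (a * b^* * n) -
    u * w * (a * a^* + b * b^*) * n); first by ring.
  by rewrite abJ_eq baJ_eq ab1 /n; ring.
rewrite mulf_eq0 !subr_eq0 => /orP[]/eqP.
  move=> /(unit_pair_proportional ab1 uw)[e [e0 uE wE]]; left.
  by apply: (pair_symmetricZ e0); rewrite -uE -wE.
have ab1J : b^* * b^*^* + a^* * a^*^* = 1 by rewrite !conjcK -ab1; ring.
move=> /(unit_pair_proportional ab1J uw)[e [e0 uE wE]]; right.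
by apply: (pair_symmetricZ e0); rewrite -uE -wE.
Qed.

End NonzeroNearZero.

Lemma pair_symmetric_even x a b : bounded_seq x -> (a != 0) || (b != 0) ->
  pair_symmetric (ev x) a b a b -> forall z, ev x z = ev x (- z).
Proof.
move=> xb ab sym z; suff x_alt : forall n, x n = 1 * ((-1) ^+ n * x n).
  by rewrite ev_opp; congr (ev _ _); apply/funext => n; rewrite {1}x_alt mul1r.
have ab2 : (a ^+ 2 != 0) || (- b ^+ 2 != 0) by rewrite oppr_eq0 !sqrf_eq0.
apply: ev_alt_of_dnbhs0 => //; near=> w.
have w1 : in_disc w by near: w; exact/nbhs_dnbhs/near0_in_disc.
have : a ^+ 2 + (- b ^+ 2) * w ^+ 2 != 0 by near: w; exact: dnbhs0_binomial_neq0.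
move=> /mulfI; apply; rewrite mul1r.
transitivity ((a - b * w) * (a + b * w) * ev x w); first by ring.
by rewrite sym//; ring.
Unshelve. all: by end_near. Qed.

End PairSymmetry.

Section BlaschkeSymmetry.
Variable R : realType.
Implicit Types (a b l z : R[i]) (F : R[i] -> R[i]) (x : cseq R).

Definition blaschke_symmetric F l := forall z, in_disc z ->
  (z + l) * (1 - l^* * z) * F z = (l - z) * (1 + l^* * z) * F (- z).

Lemma pair_symmetric_blaschke_lt F a b : normc b < normc a ->
  pair_symmetric F a b b^* a^* -> exists2 l, in_disc l & blaschke_symmetric F l.
Proof.
move=> ba sym; have na : 0 < normc a := le_lt_trans (normc_ge0 _) ba.
have a0 : a != 0 by rewrite -normc_gt0.
have aJ0 : a^* != 0 by rewrite fmorph_eq0.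
have lJ : (b^* / a^*)^* = b / a by rewrite rmorphM fmorphV; congr (_ / _); exact: conjcK.
exists (b^* / a^*) => [|z /sym h].
  by rewrite /in_disc normcM normcV !normc_conj ltr_pdivrMr// mul1r.
apply: (mulfI (mulf_neq0 a0 aJ0)); rewrite lJ.
transitivity ((a - b * z) * (b^* + a^* * z) * F z); first by field; rewrite a0 aJ0.
by rewrite h; field; rewrite a0 aJ0.
Qed.

(* Replacing [(a, b)] by the orthogonal pair [(conjc b, - conjc a)] only negates both sides. *)
Lemma pair_symmetric_blaschke F a b : normc a != normc b -> pair_symmetric F a b b^* a^* ->
  exists2 l, in_disc l & blaschke_symmetric F l.
Proof.
rewrite neq_lt => /orP[ab sym|ba]; last exact: pair_symmetric_blaschke_lt.
apply: (@pair_symmetric_blaschke_lt _ b^* (- a^*)).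
  by rewrite normcN !normc_conj.
move=> z /sym h; rewrite conjcNK conjcK; apply: oppr_inj.
transitivity ((a - b * z) * (b^* + a^* * z) * F z); first by ring.
by rewrite h; ring.
Qed.

Lemma blaschke_symmetric_zero x l : bounded_seq x -> in_disc l ->
  blaschke_symmetric (ev x) l -> ev x l = 0.
Proof.
move=> xb l1 sym; have [l0|l_neq0] := eqVneq l 0.
  have x_alt : forall n, x n = -1 * ((-1) ^+ n * x n).
    apply: ev_alt_of_dnbhs0 => //; near=> z.
    have z1 : in_disc z by near: z; exact/nbhs_dnbhs/near0_in_disc.
    have z0 : z != 0 by near: z; exact: nbhs_dnbhs_neq.
    apply: (mulfI z0); have := sym _ z1; rewrite l0 conjc0 !mul0r subr0 !addr0 !mulr1 sub0r => ->.
    by ring.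
  rewrite l0 ev_recl//; last by rewrite -l0.
  rewrite mul0r addr0; apply/eqP; have /eqP := x_alt 0%N.
  by rewrite expr0 mul1r mulN1r -subr_eq0 opprK -mulr2n mulrn_eq0.
have := sym _ l1; rewrite subrr !mul0r => /eqP; rewrite !mulf_eq0 -mulr2n mulrn_eq0/=.
rewrite (negbTE l_neq0) subr_eq0 => /orP[/eqP l_unit|/eqP//].
have : 1 = normc l ^+ 2 by apply: complexI; rewrite -mulcJ mulrC -l_unit.
have : normc l ^+ 2 < 1 by rewrite expr_lt1 ?normc_ge0.
by move=> /[swap] <-; rewrite ltxx.
Unshelve. all: by end_near. Qed.

Lemma blaschke_symmetric_div F l z : in_disc z -> z <> l -> - z <> l ->
  blaschke_symmetric F l -> F z / blaschke l z = F (- z) / blaschke l (- z).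
Proof.
move=> z1 zl Nzl /(_ _ z1) sym.
have zl0 : z - l != 0 by rewrite subr_eq0; apply/eqP.
have Nzl0 : - z - l != 0 by rewrite subr_eq0; apply/eqP.
rewrite /blaschke !invf_div; apply: (mulfI (mulf_neq0 zl0 Nzl0)).
transitivity (- ((z + l) * (1 - l^* * z) * F z)); first by field; rewrite zl0.
by rewrite sym; field; rewrite Nzl0.
Qed.

End BlaschkeSymmetry.

Section Irreducibility.
Variables (R : realType) (c : cseq R).
Implicit Types (a b u w z : R[i]) (v : cseq R).
Local Notation shiftn k c := (iter k (@ushift R) c).
Hypothesis cH : H2 c.
Hypothesis c_unit : ip c c = 1.
Hypothesis c_orth : forall k, ip c (shiftn k.+1 c) = 0.

Let cb : bounded_seq c := H2_bounded_seq cH.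

Lemma unit_seq_neq0 : c != 0.
Proof. by apply: contra_eq_neq c_unit => ->; rewrite ip0l eq_sym oner_neq0. Qed.

Lemma pair_symmetric_range a b u w v : H2 v ->
  pairproj a b v = u *: c + w *: ushift c -> pair_symmetric (ev c) a b u w.
Proof.
move=> vH QvE z z1; have Nz1 : in_disc (- z) by apply/in_discN.
have uwE t : in_disc t -> ev (u *: c + w *: ushift c) t = (u + w * t) * ev c t.
  move=> t1; have scb := bounded_seq_ushift cb.
  rewrite (evD (bounded_seqZ u cb) (bounded_seqZ w scb) t1) (evZ u cb t1) (evZ w scb t1).
  by rewrite ev_ushift// mulrDl mulrA.
have := ev_pairproj a b vH z1; rewrite QvE (uwE _ z1) (uwE _ Nz1) mulrN.
by rewrite !mulrA.
Qed.

(* The matrices of the projection and of its complement in the basis [c], [ushift c] both have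
   rank at most one; a nonzero row of the first one is the required pair. *)
Lemma stable_pairproj_symmetric a b : a * a^* + b * b^* = 1 ->
  (forall x, coinv c x -> coinv c (pairproj a b x)) ->
  exists u w, [/\ (u != 0) || (w != 0), pair_symmetric (ev c) a b u w &
    pair_symmetric (ev c) b^* (- a^*) (- w^*) u^*].
Proof.
move=> ab1 coinv_Q; have [g [g' [h [gJ Qc Qsc]]]] := pairproj_generators cH c_unit c_orth coinv_Q.
have compl v : pairproj b^* (- a^*) v = v - pairproj a b v.
  by apply/eqP; rewrite eq_sym subr_eq addrC pairproj_compl.
have scH := H2_ushift cH.
have compl_c : pairproj b^* (- a^*) c = (1 - g) *: c + (- h) *: ushift c.
  by rewrite compl Qc scalerBl scale1r scaleNr opprD addrA.
have compl_sc : pairproj b^* (- a^*) (ushift c) = (- h^*) *: c + (1 - g') *: ushift c.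
  by rewrite compl Qsc scalerBl scale1r scaleNr opprD addrCA.
have sym_c := pair_symmetric_range cH Qc; have sym_sc := pair_symmetric_range scH Qsc.
have symJ_c := pair_symmetric_range cH compl_c.
have symJ_sc := pair_symmetric_range scH compl_sc.
have F_neq0 := dnbhs0_ev_neq0N cb unit_seq_neq0.
have ab := unit_pair_neq0 ab1; have abJ : (b^* != 0) || (- a^* != 0).
  by rewrite oppr_eq0 !fmorph_eq0 orbC.
have det_Q := pair_symmetric_det F_neq0 ab sym_c sym_sc.
have det_compl := pair_symmetric_det F_neq0 abJ symJ_c symJ_sc.
have trace_Q : 1 - g' = g.
  have -> : g = 1 - g' - ((1 - g) * (1 - g') - g * g') by ring.
  by rewrite det_compl det_Q mulrNN subrr subr0.
have [gh|] := boolP ((g != 0) || (h != 0)).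
  by exists g, h; split; [exact: gh|exact: sym_c|rewrite gJ -trace_Q; exact: symJ_sc].
move=> /norP[/negPn/eqP g0 /negPn/eqP h0]; have g'1 : g' = 1.
  by rewrite -[g'](subKr 1) trace_Q g0 subr0.
exists 0, 1; rewrite oner_neq0 orbT conjc0 conjc1; split=> [//||].
  by move: sym_sc; rewrite h0 g'1 conjc0; exact.
apply: (@pair_symmetricZ _ _ _ _ _ _ (-1)); first by rewrite oppr_eq0 oner_neq0.
by move: symJ_c; rewrite g0 h0 subr0 oppr0 mulrNN mulr1 mulr0; exact.
Qed.

Lemma coinv_pairproj_symmetric a b : a * a^* + b * b^* = 1 ->
  (forall x, coinv c x -> coinv c (pairproj a b x)) ->
  (forall z, ev c z = ev c (- z)) \/ exists2 l, in_disc l & blaschke_symmetric (ev c) l.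
Proof.
move=> ab1 /(stable_pairproj_symmetric ab1)[u [w [uw sym sym_compl]]].
have F_neq0 := dnbhs0_ev_neq0N cb unit_seq_neq0; have ab := unit_pair_neq0 ab1.
have [sym_ab|sym_ba] := pair_symmetric_dichotomy F_neq0 ab1 uw sym sym_compl.
  by left; apply: (pair_symmetric_even cb ab); exact: sym_ab.
have [ab_eq|ab_neq] := eqVneq (normc a) (normc b); last first.
  by right; exact: pair_symmetric_blaschke ab_neq sym_ba.
left; apply: (pair_symmetric_even cb ab).
have baJ : b^* * b = a^* * a by rewrite mulrC mulcJ -ab_eq -mulcJ mulrC.
have ba_neq0 : (b^* != 0) || (a^* != 0) by rewrite !fmorph_eq0 orbC.
have [e [e0 bE aE]] := unit_pair_proportional ab1 ba_neq0 baJ.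
by apply: (pair_symmetricZ e0); rewrite -bE -aE.
Qed.

End Irreducibility.

Section ModelOperator.
Variables (R : realType) (m : R[i] -> R[i]) (T : cseq R -> cseq R).
Hypothesis m_inner : inner_fun m.
Hypothesis T_proj : forall x, model_space m x -> is_proj (model_space m) (ushift x) (T x).
Local Notation H := (model_space m).

Let mH : Hinf m := m_inner.1.

Lemma model_space_closed : closed_subspace (@H2 R) H.
Proof.
have [c mc] := Hinf_taylor_coefs mH; rewrite (model_space_coinv mH mc).
exact/coinv_closed/(H2_taylor_coefs mH mc).
Qed.

Lemma model_space_bshift x : H x -> H (bshift x).
Proof.
have [c mc] := Hinf_taylor_coefs mH; rewrite (model_space_coinv mH mc).
exact/coinv_bshift/(H2_taylor_coefs mH mc).
Qed.

Lemma compression2_reducing M : closed_subspace H M ->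
  op_invariant (fun x => T (T x)) M ->
  (forall B, is_adjoint H (fun x => T (T x)) B -> op_invariant B M) ->
  [\/ M = [set 0], M = H |
    exists a b, a * a^* + b * b^* = 1 /\ forall x, H x -> H (pairproj a b x)].
Proof.
move=> M_closed M_inv M_adj; have Hcl := model_space_closed; have Hb := @model_space_bshift.
have HH2 := closed_subspace_sub Hcl; have MH := closed_subspace_sub M_closed.
apply: bshift2_reducing => // [|x [Hx [xH x_orth]]].
  exact: M_adj (adjoint_compression2 Hcl Hb T_proj).
have Hbx : H (bshift (bshift x)) by apply/Hb/Hb.
split=> //; split=> [|y My]; first exact: HH2.
have HTTy : H (T (T y)) := MH _ (M_inv _ My).
rewrite (ipC (HH2 _ (MH _ My)) (HH2 _ Hbx)) -(ip_compression2 Hcl Hb T_proj (MH _ My) Hx).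
by rewrite -(ipC (HH2 _ HTTy) xH) x_orth//; exact: M_inv.
Qed.

Lemma compression2_irreducible :
  (exists z, in_disc z /\ m z <> m (- z)) ->
  (forall l, in_disc l -> m l = 0 -> exists z, in_disc z /\ z <> l /\ - z <> l /\
     m z / blaschke l z <> m (- z) / blaschke l (- z)) ->
  op_irreducible H (fun x => T (T x)).
Proof.
move=> m_not_even m_div_not_even M M_closed M_inv M_adj.
have [c mc] := Hinf_taylor_coefs mH; have cH := H2_taylor_coefs mH mc; have [cb mE] := mc.
have c_unit : ip c c = 1 by rewrite ip_self// (nrm2_shiftn_inner m_inner mc 0).
have c_orth k : ip c (iter k.+1 (@ushift R) c) = 0.
  exact: (ip_shiftn_inner m_inner mc (ltn0Sn k)).
have mNE z : in_disc z -> m (- z) = ev c (- z) by move=> z1; apply: mE; apply/in_discN.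
have [->|->|[a [b [ab1]]]] := compression2_reducing M_closed M_inv M_adj; [by left|by right|].
rewrite (model_space_coinv mH mc) => coinv_Q.
have [c_even|[l l1 c_sym]] := coinv_pairproj_symmetric cH c_unit c_orth ab1 coinv_Q.
  by have [z [z1]] := m_not_even; rewrite (mE _ z1) (mNE _ z1) c_even.
have ml0 : m l = 0 by rewrite mE// blaschke_symmetric_zero.
have [z [z1 [zl [Nzl]]]] := m_div_not_even _ l1 ml0.
by rewrite (mE _ z1) (mNE _ z1); case; exact: blaschke_symmetric_div.
Qed.

Lemma model_space_divisor (p q : R[i] -> R[i]) : Hinf q ->
  (forall z, in_disc z -> m z = p z * q z) -> model_space p `<=` H.
Proof.
move=> qH mpq x [xH x_orth]; have [c qc] := Hinf_taylor_coefs qH.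
split=> // y [yH [a [aH ya]]]; have [b [bH bE _]] := mul_taylor_coefs qH qc aH.
by apply: x_orth; split=> //; exists b; split=> // z z1; rewrite ya// mpq// bE// mulrA.
Qed.

Lemma compression2_Lat_neq_Lat'_divisor (p q : R[i] -> R[i]) : inner_fun p ->
  ~ (exists k, forall z, in_disc z -> p z = k) ->
  Hinf q -> (forall z, in_disc z -> m z = p z * q z) ->
  (forall z, in_disc z -> p z = p (- z)) ->
  Lat H (fun x => T (T x)) <> Lat' H (fun x => T (T x)).
Proof.
move=> p_inner p_nonconst qH mpq p_even; have pH : Hinf p := p_inner.1.
have [d pd] := Hinf_taylor_coefs pH; have dH := H2_taylor_coefs pH pd; have [db pE] := pd.
apply: (compression2_Lat_neq_Lat' model_space_closed model_space_bshift T_proj dH).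
- apply: (model_space_divisor qH mpq); rewrite (model_space_coinv pH pd).
  by apply: coinv_bshift_self => // k; exact: (ip_shiftn_inner p_inner pd (ltn0Sn k)).
- have d_alt : forall n, d n = 1 * ((-1) ^+ n * d n).
    have d_even z : in_disc z -> ev d z = 1 * ev d (- z).
      move=> z1; have Nz1 : in_disc (- z) by apply/in_discN.
      by rewrite mul1r -(pE _ z1) -(pE _ Nz1) p_even.
    exact/(ev_alt_of_dnbhs0 db)/nbhs_dnbhs/(filterS d_even)/near0_in_disc.
  move=> n n_odd; have /eqP := d_alt n; rewrite mul1r -signr_odd n_odd mulN1r.
  by rewrite -subr_eq0 opprK -mulr2n mulrn_eq0 => /eqP.
- apply: contra_notN p_nonconst => /eqP bd0; exists (d 0%N) => z z1.
  by rewrite pE// ev_recl// bd0 ev0 mulr0 addr0.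
Qed.

End ModelOperator.

Theorem theorem3 (R : realType) (m : R[i] -> R[i]) (T : cseq R -> cseq R) :
  inner_fun m ->
  dim_ge2 (model_space m) ->
  (forall x, model_space m x -> is_proj (model_space m) (ushift x) (T x)) ->
  (* (A) *)
  (exists lam, in_disc lam /\ m lam <> m (- lam)) ->
  (* (B) *)
  (forall lam0, in_disc lam0 -> m lam0 = 0 ->
     exists lam, in_disc lam /\ lam <> lam0 /\ - lam <> lam0 /\
       m lam / blaschke lam0 lam <> m (- lam) / blaschke lam0 (- lam)) ->
  (* (C) *)
  (exists p : R[i] -> R[i],
     inner_fun p /\
     ~ (exists c, forall z, in_disc z -> p z = c) /\
     (exists q, Hinf q /\ forall z, in_disc z -> m z = p z * q z) /\
     (forall z, in_disc z -> p z = p (- z))) ->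
  (* (D) and (E) *)
  op_irreducible (model_space m) (fun x => T (T x)) /\
  Lat (model_space m) (fun x => T (T x)) <> Lat' (model_space m) (fun x => T (T x)).
Proof.
move=> m_inner _ T_proj m_not_even m_div_not_even.
move=> [p [p_inner [p_nonconst [[q [qH mpq]] p_even]]]]; split.
  exact: compression2_irreducible m_inner T_proj m_not_even m_div_not_even.
exact: (compression2_Lat_neq_Lat'_divisor m_inner T_proj p_inner p_nonconst qH mpq p_even).
Qed.
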